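(* Let $D\subset\widehat{\mathbb{C}}$ be a simply connected domain having more than one boundary point, let $K=\widehat{\mathbb{C}}\setminus D$, and fix a conformal transformation $T$ of $D$ onto $\mathbb{D}=\{z\in\mathbb{C}:|z|<1\}$. Given $p\in\partial\mathbb{D}$ and $x\in\prod(p)$, we have $\mathrm{Imp}(p)\subset\overline{R_K}[x]$, where $\prod(p)$ and $\mathrm{Imp}(p)$ are the principal set and the impression of the prime end of $D$ corresponding to $p$ under $T$.
   Context: $\widehat{\mathbb{C}}$ is the extended complex plane. Prime ends. A half-open path in $D$ is a continuous map $\alpha:[0,1)\to D$. Its (final) limit set is the set of all $z\in\overline{D}$ such that $z=\lim_{n\to\infty}\alpha(t_n)$ for some increasing sequence $t_n\in(0,1)$ with $t_n\to1$; if the limit set is a single point, that point is called the endpoint of $\alpha$ (the same terms apply to paths in $\mathbb{D}$). With $T$ fixed, every prime end of $D$ corresponds to a point $p\in\partial\mathbb{D}$, and a half-open path $\alpha$ in $D$ possesses the prime end corresponding to $p$ if $T(\alpha)$ has endpoint $p$. It is known that among the half-open paths possessing a given prime end there is one whose limit set is maximal (contains the limit sets of all the others) and one whose limit set is minimal (is contained in the limit sets of all the others). The maximal limit set is the impression $\mathrm{Imp}(p)$ of the prime end, and the minimal limit set is its principal set $\prod(p)$, whose elements are called principal points. The relation $\overline{R_K}$. For two disjoint Jordan curves $J_1,J_2\subset\widehat{\mathbb{C}}$, $U(J_1,J_2)$ denotes the component of $\widehat{\mathbb{C}}\setminus(J_1\cup J_2)$ whose boundary is $J_1\cup J_2$ (an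 open annulus). The Schönflies relation $R_K$ on the compact set $K$ is the symmetric relation defined as follows: $x,y\in K$ are related under $R_K$ if either $x=y$, or there exist two disjoint Jordan curves $J_1\ni x$ and $J_2\ni y$ such that (1) $\overline{U(J_1,J_2)}\cap K$ has an infinite sequence of (distinct) components $P_n$ each intersecting both $J_1$ and $J_2$; and (2) the limit $P_\infty=\lim_{n\to\infty}P_n$ under the Hausdorff distance exists and contains $\{x,y\}$. $\overline{R_K}$ denotes the closure of $R_K$ as a subset of $K\times K$, and $\overline{R_K}[x]=\{y\in K:(x,y)\in\overline{R_K}\}$. *)

(* Defs.v *)
From HB Require Import structures.
From mathcomp Require Export all_boot all_order all_algebra.
From mathcomp Require Export complex.
From mathcomp Require Export all_classical all_reals all_analysis.
Export numFieldNormedType.Exports.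
Import Order.TTheory GRing.Theory Num.Theory.

Set Implicit Arguments.
Unset Strict Implicit.
Unset Printing Implicit Defensive.

Local Open Scope classical_set_scope.
Local Open Scope ring_scope.

(* R[i] is a normed module over itself, so that [derivable] over R[i] is
   complex differentiability. *)
HB.instance Definition _ (R : realType) := Vector.copy R[i] (R[i])^o.
HB.instance Definition _ (R : realType) := NormedModule.copy R[i] (R[i])^o.

Section topology.
Context {T : topologicalType}.
Implicit Types (A C U : set T).

Definition boundary A : set T := closure A `\` A°.

Definition is_component A C : Prop :=
  exists2 z, A z & C = connected_component A z.

Definition domain A : Prop := [/\ open A, connected A & A !=set0].

End topology.

Section paths.
Context {R : realType} {T : topologicalType}.
Implicit Types (D : set T) (a g : R -> T).

(* Every loop in D contracts in D to its base point, which stays fixed. *)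
Definition simply_connected D : Prop :=
  forall g, {within `[0, 1], continuous g} -> g @` `[0, 1] `<=` D ->
    g 0 = g 1 ->
  exists H : R * R -> T,
    [/\ {within `[0, 1] `*` `[0, 1], continuous H},
        H @` (`[0, 1] `*` `[0, 1]) `<=` D,
        forall t, t \in `[0, 1] -> H (t, 0) = g t,
        forall t, t \in `[0, 1] -> H (t, 1) = g 0 &
        forall s, s \in `[0, 1] -> H (0, s) = g 0 /\ H (1, s) = g 0].

Definition half_open_path D a : Prop :=
  {within `[0, 1[, continuous a} /\ a @` `[0, 1[ `<=` D.

Definition limit_set D a : set T :=
  [set z | closure D z /\ exists t : R^nat,
     [/\ forall n, t n \in `]0, 1[, {homo t : m n / (m < n)%N >-> m < n},
         t @ \oo --> (1 : R) & (a \o t) @ \oo --> z] ].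

Definition has_endpoint D a (p : T) : Prop := limit_set D a = [set p].

End paths.

Definition hausdorff_dist (R : realType) (T : Type) (d : T -> T -> R)
    (A B : set T) : \bar R :=
  maxe (ereal_sup [set ereal_inf [set (d a b)%:E | b in B] | a in A])
       (ereal_sup [set ereal_inf [set (d a b)%:E | a in A] | b in B]).

(* The extended complex plane; [None] is the point at infinity. *)
Definition riemann_sphere (R : realType) : Type :=
  one_point_compactification R[i].
HB.instance Definition _ (R : realType) :=
  Topological.copy (riemann_sphere R) (one_point_compactification R[i]).
HB.instance Definition _ (R : realType) := Pointed.on (riemann_sphere R).

Section sphere.
Context {R : realType}.
Local Notation Chat := (riemann_sphere R).
Local Notation normc := (@ComplexField.Normc.normc R).

Definition unit_disc : set R[i] := [set z | `|z| < 1].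
Definition unit_circle : set R[i] := [set z | `|z| = 1].

(* The chordal metric: Euclidean distance between stereographic images. *)
Definition chordal (x y : Chat) : R :=
  match x, y with
  | Some z, Some w =>
      2 * normc (z - w) /
        (Num.sqrt (1 + normc z ^+ 2) * Num.sqrt (1 + normc w ^+ 2))
  | Some z, None | None, Some z => 2 / Num.sqrt (1 + normc z ^+ 2)
  | None, None => 0
  end.

Definition inv_chart (w : R[i]) : Chat := if w == 0 then None else Some w^-1.

Definition complex_derivable_at (T : Chat -> R[i]) (x : Chat) : Prop :=
  match x with
  | Some z => derivable (fun w : R[i] => T (Some w)) z 1
  | None => derivable (T \o inv_chart) 0 1
  end.

Definition conformal_onto_disc (D : set Chat) (T : Chat -> R[i]) : Prop :=
  set_bij D unit_disc T /\ forall x, D x -> complex_derivable_at T x.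

Section prime_ends.
Variables (D : set Chat) (T : Chat -> R[i]).

Definition possesses_prime_end (a : R -> Chat) (p : R[i]) : Prop :=
  half_open_path D a /\ has_endpoint unit_disc (T \o a) p.

Definition is_impression (p : R[i]) (I : set Chat) : Prop :=
  (exists2 a, possesses_prime_end a p & limit_set D a = I) /\
  (forall a, possesses_prime_end a p -> limit_set D a `<=` I).

Definition is_principal_set (p : R[i]) (P : set Chat) : Prop :=
  (exists2 a, possesses_prime_end a p & limit_set D a = P) /\
  (forall a, possesses_prime_end a p -> P `<=` limit_set D a).

End prime_ends.

Definition jordan_curve (J : set Chat) : Prop :=
  exists f : R[i] -> Chat,
    [/\ {within unit_circle, continuous f}, set_inj unit_circle f &
        J = f @` unit_circle].

Definition annulus_between (J1 J2 U : set Chat) : Prop :=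
  is_component (~` (J1 `|` J2)) U /\ boundary U = J1 `|` J2.

Definition schoenflies_rel (K : set Chat) (x y : Chat) : Prop :=
  [/\ K x, K y &
    x = y \/
    exists J1 J2 U : set Chat,
      [/\ jordan_curve J1, jordan_curve J2, J1 `&` J2 = set0,
          annulus_between J1 J2 U & J1 x /\ J2 y /\
      exists (P : nat -> set Chat) (Poo : set Chat),
        [/\ injective P,
            forall n, is_component (closure U `&` K) (P n),
            forall n, P n `&` J1 !=set0 /\ P n `&` J2 !=set0,
            compact Poo /\
              hausdorff_dist chordal (P n) Poo @[n --> \oo] --> 0%E &
            [set x; y] `<=` Poo]]].

(* K being closed in every use, the closure in K x K is the trace on K x K of
   the closure in the square of the sphere. *)
Definition closed_schoenflies_class (K : set Chat) (x : Chat) : set Chat :=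
  [set y | [/\ K x, K y &
    closure [set q : Chat * Chat | schoenflies_rel K q.1 q.2] (x, y)]].

End sphere.

(* Main.v *)
Require Import Defs.
From mathcomp Require Import ring lra.
Import Order.TTheory GRing.Theory Num.Theory.
Set Implicit Arguments.
Unset Strict Implicit.
Unset Printing Implicit Defensive.
Local Open Scope classical_set_scope.
Local Open Scope ring_scope.
Notation normc := (@ComplexField.Normc.normc _).

(** Let [a] be a path which possesses the prime end [p] and whose limit set is
    the impression.  Since [x] is a principal point, the limit set of [a]
    contains [x] as well as the given point [y] of the impression; let
    [x <> y].  The homography [M] with [M 0 = x] and [M oo = y] carries the
    circles of radii [r1 < r2] about 0 to disjoint Jordan curves, and the ring
    between them to the annulus which these curves bound.  If infinitely many
    components of the part of the complement of [D] in the closed ring meet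
    both circles, then a subsequence of them converges (Blaschke's selection
    theorem, [blaschke]) and the limit relates a point of the small curve to a
    point of the large one ([crossing_components_schoenflies]).  As [r1] tends
    to 0 and [r2] to infinity these pairs converge to [(x, y)].

    So everything rests on [infinitely_many_crossings].  Suppose that only
    finitely many components cross the ring, and follow the path
    [alpha = M^-1 o a].  It is near 0 and near infinity at times arbitrarily
    close to 1, hence it crosses the ring infinitely often, without meeting the
    complement of [D].

    - Infinitely many of these strands lie in one component of the open ring
      minus the complement of [D] ([infinitely_many_strands]).  To separate
      [N + 2] strands one would need [N + 1] crossing components: each
      further point [v] of a strand, compared with a fixed one [v 0], has two
      logarithms of [(z - v) / (z - v 0)] on the obstacle, one obtained by
      moving [v] outwards and one by moving it inwards.  They differ by
      2 pi i times an integer on each crossing component.  An integer relation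
      among these [N + 1] vectors of length [N] makes a combined logarithm
      extend over the whole obstacle, and Eilenberg's criterion ([eilenberg])
      forbids this.

    - Such strands can therefore be connected in [D] inside the ring, so at
      a distance from [x], and late ones can also be connected in [D] close to
      the prime end, along [a] itself.  In the disc onto which [D] is mapped,
      a union theorem of Janiszewski's type ([joined_union]) replaces the two
      connections by one which has both properties at once ([strands_connect]), up to the factor [expR (-5)] in the distance
      from [x].  Its hypothesis is a Lindeloef type estimate
      ([finger_reaches_circle]): the part of the disc which is mapped close to
      [x] cannot stop inside the disc away from [p].

    - Concatenating these connections ([path_avoiding]) gives a path which
      possesses the prime end and stays away from [x], although [x] lies in the
      limit set of every such path.

    The tools are elementary complex analysis, built on Caratheodory's form of
    differentiability: Goursat's theorem, the mean value property, the maximum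
    modulus principle, and the lifting of logarithms along homotopies. *)

(** * Modulus, limits and continuity of complex functions *)

Section modulus.
Context {R : realType}.
Local Notation C := R[i].
Implicit Types (z w : C).

Lemma normcE z : `|z| = (normc z)%:C%C. Proof. by []. Qed.

Lemma normc_ge0 z : 0 <= normc z.
Proof. by case: z => a b; exact: sqrtr_ge0. Qed.

Lemma ler_normcD z w : normc (z + w) <= normc z + normc w.
Proof. by rewrite -lecR rmorphD /= -!normcE ler_normD. Qed.

Lemma normc_opp z : normc (- z) = normc z.
Proof. by apply: complexI; rewrite -!normcE normrN. Qed.

Lemma normcM z w : normc (z * w) = normc z * normc w.
Proof. exact: ComplexField.Normc.normcM. Qed.

Lemma normc0 : normc (0 : C) = 0. Proof. exact: ComplexField.Normc.normc0. Qed.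
Lemma normc1 : normc (1 : C) = 1. Proof. exact: ComplexField.Normc.normc1. Qed.

Lemma normcV z : normc z^-1 = (normc z)^-1.
Proof. exact: ComplexField.Normc.normcV. Qed.

Lemma normc_eq0 z : (normc z == 0) = (z == 0).
Proof. by apply/eqP/eqP => [/ComplexField.Normc.eq0_normc|->]; rewrite ?normc0. Qed.

Lemma normc_gt0 z : (0 < normc z) = (z != 0).
Proof. by rewrite lt0r normc_ge0 andbT normc_eq0. Qed.

Lemma distcC z w : normc (z - w) = normc (w - z).
Proof. by rewrite -normc_opp opprB. Qed.

Lemma lerB_distc z w : normc z - normc w <= normc (z - w).
Proof. by rewrite lerBlDr -[X in normc X <= _](subrK w) ler_normcD. Qed.

Lemma ler_distcD w z1 z2 : normc (z1 - z2) <= normc (z1 - w) + normc (w - z2).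
Proof. by rewrite (_ : z1 - z2 = (z1 - w) + (w - z2)) ?ler_normcD //; ring. Qed.

Lemma normc_real (a : R) : normc a%:C%C = `|a|.
Proof. by rewrite /ComplexField.Normc.normc /= expr0n /= addr0 sqrtr_sqr. Qed.

Lemma normc_imag (a : R) : normc (Complex 0 a) = `|a|.
Proof. by rewrite /ComplexField.Normc.normc /= expr0n /= add0r sqrtr_sqr. Qed.

Lemma normc_Re z : `|complex.Re z| <= normc z.
Proof. by have := normc_ge_Re z; rewrite normcE lecR. Qed.

Lemma normc_Im z : `|complex.Im z| <= normc z.
Proof.
have := normc_Re (z * 'i%C); rewrite ReiNIm normrN normcM.
by rewrite [normc 'i%C]normc_imag normr1 mulr1.
Qed.

Lemma normc_le_sum (a b : R) : normc (Complex a b) <= `|a| + `|b|.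
Proof.
have -> : Complex a b = a%:C%C + Complex 0 b.
  by apply/eqP; rewrite eq_complex /= addr0 add0r !eqxx.
by rewrite (le_trans (ler_normcD _ _))// normc_real normc_imag.
Qed.

Lemma normc_conj z : normc (conjc z) = normc z.
Proof. by case: z => a b /=; rewrite sqrrN. Qed.

(** The norm of [R[i]] takes its values in [R[i]]; from here on neighbourhoods
    are described by the real modulus [normc]. *)
Lemma nbhsCP z (A : set C) :
  nbhs z A <-> exists2 e : R, 0 < e & forall w, normc (w - z) < e -> A w.
Proof.
split.
  move=> /nbhs_normP[e /= e0 eA].
  have e0' : e = (complex.Re e)%:C%C.
    by case: e e0 {eA} => a b; rewrite ltcE /= => /andP[/eqP -> _].
  exists (complex.Re e); first by move: e0; rewrite ltcE /= => /andP[].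
  by move=> w we; apply: eA; rewrite /ball_ /= distrC e0' normcE ltcR.
move=> [e e0 eA]; apply/nbhs_normP; exists (e%:C%C); first by rewrite /= ltcR.
by move=> w; rewrite /ball_ /= distrC normcE ltcR => /eA.
Qed.

Lemma near_normc z (e : R) : 0 < e -> \forall w \near z, normc (w - z) < e.
Proof. by move=> e0; apply/nbhsCP; exists e. Qed.

Lemma cvgCP {T} (F : set_system T) {FF : Filter F} (f : T -> C) z :
  f @ F --> z <-> forall e : R, 0 < e -> \forall t \near F, normc (f t - z) < e.
Proof.
split; first by move=> + e e0 => /(_ [set w | normc (w - z) < e]) /=; apply; exact: near_normc.
move=> h A /nbhsCP[e e0 eA]; rewrite /= nbhs_simpl /=.
by apply: filterS (h e e0) => t; exact: eA.
Qed.

Lemma cvg_Re {T} (F : set_system T) {FF : Filter F} (f : T -> C) z :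
  f @ F --> z -> complex.Re (f x) @[x --> F] --> complex.Re z.
Proof.
move=> /cvgCP h; apply/cvgrPdist_lt => e e0; apply: filterS (h e e0) => t.
apply: le_lt_trans; rewrite distcC (le_trans _ (normc_Re _)) //.
by case: (f t) (z) => a b [c d].
Qed.

Lemma cvg_Im {T} (F : set_system T) {FF : Filter F} (f : T -> C) z :
  f @ F --> z -> complex.Im (f x) @[x --> F] --> complex.Im z.
Proof.
move=> /cvgCP h; apply/cvgrPdist_lt => e e0; apply: filterS (h e e0) => t.
apply: le_lt_trans; rewrite distcC (le_trans _ (normc_Im _)) //.
by case: (f t) (z) => a b [c d].
Qed.

Lemma cvg_normc {T} (F : set_system T) {FF : Filter F} (f : T -> C) z :
  f @ F --> z -> normc (f x) @[x --> F] --> normc z.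
Proof.
move=> /cvgCP h; apply/cvgrPdist_lt => e e0; apply: filterS (h e e0) => t.
apply: le_lt_trans; rewrite ler_norml; apply/andP; split.
  by rewrite lerNl opprB lerB_distc.
by rewrite distcC lerB_distc.
Qed.

Lemma cvg_Complex {T} (F : set_system T) {FF : Filter F} (f g : T -> R) (a b : R) :
  f @ F --> a -> g @ F --> b -> Complex (f x) (g x) @[x --> F] --> Complex a b.
Proof.
move=> /cvgrPdist_lt fa /cvgrPdist_lt gb; apply/cvgCP => e e0.
have e2 : 0 < e / 2 by rewrite divr_gt0.
near=> t; rewrite distcC (le_lt_trans (normc_le_sum _ _)) // [ltRHS]splitr ltrD //.
  by near: t; exact: fa.
by near: t; exact: gb.
Unshelve. all: by end_near. Qed.

Lemma cvg_real {T} (F : set_system T) {FF : Filter F} (f : T -> R) (a : R) :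
  f @ F --> a -> ((f x)%:C)%C @[x --> F] --> (a%:C)%C.
Proof. by move=> fa; apply: cvg_Complex => //; exact: cvg_cst. Qed.

Lemma cvg_conjc {T} (F : set_system T) {FF : Filter F} (f : T -> C) z :
  f @ F --> z -> conjc (f x) @[x --> F] --> conjc z.
Proof.
move=> /cvgCP h; apply/cvgCP => e e0; apply: filterS (h e e0) => t.
by rewrite -rmorphB normc_conj.
Qed.

Lemma normc_cont : continuous (fun z : C => normc z).
Proof. by move=> z; exact: (@cvg_normc _ (nbhs z) _ id z cvg_id). Qed.
Lemma Re_cont : continuous (@complex.Re R).
Proof. by move=> z; exact: (@cvg_Re _ (nbhs z) _ id z cvg_id). Qed.
Lemma Im_cont : continuous (@complex.Im R).
Proof. by move=> z; exact: (@cvg_Im _ (nbhs z) _ id z cvg_id). Qed.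

Lemma hausdorffC : hausdorff_space C.
Proof. exact: (@norm_hausdorff C C). Qed.

Lemma bounded_closed_compactC (A : set C) (M : R) :
  closed A -> (forall z, A z -> normc z <= M) -> compact A.
Proof.
move=> cA AM.
pose B : set (R * R) := `[- M, M] `*` `[- M, M].
pose mk (u : R * R) : C := Complex u.1 u.2.
have cB : compact (mk @` B).
  apply: continuous_compact.
    apply: continuous_subspaceT => u; apply: cvg_Complex.
      exact: cvg_fst.
    exact: cvg_snd.
  by apply: compact_setX; exact: segment_compact.
apply: subclosed_compact cA cB _ => -[a b] /AM abM; exists (a, b) => //=.
split; rewrite /= in_itv /= -ler_norml.
  exact: le_trans (normc_Re (Complex a b)) abM.
exact: le_trans (normc_Im (Complex a b)) abM.
Qed.

Lemma compact_disc (r : R) : compact [set z : C | normc z <= r].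
Proof.
apply: (@bounded_closed_compactC _ r) => //.
apply: (@closed_comp C R (fun v : C => normc v) [set x : R | x <= r]); last exact: closed_le.
by move=> w _; exact: (@normc_cont w).
Qed.

Lemma compact_closedC (A : set C) : compact A -> closed A.
Proof. exact: compact_closed hausdorffC. Qed.

Lemma compact_boundedC (A : set C) : compact A -> exists2 M : R, 0 < M & forall z, A z -> normc z < M.
Proof.
move=> cA; have [->|/set0P A0] := eqVneq A set0.
  by exists 1.
have cn : {within A, continuous (fun z : C => normc z)}.
  by apply: continuous_subspaceT; exact: normc_cont.
have [c _ cM] := compact_EVT_max A0 cA cn.
exists (normc c + 1); first by rewrite ltr_pwDr // normc_ge0.
by move=> z Az; rewrite ltr_pwDr // cM // inE.
Qed.

Section limits.
Context {T : Type} {F : set_system T} {FF : Filter F}.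
Implicit Types (f g : T -> C).

Lemma cvgcD f g z w : f @ F --> z -> g @ F --> w -> f x + g x @[x --> F] --> z + w.
Proof.
move=> /cvgCP fz /cvgCP gw; apply/cvgCP => e e0.
have e2 : 0 < e / 2 by rewrite divr_gt0.
apply: filterS2 (fz _ e2) (gw _ e2) => t h1 h2.
rewrite (_ : _ - _ = (f t - z) + (g t - w)); last by ring.
by rewrite (le_lt_trans (ler_normcD _ _)) // [ltRHS]splitr ltrD.
Qed.

Lemma cvgcN f z : f @ F --> z -> - f x @[x --> F] --> - z.
Proof.
move=> /cvgCP fz; apply/cvgCP => e e0; apply: filterS (fz _ e0) => t.
by rewrite -opprD normc_opp.
Qed.

Lemma cvgcB f g z w : f @ F --> z -> g @ F --> w -> f x - g x @[x --> F] --> z - w.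
Proof. by move=> fz gw; exact: cvgcD fz (cvgcN gw). Qed.

Lemma cvgcM f g z w : f @ F --> z -> g @ F --> w -> f x * g x @[x --> F] --> z * w.
Proof. by move=> fz gw; exact: (cvgM fz gw). Qed.

Lemma cvgcV f z : z != 0 -> f @ F --> z -> (f x)^-1 @[x --> F] --> z^-1.
Proof. by move=> z0 fz; exact: (cvgV z0 fz). Qed.

Lemma cvgcc z : (fun=> z) @ F --> z.
Proof. exact: cvg_cst. Qed.

Lemma cvgc_sum (I : Type) (r : seq I) (h : I -> T -> C) (l : I -> C) :
  (forall i, h i @ F --> l i) -> \sum_(i <- r) h i x @[x --> F] --> \sum_(i <- r) l i.
Proof.
move=> hl; elim: r => [|i r IH].
  by under eq_fun do rewrite big_nil; rewrite big_nil; exact: cvgcc.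
rewrite (_ : (fun x => _) = fun x => h i x + \sum_(j <- r) h j x); last first.
  by apply/funext => x; rewrite big_cons.
by rewrite big_cons; exact: (cvgcD (hl i) IH).
Qed.

Lemma cvgc_prod (I : Type) (r : seq I) (h : I -> T -> C) (l : I -> C) :
  (forall i, h i @ F --> l i) -> \prod_(i <- r) h i x @[x --> F] --> \prod_(i <- r) l i.
Proof.
move=> hl; elim: r => [|i r IH].
  by under eq_fun do rewrite big_nil; rewrite big_nil; exact: cvgcc.
rewrite (_ : (fun x => _) = fun x => h i x * \prod_(j <- r) h j x); last first.
  by apply/funext => x; rewrite big_cons.
by rewrite big_cons; exact: (cvgcM (hl i) IH).
Qed.

End limits.

Section continuity_at.
Context {T : topologicalType}.
Implicit Types (f g : T -> C) (x : T).

(** The prefix [cc] marks continuity at a point of complex-valued maps on an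
    arbitrary space, and [rc] that of real-valued ones. *)
Lemma ccD f g x : {for x, continuous f} -> {for x, continuous g} ->
  {for x, continuous (fun t => f t + g t)}.
Proof. exact: (@cvgcD _ (nbhs x)). Qed.
Lemma ccN f x : {for x, continuous f} -> {for x, continuous (fun t => - f t)}.
Proof. exact: (@cvgcN _ (nbhs x)). Qed.
Lemma ccB f g x : {for x, continuous f} -> {for x, continuous g} ->
  {for x, continuous (fun t => f t - g t)}.
Proof. exact: (@cvgcB _ (nbhs x)). Qed.
Lemma ccM f g x : {for x, continuous f} -> {for x, continuous g} ->
  {for x, continuous (fun t => f t * g t)}.
Proof. exact: (@cvgcM _ (nbhs x)). Qed.
Lemma ccV f x : f x != 0 -> {for x, continuous f} -> {for x, continuous (fun t => (f t)^-1)}.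
Proof. exact: (@cvgcV _ (nbhs x)). Qed.
Lemma cc_cst z x : {for x, continuous (fun _ : T => z)}.
Proof. exact: (@cvgcc _ (nbhs x)). Qed.
Lemma cc_conj f x : {for x, continuous f} -> {for x, continuous (fun t => conjc (f t))}.
Proof. exact: (@cvg_conjc _ (nbhs x)). Qed.
Lemma cc_Complex (f g : T -> R) x : {for x, continuous f} -> {for x, continuous g} ->
  {for x, continuous (fun t => Complex (f t) (g t))}.
Proof. exact: (@cvg_Complex _ (nbhs x)). Qed.
Lemma cc_Re f x : {for x, continuous f} -> {for x, continuous (fun t => complex.Re (f t))}.
Proof. exact: (@cvg_Re _ (nbhs x)). Qed.
Lemma cc_Im f x : {for x, continuous f} -> {for x, continuous (fun t => complex.Im (f t))}.
Proof. exact: (@cvg_Im _ (nbhs x)). Qed.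
Lemma cc_normc f x : {for x, continuous f} -> {for x, continuous (fun t => normc (f t))}.
Proof. exact: (@cvg_normc _ (nbhs x)). Qed.
Lemma cc_real (f : T -> R) x : {for x, continuous f} -> {for x, continuous (fun t => ((f t)%:C)%C)}.
Proof. exact: (@cvg_real _ (nbhs x)). Qed.
Lemma ccP f x : {for x, continuous f} <->
  forall e : R, 0 < e -> \forall t \near x, normc (f t - f x) < e.
Proof. exact: (@cvgCP _ (nbhs x)). Qed.
End continuity_at.

Lemma cc_id z : {for z, continuous (fun w : C => w)}.
Proof. exact: cvg_id. Qed.

End modulus.

Section composition.
Context {T U V : topologicalType}.
Lemma cc_comp (f : T -> U) (g : U -> V) x : {for x, continuous f} -> {for f x, continuous g} ->
  {for x, continuous (fun t => g (f t))}.
Proof. by move=> cf cg; exact: (@continuous_comp _ _ _ f g x). Qed.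
Lemma cc_near (f g : T -> U) x : (\forall t \near x, f t = g t) ->
  {for x, continuous g} -> {for x, continuous f}.
Proof.
move=> fg cg; rewrite /prop_for /continuous_at (nbhs_singleton fg).
by apply: cvg_trans cg; exact: near_eq_cvg (filterS (fun t (h : f t = g t) => esym h) fg).
Qed.
End composition.

(** * The complex exponential and logarithms *)

Section exponential.
Context {R : realType}.
Local Notation C := R[i].
Implicit Types (z w : C).
Local Notation Re := complex.Re.
Local Notation Im := complex.Im.

Lemma ceqP z w : Re z = Re w -> Im z = Im w -> z = w.
Proof. by case: z w => a b [c d] /= -> ->. Qed.

Lemma ReD z w : Re (z + w) = Re z + Re w. Proof. by case: z w => a b []. Qed.
Lemma ImD z w : Im (z + w) = Im z + Im w. Proof. by case: z w => a b []. Qed.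
Lemma ReN z : Re (- z) = - Re z. Proof. by case: z. Qed.
Lemma ImN z : Im (- z) = - Im z. Proof. by case: z. Qed.
Lemma ReM z w : Re (z * w) = Re z * Re w - Im z * Im w. Proof. by case: z w => a b []. Qed.
Lemma ImM z w : Im (z * w) = Re z * Im w + Im z * Re w. Proof. by case: z w => a b []. Qed.
Definition reim := (ReD, ImD, ReN, ImN, ReM, ImM).

Definition expC z : C := Complex (expR (Re z) * cos (Im z)) (expR (Re z) * sin (Im z)).

Lemma expC0 : expC 0 = 1.
Proof. by rewrite /expC /= expR0 cos0 sin0 mulr1 mulr0. Qed.

Lemma expCD z w : expC (z + w) = expC z * expC w.
Proof. by apply: ceqP; rewrite /expC !reim /= expRD ?cosD ?sinD; ring. Qed.

Lemma normc_expC z : normc (expC z) = expR (Re z).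
Proof.
rewrite /expC /ComplexField.Normc.normc !exprMn -mulrDr cos2Dsin2 mulr1 sqrtr_sqr.
by rewrite ger0_norm // expR_ge0.
Qed.

Lemma expC_neq0 z : expC z != 0.
Proof. by rewrite -normc_gt0 normc_expC expR_gt0. Qed.

Lemma expCN z : expC (- z) = (expC z)^-1.
Proof.
apply: (mulfI (expC_neq0 z)); rewrite -expCD subrr expC0 mulfV //.
exact: expC_neq0.
Qed.

Lemma expCB z w : expC (z - w) = expC z / expC w.
Proof. by rewrite expCD expCN. Qed.

Lemma expCMn z n : expC (z *+ n) = expC z ^+ n.
Proof. by elim: n => [|n IH]; rewrite ?mulr0n ?expC0 // mulrS exprS expCD IH. Qed.

Lemma expCMz z (n : int) : expC (z *~ n) = expC z ^ n.
Proof.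
case: n => n; first by rewrite -pmulrn expCMn.
by rewrite NegzE mulrNz -pmulrn expCN expCMn -exprnN.
Qed.

Lemma expC_sum I (r : seq I) (P : pred I) (F : I -> C) :
  expC (\sum_(i <- r | P i) F i) = \prod_(i <- r | P i) expC (F i).
Proof. by apply: (big_morph expC expCD expC0). Qed.

Lemma cvg_expC {T} (F : set_system T) {FF : Filter F} (f : T -> C) z :
  f @ F --> z -> expC (f x) @[x --> F] --> expC z.
Proof.
move=> fz; apply: cvg_Complex; apply: cvgM.
- by apply: (cvg_comp (fun x => Re (f x)) expR); [exact: cvg_Re fz|exact: continuous_expR].
- by apply: (cvg_comp (fun x => Im (f x)) cos); [exact: cvg_Im fz|exact: continuous_cos].
- by apply: (cvg_comp (fun x => Re (f x)) expR); [exact: cvg_Re fz|exact: continuous_expR].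
- by apply: (cvg_comp (fun x => Im (f x)) sin); [exact: cvg_Im fz|exact: continuous_sin].
Qed.

Lemma expC_cont : continuous expC.
Proof. by move=> z; exact: (@cvg_expC _ (nbhs z) _ id z cvg_id). Qed.

Lemma cc_expC {T : topologicalType} (f : T -> C) x : {for x, continuous f} ->
  {for x, continuous (fun t => expC (f t))}.
Proof. exact: (@cvg_expC _ (nbhs x)). Qed.

Definition twopii : C := Complex 0 (pi *+ 2).

Lemma expC_twopii : expC twopii = 1.
Proof. by rewrite /expC /= expR0 cos2pi sin2pi mulr1 mulr0. Qed.

Lemma normc_twopii : normc twopii = pi *+ 2.
Proof. by rewrite normc_imag ger0_norm // mulrn_wge0 // pi_ge0. Qed.

Lemma twopii_neq0 : twopii != 0.
Proof. by rewrite -normc_gt0 normc_twopii mulrn_wgt0 // pi_gt0. Qed.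

Lemma expC_eq1 z : expC z = 1 -> exists k : int, z = twopii *~ k.
Proof.
move=> ez; have Rz : Re z = 0.
  by apply: (@expR_inj R); rewrite expR0 -normc_expC ez normc1.
have p2 : (0 : R) < pi *+ 2 by rewrite mulrn_wgt0 // pi_gt0.
pose k := Num.floor (Im z / (pi *+ 2)).
exists k; pose b := Im z - (pi *+ 2) * k%:~R.
have bE : z - twopii *~ k = Complex 0 b.
  have kE : (k%:~R : C) = ((k%:~R : R)%:C)%C by rewrite rmorph_int.
  by apply: ceqP; rewrite !reim ?Rz -mulrzr !reim kE /= /b; ring.
have eb : expC (Complex 0 b) = 1.
  by rewrite -bE expCB ez expCMz expC_twopii exp1rz divr1.
have cb : cos b = 1.
  by have := congr1 (@complex.Re R) eb; rewrite /expC /= expR0 mul1r.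
have /andP[b0 b1] : 0 <= b < pi *+ 2.
  have /andP[k1 k2] := real_floor_itv (num_real (Im z / (pi *+ 2))).
  rewrite /b subr_ge0 ltrBlDr; apply/andP; split.
    by rewrite mulrC -ler_pdivlMr.
  rewrite -{1}[pi *+ 2]mulr1 -mulrDr mulrC -ltr_pdivrMr //.
  by rewrite -[1]/(1%:~R) addrC -rmorphD.
suff b00 : b = 0.
  by apply/eqP; rewrite -subr_eq0 bE b00.
have [bpi|bpi] := lerP b pi.
  apply: cos_inj; rewrite ?cos0 // in_itv /= ?lexx ?pi_ge0 //.
  by rewrite b0.
exfalso; have : cos (b - pi) = cos pi.
  by rewrite cosB cospi sinpi mulr0 addr0 cb mul1r.
move/cos_inj; rewrite !in_itv /= pi_ge0 lexx subr_ge0 (ltW bpi) lerBlDr.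
by rewrite -mulr2n (ltW b1) => /(_ isT isT) bb; move: b1; rewrite mulr2n -{1}bb subrK ltxx.
Qed.

(** The kernel of the exponential is discrete: this is what makes logarithms
    unique up to a constant. *)
Lemma expC_eq1_small z : expC z = 1 -> normc z < 1 -> z = 0.
Proof.
move=> /expC_eq1[k ->]; have [->|k0] := eqVneq k 0; first by rewrite mulr0z.
rewrite -mulrzr normcM normc_twopii => h; exfalso; move: h; apply/negP; rewrite -leNgt.
have -> : (k%:~R : C) = ((k%:~R : R)%:C)%C by rewrite rmorph_int.
rewrite normc_real -[leLHS]mulr1 ler_pM //.
  have := @pi_ge2 R; rewrite mulr2n; lra.
by rewrite -intr_norm -[1]/(1%:~R) ler_int -gtz0_ge1 normr_gt0.
Qed.

(** The principal logarithm, meaningful on the right half-plane only. *)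
Definition logC z : C := Complex (ln (normc z)) (atan (Im z / Re z)).

Lemma logCK z : 0 < Re z -> expC (logC z) = z.
Proof.
case: z => a b /= a0; rewrite /logC /expC /=.
have n2 : 0 < a ^+ 2 + b ^+ 2 by rewrite ltr_pwDl ?sqr_ge0 // exprn_gt0.
rewrite lnK ?posrE ?sqrtr_gt0 //.
have ca : cos (atan (b / a)) = a / Num.sqrt (a ^+ 2 + b ^+ 2).
  rewrite cos_atan; have -> : 1 + (b / a) ^+ 2 = (a ^+ 2 + b ^+ 2) / a ^+ 2.
    by rewrite expr_div_n mulrDl divff // sqrf_eq0 gt_eqF.
  rewrite sqrtrM ?ltW // sqrtrV ?sqr_ge0 // sqrtr_sqr gtr0_norm //.
  by rewrite invfM invrK mulrC.
have s0 : Num.sqrt (a ^+ 2 + b ^+ 2) != 0 by rewrite gt_eqF // sqrtr_gt0.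
have sa : sin (atan (b / a)) = b / Num.sqrt (a ^+ 2 + b ^+ 2).
  have := atanK (b / a); rewrite /tan ca => /(canRL (divfK _)) ->; last first.
    by rewrite mulf_neq0 ?invr_eq0 // gt_eqF.
  by field; rewrite s0 /= gt_eqF.
by rewrite ca sa; apply: ceqP => /=; field.
Qed.

Lemma logC1 : logC 1 = 0.
Proof. by rewrite /logC normc1 ln1 /= mul0r atan0. Qed.

Lemma cvg_logC {T} (F : set_system T) {FF : Filter F} (f : T -> C) z : 0 < Re z ->
  f @ F --> z -> logC (f x) @[x --> F] --> logC z.
Proof.
move=> z0 fz; apply: cvg_Complex.
  apply: (cvg_comp (fun x => normc (f x)) (@ln R)); first exact: cvg_normc fz.
  by apply: continuous_ln; rewrite normc_gt0; apply/eqP => zz; move: z0; rewrite zz ltxx.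
apply: (cvg_comp (fun x => Im (f x) / Re (f x)) (@atan R)); last exact: continuous_atan.
apply: cvgM; first exact: cvg_Im fz.
by apply: cvgV; [rewrite gt_eqF|exact: cvg_Re fz].
Qed.

Lemma cc_logC {T : topologicalType} (f : T -> C) x : 0 < Re (f x) -> {for x, continuous f} ->
  {for x, continuous (fun t => logC (f t))}.
Proof. by move=> h; exact: (@cvg_logC _ (nbhs x)). Qed.

Lemma Re_gt0_near1 z : normc (z - 1) < 1 -> 0 < Re z.
Proof.
move=> h; have := le_lt_trans (normc_Re _) h; rewrite !reim /= ltr_norml => /andP[+ _].
by rewrite ltrBrDr addrC subrr.
Qed.

Lemma expC_surj w : w != 0 -> exists z, expC z = w.
Proof.
move=> w0; have [h|h|h] := ltrgt0P (Re w).
- by exists (logC w); exact: logCK.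
- exists (logC (- w) + Complex 0 pi); rewrite expCD logCK ?reim ?oppr_gt0 //.
  by rewrite /expC /= expR0 cospi sinpi mulr0 mul1r; apply: ceqP; rewrite !reim /=; ring.
- have eI s : expC (Complex 0 (s * (pi / 2))) = Complex (cos (s * (pi / 2))) (sin (s * (pi / 2))).
    by rewrite /expC /= expR0 !mul1r.
  have wE : w = Complex 0 (Im w) by apply: ceqP.
  have i0 : Im w != 0 by apply: contra_neq w0 => i0; rewrite wE i0.
  have [i1|i1|/eqP] := ltrgt0P (Im w); last by rewrite (negbTE i0).
    exists (Complex (ln (Im w)) (pi / 2)).
    by rewrite /expC /= cos_pihalf sin_pihalf lnK ?posrE // mulr0 mulr1 -wE.
  exists (Complex (ln (- Im w)) (- (pi / 2))).
  rewrite /expC /= cosN sinN cos_pihalf sin_pihalf lnK ?posrE ?oppr_gt0 //.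
  by rewrite mulr0 mulrN1 opprK -wE.
Qed.

End exponential.

(** * Integrals of continuous real functions *)

Section real_integral.
Context {R : realType}.
Notation mu := (@lebesgue_measure R).
Implicit Types (f g : R -> R) (a b c : R).

(** Continuity of [f] as a function on the whole space at every point of [A];
    this is stronger than continuity within [A]. *)
Definition cont_on (T U : topologicalType) (A : set T) (f : T -> U) :=
  forall x, A x -> {for x, continuous f}.

Definition rint f a b : R := \int[mu]_(x in `[a, b]) f x.

Lemma cont_on_integrable f a b : cont_on `[a, b] f -> mu.-integrable `[a, b] (EFin \o f).
Proof.
move=> cf; apply: continuous_compact_integrable; first exact: segment_compact.
by apply: continuous_in_subspaceT => x; rewrite inE => /cf.
Qed.

Lemma cont_on_sub (T U : topologicalType) (A B : set T) (f : T -> U) : B `<=` A -> cont_on A f -> cont_on B f.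
Proof. by move=> BA cf x /BA/cf. Qed.

Lemma mu_itvcc a b : a <= b -> fine (mu `[a, b]) = b - a.
Proof.
rewrite lebesgue_measure_itv /= lte_fin; have [ab|//|->] := ltgtP a b; last by rewrite subrr.
by rewrite -EFinB.
Qed.

Lemma rint_cst (k : R) a b : a <= b -> rint (fun=> k) a b = k * (b - a).
Proof. by move=> ab; rewrite /rint Rintegral_cst // mu_itvcc. Qed.

Lemma rintD f g a b : cont_on `[a, b] f -> cont_on `[a, b] g ->
  rint (fun x => f x + g x) a b = rint f a b + rint g a b.
Proof. by move=> cf cg; rewrite /rint RintegralD //; exact: cont_on_integrable. Qed.

Lemma rintZ (k : R) f a b : cont_on `[a, b] f ->
  rint (fun x => k * f x) a b = k * rint f a b.
Proof. by move=> cf; rewrite /rint RintegralZl //; exact: cont_on_integrable. Qed.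

Lemma rint_chasles f a b c : a <= c <= b -> cont_on `[a, b] f ->
  rint f a b = rint f a c + rint f c b.
Proof.
move=> /andP[ac cb] cf.
have fi : mu.-integrable `[a, b] (EFin \o f) by exact: cont_on_integrable.
have := @Rintegral_itvB R f (BLeft a) (BRight b) c fi.
rewrite !bnd_simp => /(_ ac cb) h.
rewrite /rint -[X in _ + X]Rintegral_itv_obnd_cbnd; first by rewrite -h addrC subrK.
by apply: integrableS fi => //; apply: subset_itv; rewrite bnd_simp.
Qed.

Lemma rint_le f g a b : cont_on `[a, b] f -> cont_on `[a, b] g ->
  (forall x, a <= x <= b -> f x <= g x) -> rint f a b <= rint g a b.
Proof.
move=> cf cg fg; apply: le_Rintegral.
- exact: measurable_itv.
- exact: cont_on_integrable.
- exact: cont_on_integrable.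
by move=> x; rewrite /= in_itv /= => /fg.
Qed.

Lemma rint_bound f a b (M : R) : a <= b -> cont_on `[a, b] f ->
  (forall x, a <= x <= b -> `|f x| <= M) -> `|rint f a b| <= M * (b - a).
Proof.
move=> ab cf fM; rewrite ler_norml; apply/andP; split.
  rewrite -mulNr -rint_cst //; apply: rint_le => // [x _|x /fM]; first exact: cst_continuous.
  by rewrite ler_norml => /andP[].
rewrite -rint_cst //; apply: rint_le => // [x _|x /fM]; first exact: cst_continuous.
by rewrite ler_norml => /andP[].
Qed.

Lemma rint_eq f g a b : (forall x, a <= x <= b -> f x = g x) -> rint f a b = rint g a b.
Proof.
by move=> fg; apply: eq_Rintegral => x; rewrite inE /= in_itv /= => /fg.
Qed.

Lemma rint_id a b : a <= b -> rint id a b = (b ^+ 2 - a ^+ 2) / 2.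
Proof.
rewrite le_eqVlt => /predU1P[->|ab].
  rewrite /rint set_itv1 Rintegral_set1; lra.
pose F (x : R) := x ^+ 2 / 2.
have dF x : is_derive x (1 : R) F x.
  have -> : F = (2^-1 : R) *: (@GRing.exp R)^~ 2 by apply/funext => y; rewrite /F /= mulrC.
  by apply: is_derive_eq; rewrite /GRing.scale /=; field.
rewrite /rint /Rintegral; have := @continuous_FTC2 R id F a b ab; rewrite /= => -> //.
- by rewrite -EFinB /F mulrBl.
- by apply: continuous_subspaceT => x; exact: cvg_id.
- have cF x : {for x, continuous F}.
    by apply: differentiable_continuous; apply/derivable1_diffP; exact: ex_derive.
  split; [by move=> x _; exact: ex_derive|exact/cvg_at_right_filter/cF|].
  exact/cvg_at_left_filter/cF.
- by move=> x _; rewrite derive1E; apply: derive_val.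
Qed.
End real_integral.

(** * Complex differentiability *)

Section complex_derivative.
Context {R : realType}.
Local Notation C := R[i].
Implicit Types (f g h : C -> C) (z w : C).
Local Notation Re := complex.Re.
Local Notation Im := complex.Im.

(** Caratheodory's form of complex differentiability: the difference quotient
    extends continuously to [z]. It makes the chain and product rules and the
    passage to the real integrals below purely algebraic. *)
Definition cdiff f z := exists2 q : C -> C, {for z, continuous q} &
  forall w, f w - f z = q w * (w - z).

Lemma cdiff_cont f z : cdiff f z -> {for z, continuous f}.
Proof.
move=> [q cq qE].
have : {for z, continuous (fun w => q w * (w - z) + f z)}.
  apply: ccD; last exact: cc_cst.
  apply: ccM; first exact: cq.
  by apply: ccB; [exact: cc_id|exact: cc_cst].
rewrite (_ : (fun w => _ + _) = f) //.
by apply/funext => w; rewrite -qE subrK.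
Qed.

Lemma cdiff_cst (k : C) z : cdiff (fun=> k) z.
Proof. by exists (fun=> 0); [exact: cc_cst|move=> w; rewrite subrr mul0r]. Qed.

Lemma cdiff_id z : cdiff id z.
Proof. by exists (fun=> 1); [exact: cc_cst|move=> w; rewrite mul1r]. Qed.

Lemma cdiffD f g z : cdiff f z -> cdiff g z -> cdiff (fun w => f w + g w) z.
Proof.
move=> [q cq qE] [r cr rE]; exists (fun w => q w + r w); first exact: (ccD cq cr).
by move=> w; rewrite mulrDl -qE -rE; ring.
Qed.

Lemma cdiffM f g z : cdiff f z -> cdiff g z -> cdiff (fun w => f w * g w) z.
Proof.
move=> df [r cr rE]; have cf := cdiff_cont df; case: df => q cq qE.
exists (fun w => f w * r w + g z * q w).
  by apply: ccD; apply: ccM; [exact: cf|exact: cr|exact: cc_cst|exact: cq].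
move=> w; rewrite mulrDl -!mulrA -qE -rE; ring.
Qed.

Lemma cdiffN f z : cdiff f z -> cdiff (fun w => - f w) z.
Proof.
move=> [q cq qE]; exists (fun w => - q w); first exact: (ccN cq).
by move=> w; rewrite mulNr -qE opprB opprK addrC.
Qed.

Lemma cdiffB f g z : cdiff f z -> cdiff g z -> cdiff (fun w => f w - g w) z.
Proof. by move=> df dg; apply: cdiffD => //; exact: cdiffN. Qed.

Lemma cdiff_comp f g z : cdiff g z -> cdiff f (g z) -> cdiff (f \o g) z.
Proof.
move=> dg [q cq qE]; have cg := cdiff_cont dg; case: dg => r cr rE.
exists (fun w => q (g w) * r w); last by move=> w; rewrite -mulrA -rE -qE.
by apply: ccM; [exact: (@cc_comp _ _ _ g q _ cg cq)|exact: cr].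
Qed.

(** Schwarz reflection. *)
Lemma cdiff_conj f z : cdiff f (conjc z) -> cdiff (fun w => conjc (f (conjc w))) z.
Proof.
move=> [q cq qE]; exists (fun w => conjc (q (conjc w))).
  apply: cc_conj; apply: (@cc_comp _ _ _ (@conjc R) q _ _ cq).
  by apply: cc_conj; exact: cc_id.
by move=> w; rewrite -rmorphB qE rmorphM rmorphB /= !conjcK.
Qed.

Lemma cdiff_prod (I : Type) (s : seq I) (F : I -> C -> C) z :
  (forall i, cdiff (F i) z) -> cdiff (fun w => \prod_(i <- s) F i w) z.
Proof.
move=> dF; elim: s => [|i s IH].
  rewrite (_ : (fun _ => _) = fun=> 1); first exact: cdiff_cst.
  by apply/funext => w; rewrite big_nil.
rewrite (_ : (fun _ => _) = fun w => F i w * \prod_(i <- s) F i w); first exact: cdiffM.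
by apply/funext => w; rewrite big_cons.
Qed.

Lemma cdiff_intro f z l :
  (forall e : R, 0 < e -> \forall w \near z,
     normc (f w - f z - l * (w - z)) <= e * normc (w - z)) -> cdiff f z.
Proof.
move=> h; exists (fun w => if w == z then l else (f w - f z) / (w - z)).
  apply/ccP => e e0; rewrite eqxx.
  have e2 : 0 < e / 2 by rewrite divr_gt0.
  apply: filterS (h _ e2) => w; case: ifPn => [_ _|wz].
    by rewrite subrr normc0.
  have wz0 : w - z != 0 by rewrite subr_eq0.
  have -> : (f w - f z) / (w - z) - l = (f w - f z - l * (w - z)) / (w - z) by field.
  rewrite normcM normcV => le1; rewrite ltr_pdivrMr ?normc_gt0 //.
  by rewrite (le_lt_trans le1) // ltr_pM2r ?normc_gt0 // ltr_pdivrMr // mulr_natr mulr2n ltrDl.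
move=> w; case: eqP => [->|/eqP wz]; first by rewrite !subrr mulr0.
by rewrite divfK // subr_eq0.
Qed.

Lemma cdiff_near f g z : (\forall w \near z, f w = g w) -> cdiff g z -> cdiff f z.
Proof.
move=> fg [q cq qE]; have fz := nbhs_singleton fg.
apply: (@cdiff_intro _ _ (q z)) => e e0.
move/ccP : (cq) => /(_ e e0) h; apply: filterS2 fg h => w -> qw.
by rewrite fz qE -mulrBl normcM ler_wpM2r ?normc_ge0 // ltW.
Qed.

Lemma cdiff_inv f z : f z != 0 -> cdiff f z -> cdiff (fun w => (f w)^-1) z.
Proof.
move=> fz0 df; have cf := cdiff_cont df; case: df => q cq qE.
have fw0 : \forall w \near z, f w != 0.
  move/ccP : cf => /(_ (normc (f z))); rewrite normc_gt0 => /(_ fz0).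
  apply: filterS => w; apply: contraTN => /eqP ->.
  by rewrite sub0r normc_opp ltxx.
pose r w := - q w / (f w * f z).
apply: (@cdiff_near _ (fun w => (f z)^-1 + r w * (w - z))).
  apply: filterS fw0 => w fw; rewrite /r mulrAC mulNr -qE.
  by field; rewrite ?fw ?fz0.
apply: cdiffD; first exact: cdiff_cst.
exists r.
  apply: (ccM (ccN cq)); apply: ccV; first by rewrite mulf_neq0.
  by apply: ccM; [exact: cf|exact: cc_cst].
by move=> w; rewrite !subrr mulr0 subr0.
Qed.

Lemma derivable_cdiff f z : derivable f z 1 -> cdiff f z.
Proof.
move=> /cvg_ex[l /= /cvgCP h]; apply: (@cdiff_intro _ _ l) => e e0.
have /nbhsCP[d d0 hd] := h e e0.
apply/nbhsCP; exists d => // w wz.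
have [->|wnz] := eqVneq w z; first by rewrite !subrr mulr0 subr0 normc0 mulr0.
have wz0 : w - z != 0 by rewrite subr_eq0.
have := hd (w - z); rewrite subr0 => /(_ wz wz0).
have -> : (w - z)%:A + z = w by rewrite /GRing.scale /= mulr1 subrK.
have -> : (w - z)^-1 *: (f w - f z) - l = (f w - f z - l * (w - z)) / (w - z).
  by rewrite /GRing.scale /=; field.
by rewrite normcM normcV ltr_pdivrMr ?normc_gt0 // => /ltW.
Qed.

Lemma real_little_o (g : R -> R) (l : R) : is_derive (0 : R) (1 : R) g l ->
  forall e : R, 0 < e -> exists2 d, 0 < d & forall t, `|t| < d ->
    `|g t - g 0 - l * t| <= e * `|t|.
Proof.
move=> [/cvg_ex[k /= hk] gl] e e0.
have kl : k = l by rewrite -gl; apply/esym; apply: cvg_lim.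
rewrite {}kl in hk.
move/cvgrPdist_lt : hk => /(_ e e0) /nbhs_normP[d d0 hd]; exists d => // t td.
have [->|t0] := eqVneq t 0; first by rewrite mulr0 subr0 subrr normr0 mulr0.
have := hd t; rewrite /ball_ /= sub0r normrN => /(_ td t0).
have -> : t *: 1 + 0 = t by rewrite addr0 /GRing.scale /= mulr1.
have -> : l - t^-1 *: (g t - g 0) = - (g t - g 0 - l * t) / t.
  by rewrite /GRing.scale /=; field.
by rewrite normrM normrN normfV ltr_pdivrMr ?normr_gt0 // => /ltW.
Qed.

Lemma cdiff_expC z : cdiff expC z.
Proof.
suff h0 : forall e : R, 0 < e -> exists2 d, 0 < d & forall w, normc w < d ->
    normc (expC w - 1 - w) <= e * normc w.
  apply: (@cdiff_intro _ _ (expC z)) => e e0.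
  have [d d0 hd] := h0 (e / expR (Re z)) (divr_gt0 e0 (expR_gt0 _)).
  apply/nbhsCP; exists d => // w /hd.
  have -> : expC w - expC z - expC z * (w - z) = expC z * (expC (w - z) - 1 - (w - z)).
    have -> : expC w = expC (w - z) * expC z by rewrite -expCD subrK.
    by ring.
  rewrite normcM normc_expC => le1; rewrite (le_trans (ler_wpM2l _ le1)) ?expR_ge0 //.
  by rewrite mulrA mulrCA mulfV ?mulr1 // gt_eqF // expR_gt0.
move=> e e0; have e6 : 0 < e / 6 by rewrite divr_gt0.
have [d1 d10 h1] := real_little_o (is_derive_expR (0 : R)) e6.
have [d2 d20 h2] := real_little_o (is_derive_cos (0 : R)) e6.
have [d3 d30 h3] := real_little_o (is_derive_sin (0 : R)) e6.
have [d4 d40 h4] : exists2 d : R, 0 < d & forall t, `|t| < d -> `|expR t - 1| < Num.min 1 (e / 6).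
  have m0 : 0 < Num.min 1 (e / 6) by rewrite lt_min ltr01.
  have /cvgrPdist_lt /(_ _ m0) /nbhs_normP[d d0 hd] := @continuous_expR R 0.
  by exists d => // t td; have := hd t; rewrite /ball_ /= sub0r normrN expR0 distrC; exact.
exists (Num.min (Num.min 1 d1) (Num.min d2 (Num.min d3 d4))).
  by rewrite !lt_min ltr01 d10 d20 d30.
move=> [a b]; rewrite !lt_min => /andP[/andP[w1 wd1] /andP[wd2 /andP[wd3 wd4]]].
have ha : `|a| <= normc (Complex a b) := normc_Re (Complex a b).
have hb : `|b| <= normc (Complex a b) := normc_Im (Complex a b).
move: w1 wd1 wd2 wd3 wd4 ha hb; set n := normc _ => w1 wd1 wd2 wd3 wd4 ha hb.
have {}h1 := h1 a (le_lt_trans ha wd1); rewrite expR0 mul1r in h1.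
have {}h2 := h2 b (le_lt_trans hb wd2); rewrite cos0 sin0 oppr0 mul0r subr0 in h2.
have {}h3 := h3 b (le_lt_trans hb wd3); rewrite sin0 cos0 mul1r subr0 in h3.
have := h4 a (le_lt_trans ha wd4); rewrite lt_min => /andP[h4a h4b].
have -> : expC (Complex a b) - 1 - Complex a b =
   Complex ((expR a - 1 - a) * cos b + (1 + a) * (cos b - 1))
           (expR a * (sin b - b) + (expR a - 1) * b).
  by apply: ceqP; rewrite !reim /expC /=; ring.
rewrite (le_trans (normc_le_sum _ _)) //.
have en : e / 6 * `|a| <= e / 6 * n by rewrite ler_wpM2l // ltW.
have en' : e / 6 * `|b| <= e / 6 * n by rewrite ler_wpM2l // ltW.
have b1 : `|(expR a - 1 - a) * cos b| <= e / 6 * n.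
  rewrite normrM -[leRHS]mulr1 ler_pM // ?cos_max //; exact: le_trans h1 en.
have b2 : `|(1 + a) * (cos b - 1)| <= 2 * (e / 6 * n).
  rewrite normrM ler_pM //; last exact: le_trans h2 en'.
  rewrite (le_trans (ler_normD _ _)) // normr1 lerD2l (le_trans ha) // ltW //.
have b3 : `|expR a * (sin b - b)| <= 2 * (e / 6 * n).
  rewrite normrM ler_pM //; last exact: le_trans h3 en'.
  rewrite ger0_norm ?expR_ge0 //; move: h4a; rewrite ltr_norml => /andP[_ ?]; lra.
have b4 : `|(expR a - 1) * b| <= e / 6 * n.
  by rewrite normrM (le_trans _ en') // ler_wpM2r // ltW.
have := ler_normD ((expR a - 1 - a) * cos b) ((1 + a) * (cos b - 1)).
have := ler_normD (expR a * (sin b - b)) ((expR a - 1) * b).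
lra.
Qed.

End complex_derivative.

(** * Goursat's theorem for rectangles *)

Section goursat.
Context {R : realType}.
Local Notation C := R[i].
Implicit Types (h : C -> C) (F G : R -> C) (a b c d : R).
Local Notation Re := complex.Re.
Local Notation Im := complex.Im.

Definition cint F a b : C := Complex (rint (fun x => Re (F x)) a b) (rint (fun x => Im (F x)) a b).

Lemma cont_on_Re a b F : cont_on `[a, b] F -> cont_on `[a, b] (fun x => Re (F x)).
Proof. by move=> cF x /cF; exact: cc_Re. Qed.
Lemma cont_on_Im a b F : cont_on `[a, b] F -> cont_on `[a, b] (fun x => Im (F x)).
Proof. by move=> cF x /cF; exact: cc_Im. Qed.

Lemma cintD F G a b : cont_on `[a, b] F -> cont_on `[a, b] G ->
  cint (fun x => F x + G x) a b = cint F a b + cint G a b.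
Proof.
move=> cF cG; apply: ceqP; rewrite reim /= -rintD; try exact: cont_on_Re; try exact: cont_on_Im.
  by apply: rint_eq => x _; rewrite reim.
by apply: rint_eq => x _; rewrite reim.
Qed.

Lemma cintZ (k : C) F a b : cont_on `[a, b] F -> cint (fun x => k * F x) a b = k * cint F a b.
Proof.
move=> cF; have cR := cont_on_Re cF; have cI := cont_on_Im cF.
have cZ (r : R) (g : R -> R) : cont_on `[a, b] g -> cont_on `[a, b] (fun x => r * g x).
  by move=> cg x /cg cgx; apply: cvgM => //; exact: cvg_cst.
apply: ceqP; rewrite !reim /=.
  rewrite -mulNr -(rintZ (Re k) cR) -(rintZ (- Im k) cI) -(rintD (cZ _ _ cR) (cZ _ _ cI)).
  by apply: rint_eq => x _; rewrite reim mulNr.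
rewrite -(rintZ (Re k) cI) -(rintZ (Im k) cR) -(rintD (cZ _ _ cI) (cZ _ _ cR)).
by apply: rint_eq => x _; rewrite reim.
Qed.

Lemma cint_cst (k : C) a b : a <= b -> cint (fun=> k) a b = k * ((b - a)%:C)%C.
Proof. by move=> ab; apply: ceqP; rewrite !reim /= !rint_cst // mulr0 ?subr0 ?add0r. Qed.

Lemma cint_chasles F a b c : a <= c <= b -> cont_on `[a, b] F ->
  cint F a b = cint F a c + cint F c b.
Proof.
move=> acb cF; apply: ceqP; rewrite !reim /= -rint_chasles //.
  exact: cont_on_Re.
exact: cont_on_Im.
Qed.

Lemma cint_bound F a b (M : R) : a <= b -> cont_on `[a, b] F ->
  (forall x, a <= x <= b -> normc (F x) <= M) -> normc (cint F a b) <= 2 * M * (b - a).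
Proof.
move=> ab cF FM; rewrite (le_trans (normc_le_sum _ _)) //.
rewrite -mulrA (mulr_natl (M * (b - a)) 2) mulr2n lerD //; apply: rint_bound => //.
- exact: cont_on_Re.
- by move=> x /FM; apply: le_trans; exact: normc_Re.
- exact: cont_on_Im.
- by move=> x /FM; apply: le_trans; exact: normc_Im.
Qed.

Lemma cint_eq F G a b : (forall x, a <= x <= b -> F x = G x) -> cint F a b = cint G a b.
Proof. by move=> FG; apply: ceqP => /=; apply: rint_eq => x /FG ->. Qed.

Lemma cint_real_id a b : a <= b -> cint (fun x => (x%:C)%C) a b = (((b ^+ 2 - a ^+ 2) / 2)%:C)%C.
Proof.
move=> ab; apply: ceqP => /=; first by rewrite -rint_id.
by rewrite rint_cst // mul0r.
Qed.

(** The counterclockwise integral along the boundary of [a, b] x [c, d]. *)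
Definition rectint h a b c d : C :=
  cint (fun x => h (Complex x c)) a b - cint (fun x => h (Complex x d)) a b +
  'i%C * (cint (fun y => h (Complex b y)) c d - cint (fun y => h (Complex a y)) c d).

Definition inrect a b c d (z : C) := (a <= Re z <= b) && (c <= Im z <= d).

Lemma cont_on_hor h a b c d y : cont_on (inrect a b c d) h -> c <= y <= d ->
  cont_on `[a, b] (fun x => h (Complex x y)).
Proof.
move=> ch yb x; rewrite /= in_itv /= => xb; apply: (@cc_comp _ _ _ (fun x => Complex x y) h).
  by apply: cc_Complex; [exact: cvg_id|exact: cvg_cst].
by apply: ch; rewrite /inrect /= xb.
Qed.

Lemma cont_on_ver h a b c d x : cont_on (inrect a b c d) h -> a <= x <= b ->
  cont_on `[c, d] (fun y => h (Complex x y)).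
Proof.
move=> ch xb y; rewrite /= in_itv /= => yb; apply: (@cc_comp _ _ _ (fun y => Complex x y) h).
  by apply: cc_Complex; [exact: cvg_cst|exact: cvg_id].
by apply: ch; rewrite /inrect /= xb.
Qed.

Lemma rectint_split_x h a b c d m : a <= m <= b -> c <= d -> cont_on (inrect a b c d) h ->
  rectint h a b c d = rectint h a m c d + rectint h m b c d.
Proof.
move=> amb cd ch; rewrite /rectint.
rewrite (cint_chasles amb (cont_on_hor ch _)) ?lexx ?cd //.
rewrite (cint_chasles amb (cont_on_hor ch _)) ?lexx ?cd //.
by ring.
Qed.

Lemma rectint_split_y h a b c d m : c <= m <= d -> a <= b -> cont_on (inrect a b c d) h ->
  rectint h a b c d = rectint h a b c m + rectint h a b m d.
Proof.
move=> cmd ab ch; rewrite /rectint.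
rewrite (cint_chasles cmd (cont_on_ver ch _)) ?lexx ?ab //.
rewrite (cint_chasles cmd (cont_on_ver ch _)) ?lexx ?ab //.
by ring.
Qed.

Lemma rectintD h g a b c d : a <= b -> c <= d -> cont_on (inrect a b c d) h -> cont_on (inrect a b c d) g ->
  rectint (fun z => h z + g z) a b c d = rectint h a b c d + rectint g a b c d.
Proof.
move=> ab cd ch cg; rewrite /rectint.
have c1 : c <= c <= d by rewrite lexx.
have d1 : c <= d <= d by rewrite lexx cd.
have a1 : a <= a <= b by rewrite lexx.
have b1 : a <= b <= b by rewrite lexx ab.
rewrite (cintD (cont_on_hor ch c1) (cont_on_hor cg c1)) (cintD (cont_on_hor ch d1) (cont_on_hor cg d1)).
rewrite (cintD (cont_on_ver ch a1) (cont_on_ver cg a1)) (cintD (cont_on_ver ch b1) (cont_on_ver cg b1)).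
by ring.
Qed.

(** An affine function has a primitive; here the four integrals are computed
    explicitly. *)
Lemma rectint_affine (k l : C) a b c d : a <= b -> c <= d ->
  rectint (fun z => k + l * z) a b c d = 0.
Proof.
move=> ab cd.
have cC (r : R) (u v : R) : cont_on `[u, v] (fun x : R => (x%:C)%C).
  by move=> x _; apply: cc_real; exact: cvg_id.
have cst (r : C) (u v : R) : cont_on `[u, v] (fun _ : R => r) by move=> x _; exact: cc_cst.
have H y : cint (fun x => k + l * Complex x y) a b =
    (k + l * Complex 0 y) * ((b - a)%:C)%C + l * (((b ^+ 2 - a ^+ 2) / 2)%:C)%C.
  rewrite -cint_cst // -cint_real_id // -cintZ; last exact: cC.
  rewrite -cintD; [|exact: cst|by move=> x _; apply: ccM; [exact: cc_cst|apply: cc_real; exact: cvg_id]].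
  apply: cint_eq => x _; rewrite -addrA -mulrDr; congr (_ + _ * _).
  by apply: ceqP; rewrite !reim /= ?add0r ?addr0.
have V x : cint (fun y => k + l * Complex x y) c d =
    (k + l * (x%:C)%C) * ((d - c)%:C)%C + l * 'i%C * (((d ^+ 2 - c ^+ 2) / 2)%:C)%C.
  rewrite -cint_cst // -cint_real_id // -cintZ; last exact: cC.
  rewrite -cintD; [|exact: cst|by move=> y _; apply: ccM; [exact: cc_cst|apply: cc_real; exact: cvg_id]].
  apply: cint_eq => y _; rewrite -addrA -mulrA -mulrDr; congr (_ + _ * _).
  by apply: ceqP; rewrite !reim /=; ring.
rewrite /rectint !H !V.
case: k l {H V} => k1 k2 [l1 l2].
by apply: ceqP; rewrite !reim /=; field.
Qed.

Lemma rectint_bound h a b c d (M : R) : a <= b -> c <= d -> cont_on (inrect a b c d) h ->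
  (forall z, inrect a b c d z -> normc (h z) <= M) ->
  normc (rectint h a b c d) <= 4 * M * (b - a + (d - c)).
Proof.
move=> ab cd ch hM.
have H y : c <= y <= d -> normc (cint (fun x => h (Complex x y)) a b) <= 2 * M * (b - a).
  move=> yb; apply: cint_bound => //; first exact: cont_on_hor ch yb.
  by move=> x xb; apply: hM; rewrite /inrect /= xb.
have V x : a <= x <= b -> normc (cint (fun y => h (Complex x y)) c d) <= 2 * M * (d - c).
  move=> xb; apply: cint_bound => //; first exact: cont_on_ver ch xb.
  by move=> y yb; apply: hM; rewrite /inrect /= xb.
have H1 := H c; have H2 := H d; have V1 := V a; have V2 := V b.
rewrite !lexx ?cd in H1 H2; rewrite !lexx ?ab in V1 V2.
rewrite /rectint (le_trans (ler_normcD _ _)) // normcM normc_imag normr1 mul1r.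
have n1 := ler_normcD (cint (fun x => h (Complex x c)) a b) (- cint (fun x => h (Complex x d)) a b).
have n2 := ler_normcD (cint (fun y => h (Complex b y)) c d) (- cint (fun y => h (Complex a y)) c d).
rewrite normc_opp in n1; rewrite normc_opp in n2.
have := H1 isT; have := H2 isT; have := V1 isT; have := V2 isT.
lra.
Qed.

(** The integral along a rectangle is the sum of those along its four quarters,
    so one quarter carries a fourth of it. *)
Lemma rectint_quarter h a b c d : a <= b -> c <= d -> cont_on (inrect a b c d) h ->
  exists s : bool * bool,
    let m := (a + b) / 2 in let n := (c + d) / 2 in
    let a' := if s.1 then m else a in let b' := if s.1 then b else m in
    let c' := if s.2 then n else c in let d' := if s.2 then d else n in
    normc (rectint h a b c d) <= 4 * normc (rectint h a' b' c' d').
Proof.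
move=> ab cd ch; set m := (a + b) / 2; set n := (c + d) / 2.
have am : a <= m <= b by rewrite /m; apply/andP; split; lra.
have cn : c <= n <= d by rewrite /n; apply/andP; split; lra.
have /andP[am1 am2] := am; have /andP[cn1 cn2] := cn.
have sub1 : cont_on (inrect a m c d) h.
  apply: cont_on_sub ch => z; rewrite /inrect => /andP[/andP[-> h2] ->].
  by rewrite (le_trans h2).
have sub2 : cont_on (inrect m b c d) h.
  apply: cont_on_sub ch => z; rewrite /inrect => /andP[/andP[h1 ->] ->].
  by rewrite (le_trans _ h1).
have E : rectint h a b c d = (rectint h a m c n + rectint h a m n d) +
   (rectint h m b c n + rectint h m b n d).
  by rewrite (rectint_split_x am cd ch) (rectint_split_y cn am1 sub1) (rectint_split_y cn am2 sub2).
have T := ler_normcD (rectint h a m c n + rectint h a m n d) (rectint h m b c n + rectint h m b n d).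
have T1 := ler_normcD (rectint h a m c n) (rectint h a m n d).
have T2 := ler_normcD (rectint h m b c n) (rectint h m b n d).
rewrite -E in T.
have [h1|h1] := lerP (normc (rectint h a b c d)) (4 * normc (rectint h a m c n)).
  by exists (false, false).
have [h2|h2] := lerP (normc (rectint h a b c d)) (4 * normc (rectint h a m n d)).
  by exists (false, true).
have [h3|h3] := lerP (normc (rectint h a b c d)) (4 * normc (rectint h m b c n)).
  by exists (true, false).
have [h4|h4] := lerP (normc (rectint h a b c d)) (4 * normc (rectint h m b n d)).
  by exists (true, true).
lra.
Qed.

Lemma nested_sup (x w : nat -> R) : (forall n, x n <= x n.+1) -> (forall n, x n.+1 + w n.+1 <= x n + w n) ->
  (forall n, 0 <= w n) -> exists s, forall n, x n <= s <= x n + w n.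
Proof.
move=> xS wS w0.
have xm n k : x n <= x (n + k)%N.
  by elim: k => [|k IH]; rewrite ?addn0 // addnS (le_trans IH).
have wm n k : x (n + k)%N + w (n + k)%N <= x n + w n.
  by elim: k => [|k IH]; rewrite ?addn0 // addnS (le_trans (wS _)).
have xw n m : x m <= x n + w n.
  have [nm|mn] := leqP n m.
    by have := wm n (m - n)%N; rewrite subnKC // => /(le_trans _); apply; rewrite lerDl.
  by have := xm m (n - m)%N; rewrite subnKC ?(ltnW mn) // => /le_trans; apply; rewrite lerDl.
exists (sup (range x)) => n; apply/andP; split.
  apply: sup_upper_bound; last by exists n.
  split; first by exists (x 0); exists 0%N.
  by exists (x 0 + w 0) => _ [m _ <-].
by apply: ge_sup; [exists (x 0); exists 0%N|move=> _ [m _ <-]].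
Qed.

(** Goursat's bisection: a quarter of the integral survives at each step, and
    at the common point of the nested rectangles the function differs from an
    affine one by an amount which is small compared with the diameter. *)
Theorem goursat h a b c d : a <= b -> c <= d -> (forall z, inrect a b c d z -> cdiff h z) ->
  rectint h a b c d = 0.
Proof.
move=> ab cd dh.
pose P (r : (R * R) * (R * R)) := [/\ r.1.1 <= r.1.2, r.2.1 <= r.2.2 &
  forall z, inrect r.1.1 r.1.2 r.2.1 r.2.2 z -> inrect a b c d z].
pose I (r : (R * R) * (R * R)) := normc (rectint h r.1.1 r.1.2 r.2.1 r.2.2).
have step (r : (R * R) * (R * R)) : exists r' : (R * R) * (R * R), P r ->
    [/\ P r', I r <= 4 * I r', [/\ r'.1.2 - r'.1.1 = (r.1.2 - r.1.1) / 2 & r'.2.2 - r'.2.1 = (r.2.2 - r.2.1) / 2],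
     r.1.1 <= r'.1.1 /\ r'.1.2 <= r.1.2 & r.2.1 <= r'.2.1 /\ r'.2.2 <= r.2.2].
  case: r => -[a1 b1] [c1 d1]; have [[/= ab1 cd1 sub1]|nP] := pselect (P ((a1, b1), (c1, d1))); last by exists ((a1, b1), (c1, d1)).
  have ch : cont_on (inrect a1 b1 c1 d1) h by move=> z /sub1/dh/cdiff_cont.
  have [s /=] := rectint_quarter ab1 cd1 ch.
  set a2 := if s.1 then _ else _; set b2 := if s.1 then _ else _.
  set c2 := if s.2 then _ else _; set d2 := if s.2 then _ else _ => le4.
  have ha : [/\ b2 - a2 = (b1 - a1) / 2, a1 <= a2 & b2 <= b1].
    by rewrite /a2 /b2; case: (s.1); split; lra.
  have hc : [/\ d2 - c2 = (d1 - c1) / 2, c1 <= c2 & d2 <= d1].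
    by rewrite /c2 /d2; case: (s.2); split; lra.
  exists ((a2, b2), (c2, d2)) => _; case: ha hc => ha1 ha2 ha3 [hc1 hc2 hc3].
  split => //=; split => /=; [lra|lra|move=> z /andP[/andP[z1 z2] /andP[z3 z4]]; apply: sub1].
  by rewrite /inrect (le_trans ha2 z1) (le_trans z2 ha3) (le_trans hc2 z3) (le_trans z4 hc3).
have [f fP] := choice step.
pose s n := iter n f ((a, b), (c, d)).
have sP n : P (s n).
  by elim: n => [|n /fP[]] //; split.
have sS n := fP (s n) (sP n).
have wE n : (s n).1.2 - (s n).1.1 = (b - a) / 2 ^+ n /\ (s n).2.2 - (s n).2.1 = (d - c) / 2 ^+ n.
  elim: n => [|n [IH1 IH2]]; first by rewrite expr0 !divr1.
  case: (sS n) => _ _ [e1 e2] _ _; rewrite /s /= -/(s n) e1 e2 IH1 IH2 exprSr invfM.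
  by split; field; rewrite expf_neq0.
have [x xP] : exists x, forall n, (s n).1.1 <= x <= (s n).1.1 + ((s n).1.2 - (s n).1.1).
  apply: nested_sup => n; case: (sS n) => _ _ _ [q1 q2] _; rewrite ?subrKC //.
  by case: (sP n) => ? _ _; rewrite subr_ge0.
have [y yP] : exists y, forall n, (s n).2.1 <= y <= (s n).2.1 + ((s n).2.2 - (s n).2.1).
  apply: nested_sup => n; case: (sS n) => _ _ _ _ [q1 q2]; rewrite ?subrKC //.
  by case: (sP n) => _ ? _; rewrite subr_ge0.
have In n : I ((a, b), (c, d)) <= 4 ^+ n * I (s n).
  elim: n => [|n IH]; first by rewrite expr0 mul1r.
  case: (sS n) => _ le4 _ _ _; rewrite (le_trans IH) // exprSr -mulrA ler_pM2l ?exprn_gt0 //.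
pose z0 := Complex x y.
have [q cq qE] : cdiff h z0.
  by apply: dh; rewrite /inrect /=; have := xP 0%N; have := yP 0%N; rewrite /= !subrKC => -> ->.
pose W := b - a + (d - c).
have W0 : 0 <= W by rewrite addr_ge0 // subr_ge0.
suff small : forall e : R, 0 < e -> I ((a, b), (c, d)) <= e * (4 * W ^+ 2).
  apply/eqP; rewrite -normc_eq0 eq_le normc_ge0 andbT.
  apply/ler_addgt0Pl => e e0; rewrite addr0.
  have k0 : 0 < 4 * W ^+ 2 + 1 by rewrite ltr_wpDl // mulr_ge0 // exprn_ge0.
  have := small (e / (4 * W ^+ 2 + 1)) (divr_gt0 e0 k0).
  move/le_trans; apply; rewrite mulrAC ler_pdivrMr // ler_pM2l // lerDl //.
move=> e e0.
have [dl dl0 hdl] : exists2 dl : R, 0 < dl & forall w, normc (w - z0) < dl -> normc (q w - q z0) < e.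
  by have /nbhsCP := proj1 (ccP q z0) cq e e0.
have [n Wn] : exists n, W / 2 ^+ n < dl.
  have [n] : exists n : nat, W / dl < n%:R by exists (Num.truncn (W / dl)).+1; rewrite truncnS_gt.
  move=> hn; exists n; rewrite ltr_pdivrMr ?exprn_gt0 // mulrC -ltr_pdivrMr //.
  rewrite (lt_trans hn) // -natrX ltr_nat ltn_expl //.
case: (sP n) => [abn cdn subn]; have [w1 w2] := wE n.
pose rr z := (q z - q z0) * (z - z0).
(* the affine part integrates to 0; the remainder [rr] is [o(z - z0)] *)
have hE z : h z = (h z0 - q z0 * z0 + q z0 * z) + rr z.
  by rewrite /rr mulrBl -qE; ring.
have crr : cont_on (inrect (s n).1.1 (s n).1.2 (s n).2.1 (s n).2.2) rr.
  move=> z /subn/dh/cdiff_cont chz.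
  rewrite (_ : rr = fun z => h z - (h z0 - q z0 * z0 + q z0 * z)); last first.
    by apply/funext => t; rewrite {1}(hE t) addrC addKr.
  by apply: (ccB chz); apply: ccD; [exact: cc_cst|apply: ccM; [exact: cc_cst|exact: cc_id]].
have caf : cont_on (inrect (s n).1.1 (s n).1.2 (s n).2.1 (s n).2.2) (fun z => h z0 - q z0 * z0 + q z0 * z).
  by move=> z _; apply: ccD; [exact: cc_cst|apply: ccM; [exact: cc_cst|exact: cc_id]].
have IE : I (s n) = normc (rectint rr (s n).1.1 (s n).1.2 (s n).2.1 (s n).2.2).
  rewrite /I (_ : h = fun z => (h z0 - q z0 * z0 + q z0 * z) + rr z); last exact/funext.
  by rewrite (rectintD abn cdn caf crr) (rectint_affine _ _ abn cdn) add0r.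
have bd z : inrect (s n).1.1 (s n).1.2 (s n).2.1 (s n).2.2 z -> normc (rr z) <= e * (W / 2 ^+ n).
  move=> /andP[/andP[z1 z2] /andP[z3 z4]].
  have zz : normc (z - z0) <= W / 2 ^+ n.
    rewrite [z - z0](_ : _ = Complex (Re z - x) (Im z - y)); last by apply: ceqP; rewrite !reim.
    rewrite (le_trans (normc_le_sum _ _)) // /W mulrDl -w1 -w2.
    have /andP[x1 x2] := xP n; have /andP[y1 y2] := yP n.
    by apply: lerD; rewrite ler_norml; apply/andP; split; lra.
  rewrite /rr normcM ler_pM ?normc_ge0 //.
  by apply: ltW; apply: hdl; exact: le_lt_trans zz Wn.
have := rectint_bound abn cdn crr bd; rewrite -IE w1 w2 -mulrDl -/W => Ib.
rewrite (le_trans (In n)) // (le_trans (ler_wpM2l _ Ib)) ?exprn_ge0 //.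
rewrite (_ : 4 ^+ n = 2 ^+ n * 2 ^+ n :> R); last by rewrite -exprMn -natrM.
have n0 : (2 ^+ n : R) != 0 by rewrite expf_neq0.
by rewrite le_eqVlt; apply/orP; left; apply/eqP; field.
Qed.

End goursat.

(** * The maximum modulus principle *)

Section maximum_modulus.
Context {R : realType}.
Local Notation C := R[i].
Implicit Types (h : C -> C) (z : C).
Local Notation Re := complex.Re.
Local Notation Im := complex.Im.

Lemma imag_neq0 : ('i%C == 0 :> C) = false.
Proof. by rewrite eq_complex /= oner_eq0 andbF. Qed.

Definition circle z (r : R) (t : R) : C := z + (r%:C)%C * expC (Complex 0 t).

Lemma normc_expC_i (t : R) : normc (expC (Complex 0 t)) = 1.
Proof. by rewrite normc_expC /= expR0. Qed.

Lemma circle_dist z r t : 0 <= r -> normc (circle z r t - z) = r.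
Proof.
by move=> r0; rewrite /circle addrC addKr normcM normc_expC_i normc_real mulr1 ger0_norm.
Qed.

Lemma circle_cont z r t : {for t, continuous (circle z r)}.
Proof.
apply: ccD; first exact: cc_cst.
apply: ccM; first exact: cc_cst.
apply: cc_expC; apply: cc_Complex; [exact: cvg_cst|exact: cvg_id].
Qed.

(** In the coordinate [w] with [z + expC w], concentric circles become vertical
    segments of length 2 pi. Goursat's theorem and periodicity show that the
    integral over such a segment does not depend on the radius, and it tends to
    the value at the centre when the radius tends to 0. *)
Lemma mean_value h z (r : R) : 0 < r -> (forall w, normc (w - z) <= r -> cdiff h w) ->
  cint (fun t => h (circle z r t)) 0 (pi *+ 2) = h z * ((pi *+ 2)%:C)%C.
Proof.
move=> r0 dh; pose H w := h (z + expC w); pose P : R := pi *+ 2.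
have P0 : 0 < P by rewrite mulrn_wgt0 // pi_gt0.
have dH w : expR (Re w) <= r -> cdiff H w.
  move=> wr; apply: (@cdiff_comp _ h (fun w => z + expC w)).
    by apply: cdiffD; [exact: cdiff_cst|exact: cdiff_expC].
  by apply: dh; rewrite addrC addKr normc_expC.
pose b := ln r; have eb : expR b = r by rewrite lnK.
(* the two horizontal sides cancel by periodicity *)
have const a : a <= b -> cint (fun y => H (Complex b y)) 0 P = cint (fun y => H (Complex a y)) 0 P.
  move=> ab; have dHr w : inrect a b 0 P w -> cdiff H w.
    by move=> /andP[/andP[_ wb] _]; apply: dH; rewrite -eb ler_expR.
  have := goursat ab (ltW P0) dHr; rewrite /rectint.
  rewrite (@cint_eq _ (fun x => H (Complex x P)) (fun x => H (Complex x 0))); last first.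
    move=> x _; rewrite /H; congr (h (z + _)).
    have -> : Complex x P = Complex x 0 + twopii by apply: ceqP; rewrite !reim /= ?addr0 ?add0r.
    by rewrite expCD expC_twopii mulr1.
  rewrite subrr add0r => /eqP; rewrite mulf_eq0 => /orP[|]; last by rewrite subr_eq0 => /eqP.
  rewrite imag_neq0; discriminate.
have Hb : cint (fun t => h (circle z r t)) 0 P = cint (fun y => H (Complex b y)) 0 P.
  apply: cint_eq => t _; rewrite /H /circle; congr (h (z + _)).
  rewrite (_ : Complex b t = (b%:C)%C + Complex 0 t); last by apply: ceqP; rewrite !reim /= ?addr0 ?add0r.
  rewrite expCD; congr (_ * _); rewrite /expC /= cos0 sin0 mulr1 mulr0 eb //.
rewrite -/P Hb; apply/eqP; rewrite -subr_eq0 -normc_eq0 eq_le normc_ge0 andbT.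
apply/ler_addgt0Pl => e e0; rewrite addr0.
have e1 : 0 < e / (2 * P) by rewrite divr_gt0 // mulr_gt0.
have ch : {for z, continuous h} by apply: cdiff_cont; apply: dh; rewrite subrr normc0 ltW.
have /nbhsCP[d d0 hd] := proj1 (ccP h z) ch _ e1.
pose a := Num.min b (ln (d / 2)).
have ab : a <= b by rewrite ge_min lexx.
have ea : expR a < d.
  have d2 : 0 < d / 2 by rewrite divr_gt0.
  rewrite (@le_lt_trans _ _ (d / 2)) //; last by rewrite ltr_pdivrMr // mulr_natr mulr2n ltrDl.
  by rewrite -[leRHS]lnK ?posrE // ler_expR ge_min lexx orbT.
have cH : cont_on `[0, P] (fun y => H (Complex a y)).
  move=> y _; apply: (@cc_comp _ _ _ (fun y => Complex a y) H).
    by apply: cc_Complex; [exact: cvg_cst|exact: cvg_id].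
  by apply: cdiff_cont; apply: dH; rewrite -eb ler_expR.
have cK : cont_on `[0, P] (fun _ : R => - h z) by move=> y _; exact: cc_cst.
have cHK : cont_on `[0, P] (fun y => H (Complex a y) + - h z).
  by move=> y yP; exact: (ccD (cH y yP) (cK y yP)).
rewrite (const _ ab) -mulNr -[P in (P%:C)%C]subr0 -(cint_cst _ (ltW P0)) -(cintD cH cK).
have := @cint_bound R _ 0 P (e / (2 * P)) (ltW P0) cHK.
rewrite subr0 (_ : 2 * (e / (2 * P)) * P = e); last first.
  by rewrite mulrAC mulrC divfK // mulf_neq0 // gt_eqF.
apply => y _; apply: ltW; apply: hd.
by rewrite addrC addKr normc_expC.
Qed.

(** If the modulus exceeded [M] in [G], its maximum [m] over the closure would
    be attained in [G] only; among the points where it is attained choose the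
    one [c] with the largest real part. On a small circle about [c] the modulus
    is at most [m], and it is less than [m] at the rightmost point, which
    contradicts the mean value property. *)
Theorem maximum_modulus (G : set C) h (M B : R) : open G -> (forall z, G z -> normc z <= B) ->
  (forall z, closure G z -> cdiff h z) ->
  (forall z, closure G z -> ~ G z -> normc (h z) <= M) ->
  forall z, G z -> normc (h z) <= M.
Proof.
move=> oG GB dh hM z1 Gz1; rewrite leNgt; apply/negP => Mz1.
have cG : compact (closure G).
  apply: (@bounded_closed_compactC _ _ B); first exact: closed_closure.
  move=> z clz; apply/ler_addgt0Pl => e e0.
  have [w [Gw wz]] := clz _ (near_normc z e0).
  rewrite -[z](subrK w) (le_trans (ler_normcD _ _)) // lerD //; last exact: GB.
  by rewrite distcC ltW.
have ch z : closure G z -> {for z, continuous h} by move=> /dh/cdiff_cont.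
have cnh : {within closure G, continuous (fun z => normc (h z))}.
  by apply: continuous_in_subspaceT => z; rewrite inE => /ch; exact: cc_normc.
have ne : closure G !=set0 by exists z1; exact: subset_closure.
have [c0 c0G c0M] := compact_EVT_max ne cG cnh.
rewrite inE in c0G; set m := normc (h c0) in c0M.
have mM : M < m by rewrite (lt_le_trans Mz1) // c0M // inE; exact: subset_closure.
pose A := closure G `&` [set z | normc (h z) = m].
have cA : compact A.
  apply: (subclosed_compact _ cG); last by move=> z [].
  move=> z clz; have Gz : closure G z.
    apply: (@closed_closure _ G) => U Uz.
    by have [w [[Gw _] Uw]] := clz U Uz; exists w.
  split=> //=; apply: contrapT => /eqP hz.
  have cz := cc_normc (ch z Gz).
  have : \forall w \near z, normc (h w) != m.
    have pos : 0 < `|normc (h z) - m| by rewrite normr_gt0 subr_eq0.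
    move/cvgrPdist_lt : cz => /(_ _ pos); apply: filterS => w.
    by apply: contraTneq => ->; rewrite ltxx.
  by move=> /clz[w [[_ /= hw]]]; rewrite hw eqxx.
have neA : A !=set0 by exists c0.
have cRe : {within A, continuous (@complex.Re R)} by apply: continuous_subspaceT; exact: Re_cont.
have [c + cM] := compact_EVT_max neA cA cRe.
rewrite inE => -[Gc hc]; rewrite /= in hc.
have {}Gc : G c by apply: contrapT => nG; have := hM _ Gc nG; rewrite hc leNgt mM.
have /nbhsCP[d d0 hd] : nbhs c G by exact: open_nbhs_nbhs.
pose r := d / 2; have r0 : 0 < r by rewrite divr_gt0.
have rd : r < d by rewrite ltr_pdivrMr // mulr_natr mulr2n ltrDl.
have inG w : normc (w - c) <= r -> G w by move=> wr; apply: hd; exact: le_lt_trans wr rd.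
have mv := mean_value r0 (fun w wr => dh w (subset_closure (inG w wr))).
pose P : R := pi *+ 2; rewrite -/P in mv.
have P0 : 0 < P by rewrite mulrn_wgt0 // pi_gt0.
have cG' t : G (circle c r t) by apply: inG; rewrite circle_dist // ltW.
have cF t : {for t, continuous (fun t => h (circle c r t))}.
  apply: (@cc_comp _ _ _ (circle c r) h); first exact: circle_cont.
  by apply: ch; exact: subset_closure.
pose k := - conjc (h c).
(* [psi] is nonnegative and has integral 0, but it is positive at [t = 0] *)
pose psi t := m ^+ 2 + Re (k * h (circle c r t)).
have ckF t : {for t, continuous (fun t => k * h (circle c r t))}.
  by apply: ccM; [exact: cc_cst|exact: cF].
have cpsi t : {for t, continuous psi}.
  by apply: cvgD; [exact: cvg_cst|apply: (cc_Re (ckF t))].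
have kk w : `|Re (k * w)| <= m * normc w.
  by rewrite (le_trans (normc_Re _)) // normcM /k normc_opp normc_conj hc.
have psi0 t : 0 <= psi t.
  have := kk (h (circle c r t)); rewrite ler_norml => /andP[+ _].
  have : m * normc (h (circle c r t)) <= m * m.
    by rewrite ler_wpM2l ?normc_ge0 // c0M // inE; apply: subset_closure.
  rewrite /psi expr2; lra.
have Ipsi : rint psi 0 P = 0.
  rewrite /psi rintD; [|by move=> t _; exact: cvg_cst|by move=> t _; exact: (cc_Re (ckF t))].
  rewrite rint_cst ?(ltW P0) // subr0.
  have := congr1 (fun z => Re (k * z)) mv; rewrite -(@cintZ _ k _ 0 P (fun t _ => cF t)).
  move=> /= ->.
  have -> : k * (h c * ((P)%:C)%C) = - ((m ^+ 2 * P)%:C)%C.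
    rewrite /k mulNr mulrA [conjc _ * _]mulrC -sqr_normc normcE hc -rmorphXn -rmorphM //.
  by rewrite ReN /= subrr.
have G0 : G (circle c r 0) by [].
have lt0 : normc (h (circle c r 0)) < m.
  rewrite lt_neqAle c0M ?inE ?andbT; last exact: subset_closure.
  apply/eqP => e0; have : Re (circle c r 0) <= Re c.
    apply: cM; rewrite inE; exact: (conj (subset_closure G0) e0).
  rewrite /circle -[Complex 0 0]/(0 : C) expC0 mulr1 ReD /= gerDl leNgt r0 //.
have p0 : 0 < psi 0.
  have := kk (h (circle c r 0)); rewrite ler_norml => /andP[+ _].
  have m0 : 0 < m := le_lt_trans (normc_ge0 _) lt0.
  have : m * normc (h (circle c r 0)) < m * m by rewrite ltr_pM2l.
  rewrite /psi expr2; lra.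
have p2 : psi 0 / 2 < psi 0 by rewrite ltr_pdivrMr // mulr_natr mulr2n ltrDl.
have [e e0 he] : exists2 e : R, 0 < e & forall t, `|t| < e -> psi 0 / 2 < psi t.
  have h2 : 0 < psi 0 / 2 by rewrite divr_gt0.
  have /cvgrPdist_lt/(_ _ h2)/nbhs_normP[e /= e0 he] := cpsi 0.
  exists e => // t te; have := he t; rewrite /ball_ /= sub0r normrN => /(_ te).
  by rewrite ltr_norml => /andP[_]; rewrite ltrBlDr -ltrBlDl => /(le_lt_trans _); apply; lra.
pose eta := Num.min (e / 2) P.
have eta0 : 0 < eta by rewrite lt_min divr_gt0.
have etaP : eta <= P by rewrite ge_min lexx orbT.
have ch1 := @rint_chasles R psi 0 P eta; rewrite (ltW eta0) etaP Ipsi in ch1.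
have {}ch1 := ch1 isT (fun t _ => cpsi t).
have i2 : 0 <= rint psi eta P by apply: Rintegral_ge0.
have i1 : psi 0 / 2 * (eta - 0) <= rint psi 0 eta.
  rewrite -rint_cst ?(ltW eta0) //; apply: rint_le.
  - by move=> t _; exact: cvg_cst.
  - by move=> t _.
  move=> t /andP[t0 te]; apply: ltW; apply: he; rewrite ger0_norm //.
  rewrite (le_lt_trans te) // (@le_lt_trans _ _ (e / 2)) ?ge_min ?lexx //.
  by rewrite ltr_pdivrMr // mulr_natr mulr2n ltrDl.
have : 0 < psi 0 / 2 * (eta - 0) by rewrite subr0 mulr_gt0 // divr_gt0.
lra.
Qed.

End maximum_modulus.

(** * Paths in the plane *)

Section real_continuity.
Context {R : realType} {T : topologicalType}.
Implicit Types (f g : T -> R) (x : T).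
Lemma rcD f g x : {for x, continuous f} -> {for x, continuous g} -> {for x, continuous (fun t => f t + g t)}.
Proof. by move=> cf cg; exact: (@cvgD R R^o _ (nbhs x) _ f g _ _ cf cg). Qed.
Lemma rcB f g x : {for x, continuous f} -> {for x, continuous g} -> {for x, continuous (fun t => f t - g t)}.
Proof. by move=> cf cg; exact: (@cvgB R R^o _ (nbhs x) _ f g _ _ cf cg). Qed.
Lemma rcM f g x : {for x, continuous f} -> {for x, continuous g} -> {for x, continuous (fun t => f t * g t)}.
Proof. by move=> cf cg; exact: (@cvgM R _ (nbhs x) _ f g _ _ cf cg). Qed.
Lemma rc_cst (k : R) x : {for x, continuous (fun _ : T => k)}.
Proof. exact: cvg_cst. Qed.
Lemma rc_id (y : R) : {for y, continuous (fun t : R => t)}.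
Proof. exact: cvg_id. Qed.
End real_continuity.

Lemma at_cont {T U : topologicalType} (f : T -> U) : (forall x, {for x, continuous f}) -> continuous f.
Proof. by []. Qed.

Lemma cc_pair {T U V : topologicalType} (f : T -> U) (g : T -> V) x : {for x, continuous f} ->
  {for x, continuous g} -> {for x, continuous (fun t => (f t, g t))}.
Proof. by move=> cf cg; exact: (@cvg_pair _ _ _ (nbhs x) (nbhs (f x)) (nbhs (g x)) _ _ _ f g cf cg). Qed.

Lemma cc_fst {T U : topologicalType} (p : T * U) : {for p, continuous (fun p : T * U => p.1)}.
Proof. by case: p => a b; exact: cvg_fst. Qed.
Lemma cc_snd {T U : topologicalType} (p : T * U) : {for p, continuous (fun p : T * U => p.2)}.
Proof. by case: p => a b; exact: cvg_snd. Qed.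

Lemma cc_sum {R : realType} {T : topologicalType} (I : Type) (r : seq I) (h : I -> T -> R[i]) x :
  (forall i, {for x, continuous (h i)}) -> {for x, continuous (fun t => \sum_(i <- r) h i t)}.
Proof. exact: (@cvgc_sum _ _ (nbhs x)). Qed.

Lemma cc_prod {R : realType} {T : topologicalType} (I : Type) (r : seq I) (h : I -> T -> R[i]) x :
  (forall i, {for x, continuous (h i)}) -> {for x, continuous (fun t => \prod_(i <- r) h i t)}.
Proof. exact: (@cvgc_prod _ _ (nbhs x)). Qed.

Lemma cont_at {T U : topologicalType} (f : T -> U) x : continuous f -> {for x, continuous f}.
Proof. by move=> cf; exact: (cf x). Qed.

Section paths_and_logarithms.
Context {R : realType}.
Local Notation C := R[i].
Local Notation Re := complex.Re.
Local Notation Im := complex.Im.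

Lemma cont_epsP (f : C -> C) z : {for z, continuous f} <->
  forall e : R, 0 < e -> exists2 d : R, 0 < d & forall w, normc (w - z) < d -> normc (f w - f z) < e.
Proof.
split=> [cf e e0|h]; first by have /nbhsCP := proj1 (ccP f z) cf e e0.
by apply: (proj2 (ccP f z)) => e e0; apply/nbhsCP; have [d d0 hd] := h e e0; exists d.
Qed.

(** The kernel of the exponential is discrete. Applied to a difference: two
    logarithms of one function on a connected set differ by a constant. *)
Lemma exp_const {T : topologicalType} (A : set T) (D : T -> C) :
  connected A -> {within A, continuous D} -> (forall x, A x -> expC (D x) = 1) ->
  forall x y, A x -> A y -> D x = D y.
Proof.
move=> cA cD eD x y Ax Ay; have cDA := connected_continuous_connected cA cD.
have e1 z w : (D @` A) z -> (D @` A) w -> normc (z - w) < 1 -> z = w.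
  move=> [a Aa <-] [b Ab <-] /expC_eq1_small; rewrite expCB !eD // divr1 => /(_ erefl) /eqP.
  by rewrite subr_eq0 => /eqP.
have Dx : (D @` A) (D x) by exists x.
suff : [set D x] = D @` A by move=> h; have : [set D x] (D y) by [rewrite h; exists y|].
apply: cDA; first by exists (D x).
- exists [set w | normc (w - D x) < 1].
    rewrite openE => w /= wx; apply/nbhsCP; exists (1 - normc (w - D x)); first by rewrite subr_gt0.
    by move=> v vw /=; rewrite (le_lt_trans (ler_distcD w _ _)) // -ltrBrDr.
  rewrite eqEsubset; split => w; first by move=> ->; split=> //=; rewrite subrr normc0.
  by move=> [Aw /= wx]; exact: e1.
- exists [set D x]; last by rewrite setIidr // => w ->.
  by apply: compact_closedC; exact: compact_set1.
Qed.

(** Retraction of the line onto [0, 1]; it turns paths defined on [0, 1] into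
    paths defined on the whole line. *)
Definition clamp (t : R) : R := Num.max 0 (Num.min t 1).

Lemma clamp01 t : 0 <= clamp t <= 1.
Proof. by rewrite /clamp le_max lexx /= ge_max ler01 ge_min lexx orbT. Qed.

Lemma clamp_id t : 0 <= t <= 1 -> clamp t = t.
Proof. by move=> /andP[t0 t1]; rewrite /clamp (min_l t1) max_r. Qed.

Lemma clamp_le0 t : t <= 0 -> clamp t = 0.
Proof.
by move=> t0; rewrite /clamp min_l ?max_l // (le_trans t0).
Qed.

Lemma clamp_ge1 t : 1 <= t -> clamp t = 1.
Proof. by move=> t1; rewrite /clamp min_r ?max_r // ler01. Qed.

Lemma clamp_cont : continuous clamp.
Proof.
move=> t; apply: (@continuous_max R R (fun=> 0) (fun t => Num.min t 1)); first exact: cvg_cst.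
by apply: (@continuous_min R R id (fun=> 1)); [exact: cvg_id|exact: cvg_cst].
Qed.

(** [v] lies in the path component of [u] in [O]. The path is defined on the
    whole line and stays in [O], so that no restriction to [0, 1] has to be
    carried along. *)
Definition joined (O : set C) (u v : C) :=
  exists c : R -> C, [/\ continuous c, c 0 = u, c 1 = v & forall t, O (c t)].

Lemma joined_itv (O : set C) (c : R -> C) (a b : R) : a <= b ->
  {within `[a, b], continuous c} -> (forall t, a <= t <= b -> O (c t)) -> joined O (c a) (c b).
Proof.
move=> ab cc Oc; pose s t := a + (b - a) * clamp t.
have sab t : a <= s t <= b.
  have /andP[h0 h1] := clamp01 t; rewrite /s; apply/andP; split.
    by rewrite lerDl mulr_ge0 // subr_ge0.
  by rewrite -lerBrDl ler_piMr // subr_ge0.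
have cs : continuous s.
  apply: at_cont => t; apply: rcD; first exact: rc_cst.
  by apply: rcM; [exact: rc_cst|exact: (cont_at clamp_cont)].
exists (c \o s); split.
- move=> t; apply: (proj2 (ccP (c \o s) t)) => e e0.
  move/subspace_continuousP : cc => /(_ (s t)) /=; rewrite in_itv /= => /(_ (sab t)).
  move=> /cvgCP/(_ e e0) h; have {}h : \forall u \near t, `[a, b]%classic (s u) -> normc (c (s u) - c (s t)) < e := cs t _ h.
  by apply: filterS h => u /=; apply; rewrite in_itv /= sab.
- by rewrite /s /= clamp_le0 // mulr0 addr0.
- by rewrite /s /= clamp_ge1 // mulr1 subrKC.
- by move=> t; exact: Oc.
Qed.

Lemma joined_refl (O : set C) u : O u -> joined O u u.
Proof. by move=> Ou; exists (fun=> u); split => //; apply: at_cont => t; exact: cc_cst. Qed.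

Lemma joined_sub (O O' : set C) u v : O `<=` O' -> joined O u v -> joined O' u v.
Proof. by move=> OO' [c [cc c0 c1 cO]]; exists c; split; [exact: cc|exact: c0|exact: c1|by move=> t; exact: OO']. Qed.

Lemma joined_sym (O : set C) u v : joined O u v -> joined O v u.
Proof.
move=> [c [cc c0 c1 cO]]; exists (fun t => c (1 - t)); split; [|by rewrite subr0|by rewrite subrr|by move=> t; exact: cO].
apply: at_cont => t; apply: (@cc_comp R R C (fun t : R => 1 - t) c); last exact: (cont_at cc).
by apply: rcB; [exact: rc_cst|exact: rc_id].
Qed.

(** Concatenation as a sum: one of the two clamped paths is always constant,
    equal to [v]. *)
Lemma joined_trans (O : set C) u v w : joined O u v -> joined O v w -> joined O u w.
Proof.
move=> [c [cc c0 c1 cO]] [d [cd d0 d1 dO]].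
exists (fun t => c (clamp (2 * t)) + d (clamp (2 * t - 1)) - v); split.
- apply: at_cont => t; apply: ccB; last exact: cc_cst.
  have c2 : {for t, continuous (fun t : R => 2 * t)}.
    by apply: rcM; [exact: rc_cst|exact: rc_id].
  apply: ccD.
    apply: (@cc_comp R R C (fun t => clamp (2 * t)) c); last exact: (cont_at cc).
    by apply: (@cc_comp R R R _ clamp _ c2); exact: (cont_at clamp_cont).
  apply: (@cc_comp R R C (fun t => clamp (2 * t - 1)) d); last exact: (cont_at cd).
  apply: (@cc_comp R R R (fun t => 2 * t - 1) clamp); last exact: (cont_at clamp_cont).
  by apply: rcB; [exact: c2|exact: rc_cst].
- by rewrite mulr0 clamp_le0 // c0 clamp_le0 ?d0 ?addrK // sub0r lerN10.
- rewrite mulr1 clamp_ge1 ?c1; last by rewrite ler1n.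
  by rewrite clamp_ge1 ?d1 1?addrC ?addKr //; lra.
- move=> t; have [h|h] := lerP (2 * t) 1.
    by rewrite [clamp (2 * t - 1)]clamp_le0 ?subr_le0 // d0 addrK.
  by rewrite [clamp (2 * t)]clamp_ge1 ?(ltW h) // c1 addrAC subrr add0r.
Qed.

Lemma joined_seg (O : set C) u v : (forall t : R, 0 <= t <= 1 -> O (u + (t%:C)%C * (v - u))) -> joined O u v.
Proof.
move=> h; exists (fun t => u + ((clamp t)%:C)%C * (v - u)); split.
- apply: at_cont => t; apply: ccD; first exact: cc_cst.
  by apply: ccM; [apply: cc_real; exact: (cont_at clamp_cont)|exact: cc_cst].
- by rewrite clamp_le0 // mul0r addr0.
- by rewrite clamp_ge1 // mul1r subrKC.
- by move=> t; apply: h; exact: clamp01.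
Qed.

Lemma joined_ball (O : set C) u v (e : R) : (forall w, normc (w - u) < e -> O w) ->
  normc (v - u) < e -> joined O u v.
Proof.
move=> h ve; apply: joined_seg => t /andP[t0 t1]; apply: h.
rewrite addrC addKr normcM normc_real ger0_norm // (le_lt_trans _ ve) //.
by rewrite ler_piMl // normc_ge0.
Qed.

Lemma joined_in (O : set C) u v : joined O u v -> O u /\ O v.
Proof. by move=> [c [_ <- <- cO]]. Qed.

Lemma joined_image (O O' : set C) (f : C -> C) u v : (forall z, O z -> {for z, continuous f}) ->
  (forall z, O z -> O' (f z)) -> joined O u v -> joined O' (f u) (f v).
Proof.
move=> cf OO' [c [cc c0 c1 cO]]; exists (f \o c); split; [|by rewrite /= c0|by rewrite /= c1|].
- by apply: at_cont => t; apply: (@cc_comp R C C c f t); [exact: (cont_at cc)|exact: cf].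
- by move=> t; exact: OO'.
Qed.

Lemma joined_open (O : set C) u : open O -> open (joined O u).
Proof.
move=> oO; rewrite openE => v uv; have [_ Ov] := joined_in uv.
have /nbhsCP[e e0 he] : nbhs v O by exact: open_nbhs_nbhs.
apply/nbhsCP; exists e => // w we; apply: joined_trans uv _.
exact: joined_ball he we.
Qed.

(** Path components of an open set are relatively closed. *)
Lemma joined_closure (O : set C) u v : open O -> closure (joined O u) v -> O v -> joined O u v.
Proof.
move=> oO cl Ov; have /nbhsCP[e e0 he] : nbhs v O by exact: open_nbhs_nbhs.
have [w [uw wv]] := cl _ (near_normc v e0).
by apply: joined_trans uw _; apply: joined_sym; exact: joined_ball he wv.
Qed.

(** A path starting in a path component stays in it; this turns a joining in
    [O] into a joining inside any set which contains the component. *)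
Lemma joined_max (O : set C) u v w : joined O u v -> joined O v w -> joined (joined O u) v w.
Proof.
move=> uv [c [cc c0 c1 cO]]; exists c; split; [exact: cc|exact: c0|exact: c1|move=> t].
apply: joined_trans uv _; rewrite -c0.
have [t0|t0] := lerP 0 t.
  by apply: (@joined_itv _ c 0 t t0) => //; exact: (continuous_subspaceT cc).
apply: joined_sym; apply: (@joined_itv _ c t 0 (ltW t0)) => //.
exact: (continuous_subspaceT cc).
Qed.

End paths_and_logarithms.

(** * Lifting of logarithms *)

Section lifting.
Context {R : realType} {T : topologicalType}.
Local Notation C := R[i].
Local Notation Re := complex.Re.

(** By compactness the quotients [H z t' / H z t] lie near 1 as soon as [t'] is
    close to [t], uniformly in [z]; so the sum of their principal logarithms
    along a fine subdivision is a continuous logarithm of [H z t / H z 0]. *)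
Lemma log_lift (X : set T) (H : T -> R -> C) : compact X ->
  (forall z (t : R), X z -> 0 <= t <= 1 -> {for (z, t), continuous (fun p : T * R => H p.1 p.2)}) ->
  (forall z (t : R), X z -> 0 <= t <= 1 -> H z t != 0) ->
  exists L : T -> R -> C, [/\ forall z, X z -> L z 0 = 0,
    forall z (t : R), X z -> 0 <= t <= 1 -> expC (L z t) * H z 0 = H z t &
    forall z (t : R), X z -> 0 <= t <= 1 -> {for (z, t), continuous (fun p : T * R => L p.1 p.2)}].
Proof.
move=> cX cH H0.
have [N hN] : exists N : nat, forall z t t', X z -> 0 <= t <= 1 -> `|t' - t| <= N.+1%:R^-1 ->
    normc (H z t' - H z t) < normc (H z t).
  pose P (n : nat) (p : T * R) := forall t', `|t' - p.2| <= n.+1%:R^-1 ->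
    normc (H p.1 t' - H p.1 p.2) < normc (H p.1 p.2).
  have cK : compact (X `*` (`[(0 : R), 1]%classic)) by apply: compact_setX => //; exact: segment_compact.
  have /compact_near_coveringP/(_ nat \oo P) := cK.
  case.
    move=> [z t] [/= Xz]; rewrite in_itv /= => t01.
    have h0 : 0 < normc (H z t) by rewrite normc_gt0 H0.
    have h3 : 0 < normc (H z t) / 3 by rewrite divr_gt0.
    have /ccP/(_ _ h3) [[U V] [/= Uz Vt] UV] := cH z t Xz t01.
    have /nbhs_normP[e /= e0 eV] := Vt.
    have e2 : 0 < e / 2 by rewrite divr_gt0.
    exists (U `*` [set s | `|s - t| < e / 2], [set n | n.+1%:R^-1 < e / 2]).
      split => /=.
        exists (U, [set s | `|s - t| < e / 2]) => //; split => //=.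
        by apply/nbhs_normP; exists (e / 2) => // s /=; rewrite distrC.
      exact: near_infty_natSinv_lt (PosNum e2).
    move=> [[z' s] n] [[/= Uz' st] ne] t' t's.
    have h1 : normc (H z' s - H z t) < normc (H z t) / 3.
      apply: (UV (z', s)); split => //=; apply: eV; rewrite /ball_ /= distrC (lt_trans st) //.
      by rewrite ltr_pdivrMr // mulr_natr mulr2n ltrDl.
    have h2 : normc (H z' t' - H z t) < normc (H z t) / 3.
      apply: (UV (z', t')); split => //=; apply: eV; rewrite /ball_ /= distrC.
      rewrite -(subrK s t') -addrA (le_lt_trans (ler_normD _ _)) // [ltRHS]splitr ltrD //.
      exact: le_lt_trans t's ne.
    have := ler_distcD (H z t) (H z' t') (H z' s); rewrite [normc (H z t - H z' s)]distcC.
    have := lerB_distc (H z t) (H z t - H z' s); rewrite [normc (H z t - H z' s)]distcC.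
    rewrite opprB [H z t + _]addrC subrK.
    lra.
  move=> N _ hN; exists N => z t t' Xz t01; apply: (hN N (leqnn N) (z, t)).
  by split => //=; rewrite in_itv.
(* [k j t] is the [j]-th subdivision point, stopped at [t] *)
pose k (j : nat) (t : R) := Num.min t (j%:R / N.+1%:R).
have k01 j t : 0 <= t <= 1 -> 0 <= k j t <= 1.
  move=> /andP[t0 t1]; rewrite /k le_min t0 /= ge_min t1 /= andbT.
  by rewrite divr_ge0.
have kS j t : `|k j.+1 t - k j t| <= N.+1%:R^-1.
  have h : j.+1%:R / N.+1%:R = j%:R / N.+1%:R + N.+1%:R^-1 :> R by rewrite -natr1 mulrDl mul1r.
  have n0 : 0 < N.+1%:R^-1 :> R by rewrite invr_gt0.
  rewrite /k h; move: (j%:R / N.+1%:R) => q; move: (N.+1%:R^-1) n0 => e e0.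
  by have [h1|h1] := lerP t (q + e); have [h2|h2] := lerP t q;
    rewrite ler_norml; apply/andP; split; lra.
pose q z t j := H z (k j.+1 t) / H z (k j t).
have qRe z t j : X z -> 0 <= t <= 1 -> 0 < Re (q z t j).
  move=> Xz t01; apply: Re_gt0_near1.
  have hn : H z (k j t) != 0 by apply: H0 => //; exact: k01.
  have -> : q z t j - 1 = (H z (k j.+1 t) - H z (k j t)) / H z (k j t).
    by rewrite /q; field.
  rewrite normcM normcV ltr_pdivrMr ?normc_gt0 // mul1r.
  by apply: hN => //; exact: k01.
exists (fun z t => \sum_(0 <= j < N.+1) logC (q z t j)); split.
- move=> z Xz; apply: big1 => j _; rewrite /q.
  have k00 i : k i 0 = 0 by rewrite /k min_l // divr_ge0.
  by rewrite !k00 mulfV ?logC1 // H0 // lexx ler01.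
- move=> z t Xz t01; rewrite expC_sum.
  suff tel n : (\prod_(0 <= j < n) expC (logC (q z t j))) * H z 0 = H z (k n t).
    rewrite tel; congr (H z _); rewrite /k divff // min_l //; by case/andP: t01.
  elim: n => [|n IH].
    by rewrite big_nil mul1r /k mul0r min_r //; case/andP: t01.
  rewrite big_nat_recr //= mulrAC IH logCK ?qRe // /q mulrC divfK // H0 //; exact: k01.
- move=> z t Xz t01; apply: cc_sum => j; apply: cc_logC; first exact: qRe.
  have ck i : {for (z, t), continuous (fun p : T * R => H p.1 (k i p.2))}.
    have ckk : {for (z, t), continuous (fun p : T * R => (p.1, k i p.2))}.
      apply: cc_pair; first exact: cc_fst.
      apply: (@cc_comp _ R R (fun p : T * R => p.2) (k i)); first exact: cc_snd.
      by apply: (@continuous_min R R id (fun=> _)); [exact: cvg_id|exact: cvg_cst].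
    exact: (@cc_comp _ _ C _ (fun p : T * R => H p.1 p.2) _ ckk (cH _ _ Xz (k01 _ _ t01))).
  by apply: ccM; [exact: ck|apply: ccV; [apply: H0 => //; exact: k01|exact: ck]].
Qed.

End lifting.

(** * Extension of functions and winding numbers *)

Section separation.
Context {R : realType}.
Local Notation C := R[i].
Local Notation Re := complex.Re.
Local Notation Im := complex.Im.

Lemma tietze_real (X : set C) (f : C -> R) : compact X -> {within X, continuous f} ->
  exists2 g : C -> R, continuous g & forall z, X z -> g z = f z.
Proof.
move=> cX cf.
have [M M0 fM] : exists2 M : R, 0 < M & forall z, X z -> `|f z| <= M.
  have [->|/set0P X0] := eqVneq X set0; first by exists 1.
  have cnf : {within X, continuous (fun z => `|f z|)}.
    move=> z; apply: (@continuous_comp (subspace X) R R f Num.norm); first exact: cf.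
    exact: norm_continuous.
  have [c _ cM] := compact_EVT_max X0 cX cnf.
  by exists (`|f c| + 1) => [|z Xz]; rewrite ?ltr_wpDl // ler_wpDr // cM // inE.
pose mk (u : R * R) : C := Complex u.1 u.2.
have cmk : continuous mk.
  apply: at_cont => u; apply: cc_Complex; [exact: cc_fst|exact: cc_snd].
have clX : closed (mk @^-1` X).
  by apply: closed_comp; [move=> u _; exact: cmk|exact: compact_closedC].
have cfm : {within mk @^-1` X, continuous ((f \o mk) : R * R -> R^o)}.
  apply/subspace_continuousP => u Xu; move=> A fA.
  have /subspace_continuousP/(_ _ Xu _ fA) h := cf.
  have h' : nbhs u (mk @^-1` [set z | X z -> A (f z)]) := cmk u _ h.
  by apply: filterS h' => v /=; apply.
have bd : forall u, (mk @^-1` X) u -> `|(f \o mk) u| <= M by move=> u; exact: fM.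
have [g [gE cg _]] := @continuous_bounded_extension (R * R)%type R (@pseudometric_normal R _)
   _ clX (f \o mk) M M0 cfm bd.
exists (fun z => g (Re z, Im z)).
  apply: at_cont => z; apply: (@cc_comp C _ R (fun z => (Re z, Im z)) g); last exact: (cont_at cg).
  by apply: cc_pair; [apply: cc_Re|apply: cc_Im]; exact: cc_id.
by move=> [a b] Xz; rewrite /= -gE // inE.
Qed.

(** Tietze's theorem for the real and the imaginary part. *)
Lemma tietzeC (X : set C) (f : C -> C) : compact X -> {within X, continuous f} ->
  exists2 g : C -> C, continuous g & forall z, X z -> g z = f z.
Proof.
move=> cX cf.
have cR : {within X, continuous (fun z => Re (f z))}.
  move=> z; apply: (@continuous_comp (subspace X) C R f (@complex.Re R)); first exact: cf.
  exact: Re_cont.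
have cI : {within X, continuous (fun z => Im (f z))}.
  move=> z; apply: (@continuous_comp (subspace X) C R f (@complex.Im R)); first exact: cf.
  exact: Im_cont.
have [g1 cg1 g1E] := tietze_real cX cR; have [g2 cg2 g2E] := tietze_real cX cI.
exists (fun z => Complex (g1 z) (g2 z)).
  by apply: at_cont => z; apply: cc_Complex; [exact: (cont_at cg1)|exact: (cont_at cg2)].
by move=> z Xz; rewrite g1E // g2E //; case: (f z).
Qed.

Lemma lift_unique (L M : R -> C) : {within `[0, 1], continuous L} -> {within `[0, 1], continuous M} ->
  (forall t, 0 <= t <= 1 -> expC (L t) = expC (M t)) -> L 0 = M 0 -> L 1 = M 1.
Proof.
move=> cL cM eLM LM0.
have cD : {within `[0, 1], continuous (fun t => L t - M t)}.
  move=> t; exact: (@cvgcB R (subspace `[0, 1]) (nbhs t) _ L M _ _ (cL t) (cM t)).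
have e1 t : `[0, 1]%classic t -> expC (L t - M t) = 1.
  by rewrite /= in_itv /= => /eLM; rewrite expCB => ->; rewrite divff // expC_neq0.
have := exp_const (@segment_connected R 0 1) cD e1 (x := 1) (y := 0).
rewrite /= !in_itv /= !lexx ler01 => /(_ isT isT) /eqP.
by rewrite LM0 subrr subr_eq0 => /eqP.
Qed.

Lemma normc_circle0 (B : R) t : 0 <= B -> normc ((B%:C)%C * expC (Complex 0 t)) = B.
Proof. by move=> B0; rewrite normcM normc_expC_i normc_real mulr1 ger0_norm. Qed.

Lemma expC_period t : expC (Complex 0 (t + pi *+ 2)) = expC (Complex 0 t) :> C.
Proof.
have -> : Complex 0 (t + pi *+ 2) = Complex 0 t + twopii by apply: ceqP; rewrite !reim /= ?addr0.
by rewrite expCD expC_twopii mulr1.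
Qed.

(** A function without zeros in the plane has winding number 0 along the circle
    of radius [B], since the circle shrinks to a point; and [(z - u) ^ m] has
    winding number [m] there. *)
Lemma no_winding (F : C -> C) (u : C) (m : int) (B : R) : 0 < B -> normc u < B ->
  (forall z, {for z, continuous F}) -> (forall z, F z != 0) ->
  (forall z, normc z = B -> F z = (z - u) ^ m) -> m = 0.
Proof.
move=> B0 uB cF F0 FE; pose P : R := pi *+ 2.
have P0 : 0 < P by rewrite mulrn_wgt0 // pi_gt0.
pose e (t : R) : C := expC (Complex 0 t).
have ce (t : R) : {for t, continuous e}.
  by apply: cc_expC; apply: cc_Complex; [exact: rc_cst|exact: rc_id].
pose H (t s : R) := F (((s * B)%:C)%C * e t).
have cH (t s : R) : {for (t, s), continuous (fun p : R * R => H p.1 p.2)}.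
  apply: (@cc_comp _ C C (fun p : R * R => ((p.2 * B)%:C)%C * e p.1) F); last exact: cF.
  apply: ccM; first by apply: cc_real; apply: rcM; [exact: cc_snd|exact: rc_cst].
  by apply: (@cc_comp _ R C (fun p : R * R => p.1) e); [exact: cc_fst|exact: ce].
have [L [L0 LE cL]] := log_lift (@segment_compact R 0 P) (fun t s _ _ => cH t s) (fun t s _ _ => F0 _).
pose A : set R := `[0, P]%classic.
have i0 : A 0 by rewrite /A /= in_itv /= lexx ltW.
have iP : A P by rewrite /A /= in_itv /= lexx ltW.
have eP : e P = e 0 by rewrite /e -[in LHS](add0r P) expC_period.
have cLs t : A t -> {within `[0, 1], continuous (L t)}.
  move=> At; apply: continuous_in_subspaceT => s; rewrite inE /= in_itv /= => s01.
  apply: (@cc_comp R _ C (fun s => (t, s)) (fun p : R * R => L p.1 p.2)).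
    by apply: cc_pair; [exact: cvg_cst|exact: rc_id].
  exact: cL.
(* the lift closes up, because it does so when the radius is 0 *)
have LP : L P 1 = L 0 1.
  apply: lift_unique; [exact: cLs|exact: cLs| |by rewrite !L0].
  move=> s s01; have H00 : H P 0 != 0 by exact: F0.
  apply: (mulIf H00); rewrite LE //.
  have <- : H 0 0 = H P 0 by rewrite /H !mul0r.
  by rewrite LE // /H eP.
(* [z - u = z * w] on the circle, with [w] in the right half-plane *)
pose w t := 1 - u / ((B%:C)%C * e t).
have Be t : (B%:C)%C * e t != 0.
  by rewrite -normc_gt0 normc_circle0 // ltW.
have wRe t : 0 < Re (w t).
  apply: Re_gt0_near1; rewrite /w addrC addKr normc_opp normcM normcV normc_circle0 ?(ltW B0) //.
  by rewrite ltr_pdivrMr // mul1r.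
pose D t := L t 1 - (Complex 0 t + logC (w t)) *~ m.
have wP : w P = w 0 by rewrite /w eP.
have cD : {within A, continuous D}.
  apply: continuous_in_subspaceT => t; rewrite inE => At; apply: ccB.
    apply: (@cc_comp R _ C (fun t : R => (t, 1 : R)) (fun p : R * R => L p.1 p.2)).
      by apply: cc_pair; [exact: rc_id|exact: rc_cst].
    by apply: cL => //; rewrite ler01 lexx.
  rewrite (_ : (fun _ => _) = fun t => (Complex 0 t + logC (w t)) * m%:~R); last first.
    by apply/funext => s; rewrite mulrzr.
  apply: ccM; last exact: cc_cst; apply: ccD.
    by apply: cc_Complex; [exact: rc_cst|exact: rc_id].
  apply: cc_logC; first exact: wRe.
  apply: ccB; [exact: cc_cst|apply: ccM; first exact: cc_cst].
  by apply: ccV; [exact: Be|apply: ccM; [exact: cc_cst|exact: ce]].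
have eD t : A t -> expC (D t) = expC (D 0).
  have key s : A s -> expC (D s) = ((B%:C)%C ^ m) / H 0 0.
    move=> As; rewrite /D expCB expCMz expCD logCK // -/(e s).
    have H00 : H 0 0 != 0 by exact: F0.
    have H0s : H s 0 = H 0 0 by rewrite /H !mul0r.
    have LsE : expC (L s 1) = H s 1 / H 0 0.
      by apply: (mulIf H00); rewrite divfK // -{1}H0s LE // ler01 lexx.
    have HsE : H s 1 = ((B%:C)%C * (e s * w s)) ^ m.
      rewrite /H mul1r FE; last by rewrite normc_circle0 // ltW.
      by congr (_ ^ _); rewrite /w; field; have := Be s; rewrite mulf_eq0 negb_or => /andP[-> ->].
    rewrite LsE HsE exprzMl; last 2 first.
    - by rewrite unitfE; have := Be s; rewrite mulf_eq0 negb_or => /andP[].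
    - rewrite unitfE mulf_neq0 //; first exact: expC_neq0.
      by apply/eqP => w0; have := wRe s; rewrite w0 ltxx.
    rewrite mulrAC mulfK //.
    apply: expfz_neq0; rewrite mulf_neq0 //; first exact: expC_neq0.
    by apply/eqP => w0; have := wRe s; rewrite w0 ltxx.
  by move=> At; rewrite !key.
have cD0 : {within A, continuous (fun t => D t - D 0)}.
  move=> t; exact: (@cvgcB R (subspace A) (nbhs t) _ D (fun=> D 0) _ _ (cD t) (cvg_cst _)).
have := exp_const (@segment_connected R 0 P) cD0 _ iP i0.
rewrite subrr => /(_ _)/eqP.
have e1 t : A t -> expC (D t - D 0) = 1.
  by move=> At; rewrite expCB eD // divff // expC_neq0.
move/(_ e1); rewrite subr_eq0 /D LP wP => /eqP/addrI/oppr_inj.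
move=> h; have : (Complex 0 P : C) *~ m = 0.
  apply/eqP; rewrite -subr_eq0 subr0; apply/eqP.
  have : (Complex 0 P + logC (w 0)) *~ m - (Complex 0 0 + logC (w 0)) *~ m = 0 by rewrite h subrr.
  rewrite -mulrzBl (_ : _ - _ = Complex 0 P) //.
  by rewrite opprD addrACA subrr addr0 -[Complex 0 0]/(0 : C) subr0.
move/eqP; rewrite -mulrzr mulf_eq0 => /orP[|].
  by rewrite eq_complex /= [P == 0]gt_eqF // ?andbF.
by rewrite intr_eq0 => /eqP.
Qed.

End separation.

(** * Eilenberg's separation criterion *)

Section eilenberg.
Context {R : realType}.
Local Notation C := R[i].
Local Notation Re := complex.Re.
Local Notation Im := complex.Im.

Lemma cc_expz {T : topologicalType} (f : T -> C) x (n : int) : f x != 0 ->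
  {for x, continuous f} -> {for x, continuous (fun t => f t ^ n)}.
Proof.
move=> f0 cf; have cn (k : nat) : {for x, continuous (fun t => f t ^+ k)}.
  elim: k => [|k IH]; first exact: cc_cst.
  rewrite (_ : (fun _ => _) = fun t => f t * f t ^+ k); last by apply/funext => t; rewrite exprS.
  exact: (ccM cf IH).
by case: n => n; [exact: cn|apply: ccV; [rewrite expf_neq0|exact: cn]].
Qed.

(** If the product of the [(z - u i) ^ m i] has a logarithm on [X], then no
    bounded component [O] of the complement contains exactly one [u j] with a
    nonzero exponent: otherwise the exponential of an extension of the
    logarithm, divided by the factors other than the [j]-th, can be glued on
    [X] to [(z - u j) ^ m j] outside [O], which gives a function without zeros
    whose winding number at infinity is [m j]. *)
Theorem eilenberg (I : finType) (u : I -> C) (m : I -> int) (X : set C) (phi : C -> C) (j : I) (B : R) :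
  compact X -> {within X, continuous phi} ->
  (forall z, X z -> expC (phi z) = \prod_i (z - u i) ^ m i) ->
  (forall i, ~ X (u i)) ->
  (forall v, joined (~` X) (u j) v -> normc v < B) ->
  (forall i, i != j -> m i != 0 -> ~ joined (~` X) (u j) (u i)) ->
  m j = 0.
Proof.
move=> cX cphi phiE uX bO other; pose O : set C := joined (~` X) (u j).
have oX : open (~` X) by apply: closed_openC; exact: compact_closedC.
have Ou : O (u j) by apply: joined_refl; exact: uX.
have [g cg gE] := tietzeC cX cphi.
(* [F1] is used on the component [O] of [u j], [F2] outside *)
pose F1 z := expC (g z) * \prod_(i | i != j) (z - u i) ^ (- m i).
pose F2 z := (z - u j) ^ m j.
have ne0 z i : i != j -> ~ O (u i) \/ m i = 0 -> O z \/ X z -> (z - u i) ^ (- m i) != 0.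
  move=> ij [nO|->] h; last by rewrite oppr0 expr0z oner_eq0.
  apply: expfz_neq0; rewrite subr_eq0; apply/eqP => zu; rewrite zu in h.
  by case: h => // /uX.
have oth i : i != j -> ~ O (u i) \/ m i = 0.
  by move=> ij; have [->|mi] := eqVneq (m i) 0; [right|left; exact: other].
have F10 z : O z \/ X z -> F1 z != 0.
  move=> h; rewrite mulf_neq0 ?expC_neq0 //; apply/prodf_neq0 => i ij.
  exact: ne0 ij (oth i ij) h.
have F20 z : ~ O z \/ X z -> F2 z != 0.
  move=> h; apply: expfz_neq0; rewrite subr_eq0; apply/eqP => zu; rewrite zu in h.
  by case: h => // /uX.
have cF1 z : O z \/ X z -> {for z, continuous F1}.
  move=> h; apply: ccM; first by apply: cc_expC; exact: (cont_at cg).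
  rewrite (_ : (fun _ => _) = fun t => \prod_(i <- enum I) (if i != j then (t - u i) ^ (- m i) else 1)); last first.
    by apply/funext => t; rewrite big_mkcond /= big_enum.
  apply: cc_prod => i; case: (boolP (i != j)) => ij; last exact: cc_cst.
  case: (oth i ij) => [nO|->]; last by rewrite oppr0; exact: cc_cst.
  apply: cc_expz; last by apply: ccB; [exact: cc_id|exact: cc_cst].
  rewrite subr_eq0; apply/eqP => zu; rewrite zu in h.
  by case: h => // /uX.
have cF2 z : ~ O z \/ X z -> {for z, continuous F2}.
  move=> h; apply: cc_expz; last by apply: ccB; [exact: cc_id|exact: cc_cst].
  rewrite subr_eq0; apply/eqP => zu; rewrite zu in h.
  by case: h => // /uX.
have F12 z : X z -> F1 z = F2 z.
  move=> Xz; rewrite /F1 gE // phiE // (bigD1 j) //= -/(F2 z) -mulrA -big_split /=.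
  rewrite big1 ?mulr1 // => i ij; rewrite -expfzDr ?subrr //.
  by rewrite subr_eq0; apply/eqP => zu; apply: (uX i); rewrite -zu.
pose F z := if `[< O z >] then F1 z else F2 z.
have FO z : O z -> F z = F1 z by move=> h; rewrite /F asboolT.
have FnO z : ~ O z -> F z = F2 z by move=> h; rewrite /F asboolF.
have clO z : closure O z -> ~ O z -> X z.
  by move=> cz nO; apply: contrapT => nX; apply: nO; exact: joined_closure.
have cF z : {for z, continuous F}.
  have [Oz|nO] := pselect (O z).
    apply: (@cc_near _ _ F F1); last by apply: cF1; left.
    have oO : open O by exact: joined_open.
    by apply: filterS (open_nbhs_nbhs (conj oO Oz)) => w; exact: FO.
  have [cz|ncz] := pselect (closure O z); last first.
    apply: (@cc_near _ _ F F2); last by apply: cF2; left.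
    have oO : open (~` closure O) by apply: closed_openC; exact: closed_closure.
    apply: filterS (open_nbhs_nbhs (conj oO ncz)) => w ncw; apply: FnO => Ow.
    by apply: ncw; exact: subset_closure.
  have Xz := clO z cz nO.
  apply: (proj2 (ccP F z)) => e e0.
  have h1 := proj1 (ccP F1 z) (cF1 z (or_intror Xz)) e e0.
  have h2 := proj1 (ccP F2 z) (cF2 z (or_intror Xz)) e e0.
  apply: filterS2 h1 h2 => w; rewrite (FnO z nO) (F12 z Xz) => h1 h2.
  by have [Ow|nOw] := pselect (O w); [rewrite FO|rewrite FnO].
have F0 z : F z != 0.
  have [Oz|nO] := pselect (O z); first by rewrite FO // F10 //; left.
  by rewrite FnO // F20 //; left.
have uB := bO _ Ou; have B0 := le_lt_trans (normc_ge0 _) uB.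
apply: (no_winding B0 uB cF F0) => z zB; apply: FnO => Oz.
by have := bO _ Oz; rewrite zB ltxx.
Qed.

Lemma cont_on_within {T U : topologicalType} (A : set T) (f : T -> U) :
  (forall x, A x -> {for x, continuous f}) -> {within A, continuous f}.
Proof. by move=> cf; apply: continuous_in_subspaceT => x; rewrite inE => /cf. Qed.

(** Moving the pole along [c] gives a logarithm of [(z - c 1) / (z - c 0)] off
    the path. *)
Lemma path_log (T : topologicalType) (X : set T) (h : T -> C) (c : R -> C) : compact X ->
  (forall x, X x -> {for x, continuous h}) -> continuous c -> (forall x t, X x -> h x != c t) ->
  exists L : T -> R -> C, [/\ forall x, X x -> L x 0 = 0,
    forall x (t : R), X x -> 0 <= t <= 1 -> expC (L x t) * (h x - c 0) = h x - c t,
    forall x, X x -> {within `[0, 1], continuous (L x)} &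
    {within X, continuous (fun x => L x 1)}].
Proof.
move=> cX ch cc hc.
have cH x (t : R) : X x -> 0 <= t <= 1 -> {for (x, t), continuous (fun p : T * R => h p.1 - c p.2)}.
  move=> Xx _; apply: ccB.
    by apply: (@cc_comp _ T C (fun p : T * R => p.1) h); [exact: cc_fst|exact: ch].
  by apply: (@cc_comp _ R C (fun p : T * R => p.2) c); [exact: cc_snd|exact: (cont_at cc)].
have H0 x (t : R) : X x -> 0 <= t <= 1 -> h x - c t != 0 by move=> Xx _; rewrite subr_eq0 hc.
have [L [L0 LE cL]] := log_lift cX cH H0.
exists L; split; [exact: L0|exact: LE| |].
- move=> x Xx; apply: cont_on_within => t; rewrite /= in_itv /= => t01.
  apply: (@cc_comp R _ C (fun t : R => (x, t)) (fun p : T * R => L p.1 p.2)).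
    by apply: cc_pair; [exact: cvg_cst|exact: rc_id].
  exact: cL.
- apply: cont_on_within => x Xx.
  apply: (@cc_comp T _ C (fun x : T => (x, 1 : R)) (fun p : T * R => L p.1 p.2)).
    by apply: cc_pair; [exact: cvg_id|exact: cvg_cst].
  by apply: cL; rewrite ?ler01 ?lexx.
Qed.

(** A form of Janiszewski's theorem: [u] and [v] are joined off [A1] by [c] and
    off [A2] by [b]. Following these paths gives a logarithm of [(z - v) / (z -
    u)] on [A1] and another one on [A2]. They agree on the intersection,
    because each of its points can be moved far away off both paths, and for a
    far away point both are equal to the principal one. So they define a
    logarithm on the union, and [eilenberg] applies. *)
Theorem joined_union (A1 A2 : set C) (u v : C) (b c : R -> C) (B M : R) :
  compact A1 -> compact A2 -> continuous b -> continuous c ->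
  b 0 = u -> b 1 = v -> c 0 = u -> c 1 = v ->
  (forall t, ~ A1 (c t)) -> (forall t, ~ A2 (b t)) ->
  (forall t, normc (b t) < M) -> (forall t, normc (c t) < M) ->
  (forall w, joined (~` (A1 `|` A2)) u w -> normc w < B) ->
  (forall z, A1 z -> A2 z -> exists2 z1, joined (~` (range b `|` range c)) z z1 & M <= normc z1) ->
  joined (~` (A1 `|` A2)) u v.
Proof.
move=> cA1 cA2 cb cc b0 b1 c0 c1 cA bA bM cM bO far.
have [L1 [L10 L1E cL1 cL1X]] := path_log cA1 (fun z _ => @cc_id R z) cc
   (fun z t (Az : A1 z) => introN eqP (fun e : z = c t => cA t (eq_ind _ A1 Az _ e))).
have [L2 [L20 L2E cL2 cL2X]] := path_log cA2 (fun z _ => @cc_id R z) cb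
   (fun z t (Az : A2 z) => introN eqP (fun e : z = b t => bA t (eq_ind _ A2 Az _ e))).
have M0 : 0 < M := le_lt_trans (normc_ge0 _) (bM 0).
(* far from the path, the continuous logarithm is the principal one *)
have far_log (d : R -> C) (L : R -> C) z : continuous d -> (forall t, normc (d t) < M) -> 3 * M <= normc z ->
    L 0 = 0 -> {within `[0, 1], continuous L} -> (forall t, 0 <= t <= 1 -> expC (L t) * (z - d 0) = z - d t) ->
    L 1 = logC ((z - d 1) / (z - d 0)).
  move=> cd dM zM L0' cL LE.
  have zd t : z - d t != 0.
    rewrite subr_eq0; apply/eqP => zd; move: zM; rewrite zd leNgt => /negP; apply.
    by rewrite (lt_trans (dM t)) // ltr_pMl // ltr1n.
  have Rz t : 0 < Re ((z - d t) / (z - d 0)).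
    apply: Re_gt0_near1.
    have -> : (z - d t) / (z - d 0) - 1 = (d 0 - d t) / (z - d 0) by field; exact: zd.
    rewrite normcM normcV ltr_pdivrMr ?normc_gt0 // mul1r.
    have := ler_normcD (d 0) (- d t); rewrite normc_opp.
    have := lerB_distc z (d 0); have := dM 0; have := dM t; lra.
  apply: (lift_unique cL (M := fun t => logC ((z - d t) / (z - d 0)))).
  - apply: cont_on_within => t _; apply: cc_logC; first exact: Rz.
    apply: ccM; last exact: cc_cst.
    by apply: ccB; [exact: cc_cst|exact: (cont_at cd)].
  - by move=> t t01; rewrite logCK // -LE // mulfK.
  - by rewrite L0' divff // logC1.
(* both logarithms are continued along a path [eta] which goes far away *)
have agree z : A1 z -> A2 z -> L1 z 1 = L2 z 1.
  move=> Az1 Az2; have [z1 zz1 z1M] := far z Az1 Az2.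
  have [eta [ceta eta0 eta1 etaO]] : joined (~` (range b `|` range c)) z (3 * z1).
    apply: joined_trans zz1 _; apply: joined_seg => t /andP[t0 t1].
    have : M <= normc (z1 + (t%:C)%C * (3 * z1 - z1)).
      have -> : z1 + (t%:C)%C * (3 * z1 - z1) = ((1 + 2 * t)%:C)%C * z1.
        by rewrite rmorphD rmorphM /= rmorph_nat; ring.
      rewrite normcM normc_real ger0_norm; last by rewrite addr_ge0 // mulr_ge0.
      by rewrite (le_trans z1M) // ler_peMl ?normc_ge0 // lerDl mulr_ge0.
    by move=> hM [[s _ e]|[s _ e]]; move: hM; rewrite -e leNgt ?bM ?cM.
  have eb (s t : R) : eta s != b t by apply/eqP => e; apply: (etaO s); left; exists t.
  have ec (s t : R) : eta s != c t by apply/eqP => e; apply: (etaO s); right; exists t.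
  have ce : forall s : R, `[0, 1]%classic s -> {for s, continuous eta} by move=> s _; exact: (cont_at ceta).
  have [N1 [N10 N1E cN1 cN1X]] := path_log (@segment_compact R 0 1) ce cc (fun s t _ => ec s t).
  have [N2 [N20 N2E cN2 cN2X]] := path_log (@segment_compact R 0 1) ce cb (fun s t _ => eb s t).
  have i0 : `[(0 : R), 1]%classic 0 by rewrite /= in_itv /= lexx ler01.
  have i1 : `[(0 : R), 1]%classic 1 by rewrite /= in_itv /= lexx ler01.
  have e01 : 0 <= (1 : R) <= 1 by rewrite ler01 lexx.
  have S1 : L1 z 1 = N1 0 1.
    apply: lift_unique; [exact: cL1|exact: cN1| |by rewrite L10 // N10].
    move=> t t01; have n0 : z - c 0 != 0 by rewrite subr_eq0 -eta0 ec.
    by apply: (mulIf n0); rewrite L1E // -{2}eta0 N1E // eta0.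
  have S2 : L2 z 1 = N2 0 1.
    apply: lift_unique; [exact: cL2|exact: cN2| |by rewrite L20 // N20].
    move=> t t01; have n0 : z - b 0 != 0 by rewrite subr_eq0 -eta0 eb.
    by apply: (mulIf n0); rewrite L2E // -{2}eta0 N2E // eta0.
  have z3 : 3 * M <= normc (eta 1).
    have -> : eta 1 = ((3 : R)%:C)%C * z1 by rewrite eta1 rmorph_nat.
    by rewrite normcM normc_real ger0_norm // ler_pM2l.
  have E1 := far_log c (N1 1) (eta 1) cc cM z3 (N10 _ i1) (cN1 _ i1) (fun t => N1E _ t i1).
  have E2 := far_log b (N2 1) (eta 1) cb bM z3 (N20 _ i1) (cN2 _ i1) (fun t => N2E _ t i1).
  have cD : {within `[0, 1], continuous (fun s => N1 s 1 - N2 s 1)}.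
    move=> t; exact: (@cvgcB R (subspace `[0, 1]) (nbhs t) _ (fun s => N1 s 1) (fun s => N2 s 1) _ _ (cN1X t) (cN2X t)).
  have eD s : `[(0 : R), 1]%classic s -> expC (N1 s 1 - N2 s 1) = 1.
    move=> s01; have n0 : eta s - c 0 != 0 by rewrite subr_eq0.
    rewrite expCB; apply/eqP; rewrite -(inj_eq (mulIf n0)) mulrAC N1E // mul1r.
    rewrite c1 c0 -{1}b1 -{1}b0 -(N2E s 1) // mulrAC divff ?mul1r //; exact: expC_neq0.
  have := exp_const (@segment_connected R 0 1) cD eD i0 i1.
  rewrite E1 E2 b0 b1 c0 c1 subrr -S1 -S2 => /eqP; rewrite subr_eq0 => /eqP //.
pose phi z := if `[< A1 z >] then L1 z 1 else L2 z 1.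
have phi1 z : A1 z -> phi z = L1 z 1 by move=> Az; rewrite /phi asboolT.
have phi2 z : A2 z -> phi z = L2 z 1.
  move=> Az; have [A1z|nA1] := pselect (A1 z); first by rewrite phi1 // agree.
  by rewrite /phi asboolF.
have cphi : {within A1 `|` A2, continuous phi}.
  apply: withinU_continuous; try exact: compact_closedC.
    apply: (@subspace_eq_continuous _ A1 _ (fun z => L1 z 1)); last exact: cL1X.
    by move=> z; rewrite inE => Az; rewrite /from_subspace phi1.
  apply: (@subspace_eq_continuous _ A2 _ (fun z => L2 z 1)); last exact: cL2X.
  by move=> z; rewrite inE => Az; rewrite /from_subspace phi2.
have nu : ~ (A1 `|` A2) u by move=> [|]; [rewrite -c0; exact: cA|rewrite -b0; exact: bA].
have nv : ~ (A1 `|` A2) v by move=> [|]; [rewrite -c1; exact: cA|rewrite -b1; exact: bA].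
apply: contrapT => nj.
pose U (x : bool) := if x then v else u; pose m (x : bool) : int := if x then 1 else -1.
suff : m false = 0 by [].
apply: (@eilenberg _ U m (A1 `|` A2) phi false B) => //.
- exact: compactU.
- move=> z Az; rewrite big_bool /= /m expr1z.
  have zu : z - u != 0 by rewrite subr_eq0; apply/eqP => e; apply: nu; rewrite -e.
  suff -> : expC (phi z) = (z - v) / (z - u) by [].
  apply: (mulIf zu); rewrite divfK //.
  have e01 : 0 <= (1 : R) <= 1 by rewrite ler01 lexx.
  by case: Az => Az; [rewrite phi1 // -c0 L1E // c1|rewrite phi2 // -b0 L2E // b1].
- by case.
- by case.
Qed.

End eilenberg.

(** * Symmetries of the square *)

Section dihedral.
Context {R : realType}.
Local Notation C := R[i].
Local Notation Re := complex.Re.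
Local Notation Im := complex.Im.

(** The eight symmetries of a square centred at 0 are encoded by three bits:
    conjugation, sign, and a quarter turn. *)
Definition dih_unit (i : bool * bool * bool) : C :=
  (if i.1.2 then -1 else 1) * (if i.2 then 'i%C else 1).
Definition dih (i : bool * bool * bool) (w : C) : C :=
  dih_unit i * (if i.1.1 then conjc w else w).

Lemma dih0 i : dih i 0 = 0.
Proof. by rewrite /dih rmorph0 if_same mulr0. Qed.

Lemma normc_dih i w : normc (dih i w) = normc w.
Proof.
rewrite /dih /dih_unit !normcM [normc (if i.1.2 then _ else _)](_ : _ = 1); last first.
  by case: (i.1.2); rewrite ?normc_opp normc1.
rewrite [normc (if i.2 then _ else _)](_ : _ = 1); last first.
  by case: (i.2); rewrite ?normc_imag ?normr1 ?normc1.
by rewrite !mul1r; case: (i.1.1); rewrite ?normc_conj.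
Qed.

Lemma dihB i v w : dih i v - dih i w = dih i (v - w).
Proof. by rewrite /dih -mulrBr; case: (i.1.1); rewrite ?rmorphB. Qed.

Lemma dih_cont i w : {for w, continuous (dih i)}.
Proof.
apply/cont_epsP => e e0; exists e => // v ve; by rewrite dihB normc_dih.
Qed.

Lemma conj_dih i w : conjc (dih i w) = dih (~~ i.1.1, i.1.2 (+) i.2, i.2) w.
Proof.
by case: i w => [[[] []] []] [a b]; apply: ceqP; rewrite /dih /dih_unit /= ?reim /=; ring.
Qed.

Lemma Re_dih i w : Re (dih i w) = Im (dih (i.1.1, i.1.2 (+) i.2, ~~ i.2) w).
Proof.
by case: i w => [[[] []] []] [a b]; rewrite /dih /dih_unit /= ?reim /=; ring.
Qed.

(** The bound on the imaginary parts, taken for the four quarter turns, bounds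
    both coordinates. *)
Lemma dih_bounded w (k : R) : (forall i, Im (dih i w) < k) -> normc w <= 2 * k.
Proof.
move=> h.
have := h (false, false, false); have := h (true, false, false).
have := h (false, false, true); have := h (false, true, true).
case: w {h} => a b; rewrite /dih /dih_unit /= ?reim /= => h1 h2 h3 h4.
rewrite (le_trans (normc_le_sum _ _)) // mulr_natl mulr2n; apply: lerD.
  by rewrite ler_norml; apply/andP; split; lra.
by rewrite ler_norml; apply/andP; split; lra.
Qed.

Lemma cdiff_dih i (F : C -> C) w : cdiff F (dih i w) ->
  cdiff (fun v => if i.1.1 then conjc (F (dih i v)) else F (dih i v)) w.
Proof.
rewrite /dih; case: (i.1.1) => dF.
  apply: (@cdiff_conj _ (fun v => F (dih_unit i * v)) w).
  apply: (@cdiff_comp _ F (fun v => dih_unit i * v)) => //.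
  by apply: cdiffM; [exact: cdiff_cst|exact: cdiff_id].
apply: (@cdiff_comp _ F (fun v => dih_unit i * v)) => //.
by apply: cdiffM; [exact: cdiff_cst|exact: cdiff_id].
Qed.

End dihedral.

(** * Continuity of the inverse of a conformal map *)

(** [tau] is a conformal map of [E] onto the unit disc and [f] is its inverse.
    *)
Section conformal_inverse.
Context {R : realType}.
Local Notation C := R[i].
Local Notation Re := complex.Re.
Local Notation Im := complex.Im.
Variables (E : set C) (tau f : C -> C).
Hypothesis oE : open E.
Hypothesis dtau : forall w, E w -> cdiff tau w.
Hypothesis tau_inj : forall v w, E v -> E w -> tau v = tau w -> v = w.
Hypothesis tauE : forall w, E w -> normc (tau w) < 1.
Hypothesis fE : forall z, normc z < 1 -> E (f z) /\ tau (f z) = z.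

Lemma ftau w : E w -> f (tau w) = w.
Proof. by move=> Ew; have [h1 h2] := fE (tauE Ew); exact: tau_inj. Qed.

(** If [f z'] were outside a small disc about [f z] for some [z'] close to [z],
    the function [1 / (tau - z')] would be holomorphic on the disc, large at
    its centre and bounded on its boundary. *)
Lemma conformal_inverse_cont z : normc z < 1 -> {for z, continuous f}.
Proof.
move=> z1; have [Efz tfz] := fE z1; set w0 := f z in Efz tfz.
have /nbhsCP[e1 e10 he1] : nbhs w0 E by exact: open_nbhs_nbhs.
apply/cont_epsP => e e0; pose r := Num.min e e1 / 2.
have m0 : 0 < Num.min e e1 by rewrite lt_min e0.
have r0 : 0 < r by rewrite divr_gt0.
have rm : r < Num.min e e1 by rewrite ltr_pdivrMr // mulr_natr mulr2n ltrDl.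
have /andP[re re1] : (r < e) && (r < e1) by rewrite -lt_min.
have BE w : normc (w - w0) <= r -> E w by move=> h; apply: he1; exact: le_lt_trans h re1.
pose S := [set w : C | normc (w - w0) = r].
have cS : compact S.
  apply: (@bounded_closed_compactC _ _ (normc w0 + r)).
    rewrite (_ : S = (fun w => normc (w - w0)) @^-1` [set r]) //.
    apply: closed_comp; last exact: closed_eq.
    by move=> w _; exact: (cc_normc (ccB (@cc_id R w) (@cc_cst R C w0 w))).
  by move=> w wS; rewrite -[w](subrK w0) addrC (le_trans (ler_normcD _ _)) // lerD2l wS.
have S0 : S !=set0.
  by exists (w0 + (r%:C)%C); rewrite /S /= addrC addKr normc_real ger0_norm // ltW.
have cm : {within S, continuous (fun w => normc (tau w - z))}.
  apply: cont_on_within => w Sw; apply: cc_normc; apply: ccB; last exact: cc_cst.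
  by apply: cdiff_cont; apply: dtau; apply: BE; rewrite Sw.
have [c Sc cmin] := compact_EVT_min S0 cS cm.
rewrite inE in Sc; set m := normc (tau c - z) in cmin.
have mpos : 0 < m.
  rewrite normc_gt0 subr_eq0; apply/eqP => h; have Ec : E c by apply: BE; rewrite Sc.
  have cw : c = w0 by apply: tau_inj => //; rewrite tfz.
  by move: r0; rewrite -Sc cw subrr normc0 ltxx.
pose d := Num.min (m / 2) (1 - normc z).
have d0 : 0 < d by rewrite lt_min divr_gt0 //= subr_gt0.
exists d => // z' z'd.
have z'm : normc (z' - z) < m / 2 by rewrite (lt_le_trans z'd) // ge_min lexx.
have z'1 : normc z' < 1.
  rewrite -[z'](subrK z) (le_lt_trans (ler_normcD _ _)) // -ltrBrDr (lt_le_trans z'd) //.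
  by rewrite ge_min lexx orbT.
have [Efz' tfz'] := fE z'1.
rewrite ltNge; apply/negP => far.
pose h w := (tau w - z')^-1.
pose G := [set w : C | normc (w - w0) < r].
have clG w : closure G w -> normc (w - w0) <= r.
  move=> cw; apply/ler_addgt0Pl => s s0.
  have [v [/= Gv vw]] := cw _ (near_normc w s0).
  by rewrite (le_trans (ler_distcD v _ _)) // distcC lerD // ltW.
have nz w : normc (w - w0) <= r -> tau w - z' != 0.
  move=> wr; rewrite subr_eq0; apply/eqP => tw.
  have wE : w = f z' by apply: tau_inj; rewrite ?tfz' //; exact: BE.
  by move: wr; rewrite wE leNgt (lt_le_trans re far).
have oG : open G.
  rewrite openE => w /= wr; apply/nbhsCP; exists (r - normc (w - w0)); first by rewrite subr_gt0.
  by move=> v vw; rewrite /G /= (le_lt_trans (ler_distcD w _ _)) // -ltrBrDr.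
have mm : forall w, G w -> normc (h w) <= (m / 2)^-1.
  apply: (@maximum_modulus R G h (m / 2)^-1 (normc w0 + r) oG).
- move=> w wr; have := ler_normcD w0 (w - w0); rewrite subrKC => /le_trans; apply.
  by rewrite lerD2l; apply: ltW.
- move=> w /clG wr; apply: cdiff_inv; first exact: nz.
  by apply: cdiffB; [apply: dtau; exact: BE|exact: cdiff_cst].
- move=> w /clG wr nG.
  have Sw : S w by apply/eqP; rewrite eq_le wr leNgt; apply/negP.
  have hp : 0 < normc (tau w - z') by rewrite normc_gt0 nz.
  have m2 : 0 < m / 2 by rewrite divr_gt0.
  rewrite /h normcV lef_pV2 //.
  have := cmin w; rewrite inE => /(_ Sw) mw.
  have := ler_distcD z' (tau w) z; lra.
have Gw0 : G w0 by rewrite /G /= subrr normc0.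
move: (nz w0); rewrite subrr normc0 => /(_ (ltW r0)) nz0.
have hp : 0 < normc (tau w0 - z') by rewrite normc_gt0.
have m2 : 0 < m / 2 by rewrite divr_gt0.
have := mm w0 Gw0; rewrite /h normcV lef_pV2 //.
by rewrite tfz distcC => /le_lt_trans/(_ z'm); rewrite ltxx.
Qed.

End conformal_inverse.

(** * A Lindeloef estimate *)

Section strict_inequalities.
Context {R : realType} {T : topologicalType}.
Lemma rc_lt (g : T -> R) x (a : R) : {for x, continuous g} -> g x < a -> \forall y \near x, g y < a.
Proof. move=> cg h; exact: (cg _ (open_nbhs_nbhs (conj (@open_lt R a) h))). Qed.
Lemma rc_gt (g : T -> R) x (a : R) : {for x, continuous g} -> a < g x -> \forall y \near x, a < g y.
Proof. move=> cg h; exact: (cg _ (open_nbhs_nbhs (conj (@open_gt R a) h))). Qed.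
End strict_inequalities.

(** Here [E] is a domain which does not surround 0: no loop in it winds around
    0, by [lift_closed]. *)
Section finger.
Context {R : realType}.
Local Notation C := R[i].
Local Notation Re := complex.Re.
Local Notation Im := complex.Im.
Variables (E : set C) (tau f : C -> C).
Hypothesis oE : open E.
Hypothesis dtau : forall w, E w -> cdiff tau w.
Hypothesis tau_inj : forall v w, E v -> E w -> tau v = tau w -> v = w.
Hypothesis tauE : forall w, E w -> normc (tau w) < 1.
Hypothesis fE : forall z, normc z < 1 -> E (f z) /\ tau (f z) = z.
Hypothesis lift_closed : forall s : R -> C, continuous s -> (forall t, E (expC (s t))) ->
  expC (s 0) = expC (s 1) -> s 0 = s 1.
Variable p : C.
Hypothesis p1 : normc p = 1.

Let ftau := ftau tau_inj tauE fE.
Let cf := conformal_inverse_cont oE dtau tau_inj fE.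

Lemma pi_lt5 : (pi : R) < 5.
Proof. have := @pihalf_lt2 R; lra. Qed.

(** Let a path in the intersection of all images of [G] under the symmetries
    about [z0] reach a point whose image under a symmetry [dih i] has imaginary
    part pi. The conjugate of that image is the image under another symmetry
    [dih j], so [G] joins two points which differ by 2 pi i. The exponential of
    such a path is a loop in [E] which winds around 0, against [lift_closed].
    *)
Lemma dih_component_below_pi (G : set C) (z0 : C) (w : C) i : open G ->
  (forall z, G z -> E (expC z)) ->
  joined [set w | forall i, G (z0 + dih i w)] 0 w -> Im (dih i w) < pi.
Proof.
move=> oG GE [c [cc c0 c1 cG]]; rewrite ltNge; apply/negP => hpi.
pose g t := Im (dih i (c t)).
have cg : {within `[0, 1], continuous g}.
  apply: cont_on_within => t _; apply: cc_Im.
  by apply: (@cc_comp R C C c (dih i)); [exact: (cont_at cc)|exact: dih_cont].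
have [t0 t01 gt0] : exists2 t, t \in `[(0 : R), 1] & g t = pi.
  apply: IVT => //; rewrite /g c0 c1 dih0 /=.
  by rewrite ge_min le_max hpi (@pi_ge0 R) orbT.
have G0 : G z0 by have := cG 0 i; rewrite c0 dih0 addr0.
rewrite in_itv /= in t01; have /andP[t00 t0le] := t01.
have cdi j : {within `[0, t0], continuous (fun t => z0 + dih j (c t))}.
  apply: cont_on_within => t _; apply: ccD; first exact: cc_cst.
  by apply: (@cc_comp R C C c (dih j)); [exact: (cont_at cc)|exact: dih_cont].
have J j : joined G z0 (z0 + dih j (c t0)).
  have := joined_itv t00 (cdi j) (fun t _ => cG t j).
  by rewrite c0 dih0 addr0.
pose j : bool * bool * bool := (~~ i.1.1, i.1.2 (+) i.2, i.2).
have [s [cs s0 s1 sG]] := joined_trans (joined_sym (J j)) (J i).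
have Ej : dih i (c t0) = dih j (c t0) + twopii.
  rewrite -conj_dih; move: gt0; rewrite /g; case: (dih i (c t0)) => a b /= ->.
  by apply: ceqP; rewrite !reim /=; rewrite ?addr0 // mulr2n; ring.
have e01 : expC (s 0) = expC (s 1) by rewrite s0 s1 Ej addrA (expCD _ twopii) expC_twopii mulr1.
have := lift_closed cs (fun t => GE _ (sG t)) e01; rewrite s0 s1 Ej addrA => /eqP.
by rewrite -subr_eq0 opprD addNKr oppr_eq0 (negbTE twopii_neq0).
Qed.

(** Let [f z] be close to 0 and [z] away from [p]. If the component of [z] in
    the part of the disc which is away from [p] and on which the modulus of [f]
    is less than [r1] stayed in the disc of radius [r < 1], look at it in the
    coordinate log f. It lies to the left of ln r1, at a distance of at least 5
    from that line there is the point [zeta] over [z], and on the rest of its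
    boundary [tau] is close to [p]. Its symmetrization about [zeta], the
    intersection of its images under the eight symmetries of a square, is
    contained in a square of half side pi by [dih_component_below_pi], so it
    does not reach the line ln r1. On its boundary one of the eight functions
    [tau - p], composed with the symmetries, is at most [eps ^+ 8 / 256] and
    the others are at most 2; at [zeta] their product is at least [eps ^+ 8].
    This contradicts the maximum modulus principle. *)
Theorem finger_reaches_circle (r1 eps r : R) (z : C) : 0 < r1 -> 0 < eps <= 1 ->
  normc z < 1 -> normc (f z) <= r1 * expR (-5) -> eps <= normc (z - p) -> r < 1 ->
  exists2 v, joined [set v | [/\ normc v < 1, normc (f v) < r1 & eps ^+ 8 / 256 < normc (v - p)]] z v &
    r <= normc v.
Proof.
move=> r10 /andP[e0 e1] z1 fz zp r_lt1; set Q := [set v | _].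
pose de : R := eps ^+ 8 / 256.
have de_lt : de < eps.
  rewrite /de ltr_pdivrMr; last by rewrite ltr0n.
  rewrite (@le_lt_trans _ _ eps); [by []| |by rewrite (ltr_pMr _ e0) ltr1n].
  by rewrite exprS ler_piMr ?(ltW e0) // exprn_ile1 // ltW.
apply: contrapT => /forall2NP nfar.
have inside v : joined Q z v -> normc v < r.
  by move=> jv; case: (nfar v) => // /negP; rewrite -ltNge.
have [Efz tfz] := fE z1.
have fz0 : f z != 0.
  (* 0 is not in [E], as small circles about 0 do not lift to closed paths *)
  apply/eqP => f0.
  have /nbhsCP[e e'0 he] : nbhs (0 : C) E by apply: open_nbhs_nbhs; split => //; rewrite -f0.
  have cs : continuous (fun t : R => Complex (ln (e / 2)) ((pi *+ 2) * t) : C).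
    apply: at_cont => t; apply: cc_Complex; first exact: rc_cst.
    by apply: rcM; [exact: rc_cst|exact: rc_id].
  have e2 : 0 < e / 2 by rewrite divr_gt0.
  have Es (t : R) : E (expC (Complex (ln (e / 2)) ((pi *+ 2) * t))).
    apply: he; rewrite subr0 normc_expC /= lnK //.
    by rewrite ltr_pdivrMr // mulr_natr mulr2n ltrDl.
  have := lift_closed cs Es; rewrite mulr0 mulr1 /expC /= cos0 sin0 cos2pi sin2pi => /(_ erefl) /eqP.
  by rewrite eq_complex /= eqxx /= eq_sym gt_eqF // mulrn_wgt0 // pi_gt0.
have [zeta zetaE] := expC_surj fz0.
pose s1 := ln r1.
have Rzeta : Re zeta <= s1 - 5.
  by rewrite -ler_expR -normc_expC zetaE (le_trans fz) // /s1 expRD lnK.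
pose Qz := [set x : C | [/\ E (expC x), Re x < s1 & de < normc (tau (expC x) - p)]].
have ctE x : E (expC x) -> {for x, continuous (fun x => tau (expC x))}.
  move=> Ex; apply: (@cc_comp C C C expC tau); first exact: (cont_at expC_cont).
  by apply: cdiff_cont; exact: dtau.
have oEe : open [set x : C | E (expC x)].
  by apply: open_comp => // x _; exact: (cont_at expC_cont).
have oQz : open Qz.
  rewrite openE => x [Ex xs xp].
  have n1 : \forall y \near x, E (expC y) by exact: (open_nbhs_nbhs (conj oEe Ex)).
  have cR : {for x, continuous (@complex.Re R)} by exact: (cont_at Re_cont).
  have n2 : \forall y \near x, Re y < s1.
    exact: (rc_lt cR xs).
  have cT : {for x, continuous (fun y => normc (tau (expC y) - p))}.
    by apply: cc_normc; apply: ccB; [exact: ctE|exact: cc_cst].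
  have n3 : \forall y \near x, de < normc (tau (expC y) - p).
    exact: (rc_gt cT xp).
  by apply: filterS3 n1 n2 n3.
(* [G] is the component in the coordinate log f *)
pose G := joined Qz zeta.
have oG : open G by exact: joined_open.
have GQ x : G x -> Qz x by move=> Gx; exact: (proj2 (joined_in Gx)).
have Qzeta : Qz zeta.
  rewrite /Qz /= zetaE tfz; split => //; last exact: lt_le_trans de_lt zp.
  by rewrite (le_lt_trans Rzeta) // ltrBlDr ltrDl.
have GT x : G x -> normc (tau (expC x)) < r.
  move=> Gx; apply: inside; rewrite -tfz -zetaE.
  apply: (@joined_image _ Qz Q (fun x => tau (expC x)) zeta x) Gx => y [Ey ys yp]; first exact: ctE.
  split; [exact: tauE| |exact: yp].
  by rewrite ftau // normc_expC -[r1]lnK // ltr_expR.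
(* the closure of [G] stays over the compact set [K] in [E] *)
pose K := f @` [set v | normc v <= r].
have cK : compact K.
  apply: continuous_compact.
    by apply: cont_on_within => v vr; apply: cf; exact: le_lt_trans vr r_lt1.
  exact: compact_disc.
have clGE x : closure G x -> E (expC x).
  move=> cx; have Kx : K (expC x).
    apply: (compact_closedC cK) => U Ux; have U' : nbhs x (expC @^-1` U) := @expC_cont R x U Ux.
    have [y [Gy Uy]] := cx _ U'.
    exists (expC y); split => //; exists (tau (expC y)); first exact: (ltW (GT _ Gy)).
    by rewrite ftau //; have [] := GQ _ Gy.
  by case: Kx => v vr <-; have [] := fE (le_lt_trans vr r_lt1).
have clGb x : closure G x -> Re x < s1 -> ~ G x -> normc (tau (expC x) - p) <= de.
  move=> cx xs nG; rewrite leNgt; apply/negP => h; apply: nG.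
  by apply: joined_closure => //; split => //; exact: clGE.
pose A := [set w | forall i, G (zeta + dih i w)].
have dG i w : {for w, continuous (fun w => zeta + dih i w)}.
  by apply: ccD; [exact: cc_cst|exact: dih_cont].
have oA : open A.
  rewrite openE => w Aw.
  suff : \forall v \near w, forall i, G (zeta + dih i v) by [].
  apply: (@filter_forall _ _ (fun (i : bool * bool * bool) (v : C) => G (zeta + dih i v)) (nbhs w) _) => i.
  exact: (dG i w _ (open_nbhs_nbhs (conj oG (Aw i)))).
pose Gs := joined A 0.
have oGs : open Gs by exact: joined_open.
have A0 : A 0 by move=> i; rewrite dih0 addr0; exact: joined_refl.
have imB i w : Gs w -> Im (dih i w) < pi.
  by apply: dih_component_below_pi => // x /GQ[].
have clB i w : closure Gs w -> Im (dih i w) <= pi.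
  move=> cw; apply/ler_addgt0Pl => e e'0.
  have [v [Gv vw]] := cw _ (near_normc w e'0).
  have := normc_Im (dih i v - dih i w); rewrite dihB normc_dih -dihB ImD ImN.
  have := imB i v Gv; rewrite ler_norml => h /andP[_ h2]; move: (vw : normc (v - w) < e).
  have := normc_Im (dih i v - dih i w); rewrite dihB normc_dih -dihB ImD ImN ler_norml => /andP[h3 _]; lra.
have clGs i w : closure Gs w -> closure G (zeta + dih i w).
  move=> cw U Uw; have U' : nbhs w ((fun w => zeta + dih i w) @^-1` U) := dG i w U Uw.
  have [v [Gv Uv]] := cw _ U'.
  by exists (zeta + dih i v); split => //; have [_ Av] := joined_in Gv; exact: Av.
have clRe i w : closure Gs w -> Re (zeta + dih i w) < s1.
  move=> cw; rewrite ReD Re_dih; have := clB (i.1.1, i.1.2 (+) i.2, ~~ i.2) w cw.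
  have := pi_lt5; lra.
(* the factor [hh i] is conjugated when [dih i] is antiholomorphic *)
pose F (w : C) := tau (expC (zeta + w)) - p.
pose hh i (v : C) := if i.1.1 then conjc (F (dih i v)) else F (dih i v).
pose h v := \prod_(i <- index_enum _) hh i v.
have nhh i v : normc (hh i v) = normc (F (dih i v)).
  by rewrite /hh; case: ifP => _ //; rewrite normc_conj.
have clF2 i w : closure Gs w -> normc (F (dih i w)) <= 2.
  move=> cw; have Ew := clGE _ (clGs i w cw).
  rewrite /F (le_trans (ler_normcD _ _)) // normc_opp p1 -[2]/(1 + 1) lerD2r ltW //.
  exact: tauE.
have hE v : normc (h v) = \prod_(i <- index_enum _) normc (F (dih i v)).
  rewrite /h (big_morph (fun z : C => normc z) (@normcM R) (@normc1 R)).
  by apply: eq_bigr => i _; rewrite nhh.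
have Gs0 : Gs 0 by exact: joined_refl.
have : normc (h 0) <= de * 2 ^+ 7.
  apply: (@maximum_modulus R Gs h (de * 2 ^+ 7) (2 * pi)) Gs0 => //.
  - by move=> w Gw; apply: dih_bounded => i; exact: imB.
  - move=> w cw; rewrite /h; apply: cdiff_prod => i; apply: cdiff_dih.
    have Ew := clGE _ (clGs i w cw).
    apply: cdiffB; last exact: cdiff_cst.
    apply: (@cdiff_comp _ tau (fun v => expC (zeta + v))); last exact: dtau.
    apply: (@cdiff_comp _ expC (fun v => zeta + v)); last exact: cdiff_expC.
    by apply: cdiffD; [exact: cdiff_cst|exact: cdiff_id].
  - move=> w cw nG; have [i nGi] : exists i, ~ G (zeta + dih i w).
      apply: contrapT => /forallNP H; apply: nG; apply: joined_closure => //.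
      by move=> i; exact: (contrapT (H i)).
    rewrite hE (bigD1_seq i) ?mem_index_enum ?index_enum_uniq //=.
    apply: ler_pM; rewrite ?normc_ge0 ?prodr_ge0 //.
    + by move=> j _; exact: normc_ge0.
    + exact: (clGb _ (clGs i w cw) (clRe i w cw) nGi).
    apply: (@le_trans _ _ (\prod_(j <- index_enum _ | j != i) 2)).
      by apply: ler_prod => j _; rewrite normc_ge0 clF2.
    rewrite prodr_const; rewrite (_ : #|_| = 7%N) //.
    have := cardC1 i; rewrite !card_prod !card_bool => h7; rewrite -[7%N]/((2 * 2 * 2).-1)%N -h7.
    by apply: eq_card => j; rewrite !inE.
rewrite hE (eq_bigr (fun _ => normc (z - p))); last first.
  by move=> i _; rewrite dih0 /F addr0 zetaE tfz.
rewrite prodr_const !card_prod !card_bool.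
apply/negP; rewrite -ltNge (@lt_le_trans _ _ (eps ^+ 8)) //; last first.
  by rewrite lerXn2r // ?nnegrE ?normc_ge0 // ltW.
have e8 : 0 < eps ^+ 8 by rewrite exprn_gt0.
rewrite /de -mulrA gtr_pMr // (_ : 2 ^+ 7 = 128) ?ltr_pdivrMl //; last by rewrite -natrX.
by rewrite mulr1 ltr_nat.
Qed.

End finger.

(** * Joining strands near a prime end *)

Section concatenation.
Context {R : realType}.
Local Notation C := R[i].

Lemma joined_compact (O : set C) u v : joined O u v ->
  exists (c : R -> C) (K : set C), [/\ continuous c, c 0 = u, c 1 = v, compact K & K `<=` O /\ forall t : R, K (c t)].
Proof.
move=> [c [cc c0 c1 cO]]; exists (c \o clamp), (c @` `[0, 1]); split.
- by apply: at_cont => t; apply: (@cc_comp R R C clamp c); [exact: (cont_at clamp_cont)|exact: (cont_at cc)].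
- by rewrite /= clamp_le0.
- by rewrite /= clamp_ge1.
- by apply: continuous_compact; [exact: continuous_subspaceT|exact: segment_compact].
- by split=> [z [t _ <-] //|t]; exists (clamp t) => //=; rewrite in_itv /= clamp01.
Qed.

Lemma compact_sublevel (K : set C) (g : C -> R) (a : R) : compact K ->
  (forall z, K z -> {for z, continuous g}) -> compact (K `&` [set z | g z <= a]).
Proof.
move=> cK cg; apply: (subclosed_compact _ cK); last by move=> z [].
move=> z cz; have Kz : K z.
  by apply: (compact_closedC cK) => U /cz[w [[Kw _] Uw]]; exists w.
split=> //=; rewrite leNgt; apply/negP => h.
by have /cz[w [[_ /=]]] := rc_gt (cg z Kz) h; rewrite leNgt => /negP.
Qed.

(** The paths are concatenated on the half-line by adding up their increments,
    which is a finite sum locally, and the half-line is mapped onto [0, 1) by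
    [t / (1 - t)]. *)
Lemma infinite_concat (O : nat -> set C) (z : nat -> C) :
  (forall n, joined (O n) (z n) (z n.+1)) ->
  exists g : R -> C, (forall t, t < 1 -> {for t, continuous g}) /\
    forall (n : nat) (t : R), n%:R / n.+1%:R <= t < 1 -> exists2 k, (n <= k)%N & O k (g t).
Proof.
move=> /choice[c hc].
pose S N (x : R) := z 0%N + \sum_(0 <= k < N) (c k (clamp (x - k%:R)) - z k).
have cS N x : {for x, continuous (S N)}.
  apply: ccD; first exact: cc_cst.
  apply: cc_sum => k; apply: ccB; last exact: cc_cst.
  have [ck _ _ _] := hc k.
  apply: (@cc_comp R R C (fun x => clamp (x - k%:R)) (c k)); last exact: (cont_at ck).
  apply: (@cc_comp R R R (fun x => x - k%:R) clamp); last exact: (cont_at clamp_cont).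
  by apply: rcB; [exact: rc_id|exact: rc_cst].
have Sle N M x : (N <= M)%N -> x <= N%:R -> S M x = S N x.
  move=> NM xN; rewrite /S (big_cat_nat _ NM) //=; congr (_ + _).
  rewrite -[RHS]addr0; congr (_ + _); rewrite big_nat_cond big1 // => k /andP[/andP[Nk _] _].
  have [_ c0 _ _] := hc k; rewrite clamp_le0 ?c0 ?subrr //.
  by rewrite subr_le0 (le_trans xN) // ler_nat.
(* for [x < N] the terms of index at least [N] vanish *)
pose G x := S (Num.truncn x).+1 x.
have GE N x : x < N%:R -> G x = S N x.
  move=> xN; rewrite /G; have x1 : x <= (Num.truncn x).+1%:R by exact: ltW (truncnS_gt _).
  have [h|h] := leqP N (Num.truncn x).+1; first by rewrite (Sle N) // ltW.
  by rewrite -(Sle _ _ _ (ltnW h)).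
have cG x : {for x, continuous G}.
  pose N := (Num.truncn x).+1.
  have xN : x < N%:R by exact: truncnS_gt.
  by apply: (@cc_near _ _ G (S N)) (cS N x); apply: filterS (rc_lt (@rc_id R x) xN) => y; exact: GE.
have GO k x : k%:R <= x < k.+1%:R -> O k (G x).
  move=> /andP[kx xk]; rewrite (GE k.+1) // /S.
  have tel n : n%:R <= x -> z 0%N + \sum_(0 <= j < n) (c j (clamp (x - j%:R)) - z j) = z n.
    elim: n => [|n IH] nx; first by rewrite big_nil addr0.
    have [_ _ c1 _] := hc n.
    rewrite big_nat_recr //= addrA IH ?(le_trans _ nx) ?ler_nat // clamp_ge1 ?c1; last first.
      by rewrite lerBrDl natr1.
    by rewrite subrKC.
  by rewrite big_nat_recr //= addrA tel // subrKC; have [_ _ _ cO] := hc k; exact: cO.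
exists (fun t => G (t / (1 - t))); split.
  move=> t t1; apply: (@cc_comp R R C (fun t => t / (1 - t)) G); last exact: cG.
  apply: rcM; first exact: rc_id.
  have t0 : 1 - t != 0 by rewrite gt_eqF // subr_gt0.
  have ct : {for t, continuous (fun t : R => 1 - t)} by apply: rcB; [exact: rc_cst|exact: rc_id].
  exact: (@cvgV R _ (nbhs t) _ (fun t => 1 - t) _ t0 ct).
move=> n t /andP[nt t1]; have t0 : 0 < 1 - t by rewrite subr_gt0.
have nx : n%:R <= t / (1 - t).
  rewrite ler_pdivlMr // mulrBr mulr1 lerBlDr.
  by move: nt; rewrite ler_pdivrMr // -natr1 mulrDr mulr1 [t * _]mulrC [t + _]addrC.
have x0 : 0 <= t / (1 - t) by apply: le_trans nx.
have /andP[h1 h2] := truncn_itv x0.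
exists (Num.truncn (t / (1 - t))); last by apply: GO; rewrite h1.
by rewrite truncn_ge_nat.
Qed.

End concatenation.

Section strands.
Context {R : realType}.
Local Notation C := R[i].
Local Notation Re := complex.Re.
Local Notation Im := complex.Im.
Variables (E : set C) (tau f : C -> C).
Hypothesis oE : open E.
Hypothesis dtau : forall w, E w -> cdiff tau w.
Hypothesis tau_inj : forall v w, E v -> E w -> tau v = tau w -> v = w.
Hypothesis tauE : forall w, E w -> normc (tau w) < 1.
Hypothesis fE : forall z, normc z < 1 -> E (f z) /\ tau (f z) = z.
Hypothesis lift_closed : forall s : R -> C, continuous s -> (forall t, E (expC (s t))) ->
  expC (s 0) = expC (s 1) -> s 0 = s 1.
Variable p : C.
Hypothesis p1 : normc p = 1.

Let ftau := ftau tau_inj tauE fE.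
Let cf := conformal_inverse_cont oE dtau tau_inj fE.

(** Work in the disc and apply [joined_union] to the set [A1] where [f] is
    close to 0 and the set [A2] of the points away from [p] or close to the
    circle. The path near [p] avoids [A2], and the one far from 0 avoids [A1].
    The points of the intersection can be moved to the circle off both paths by
    [finger_reaches_circle]. *)
Lemma strands_connect (r1 eps : R) (u v : C) : 0 < r1 -> 0 < eps <= 1 ->
  joined [set w | E w /\ normc (tau w - p) < eps ^+ 8 / 256] u v ->
  joined [set w | E w /\ r1 <= normc w] u v ->
  joined [set z | [/\ normc z < 1, normc (z - p) < eps & r1 * expR (-5) < normc (f z)]] (tau u) (tau v).
Proof.
move=> r10 e01 hb hc; have /andP[e0 e1] := e01.
set de := eps ^+ 8 / 256 in hb.
have de_lt : de < eps.
  rewrite /de ltr_pdivrMr; last by rewrite ltr0n.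
  rewrite (@le_lt_trans _ _ eps); [by []| |by rewrite (ltr_pMr _ e0) ltr1n].
  by rewrite exprS ler_piMr ?(ltW e0) // exprn_ile1 // ltW.
pose r0 := r1 * expR (-5).
have r01 : r0 < r1 by rewrite /r0 gtr_pMr // -expR0 ltr_expR; lra.
have ctau w : E w -> {for w, continuous tau} by move=> /dtau/cdiff_cont.
have {}hb : joined [set z | normc z < 1 /\ normc (z - p) < de] (tau u) (tau v).
  apply: joined_image hb => w [Ew wp]; first exact: ctau.
  by split => //; exact: tauE.
have {}hc : joined [set z | normc z < 1 /\ r1 <= normc (f z)] (tau u) (tau v).
  apply: joined_image hc => w [Ew wr]; first exact: ctau.
  by split; [exact: tauE|rewrite ftau].
have [b [Kb [cb b0 b1 cKb [KbO bK]]]] := joined_compact hb.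
have [c [Kc [cc c0 c1 cKc [KcO cK]]]] := joined_compact hc.
have maxK K : compact K -> K !=set0 -> (forall z : C, K z -> normc z < 1) -> exists2 r : R, r < 1 & forall z, K z -> normc z <= r.
  move=> cptK K0 K1; have cn : {within K, continuous (fun z : C => normc z)}.
    by apply: continuous_subspaceT; exact: normc_cont.
  have [z + zM] := compact_EVT_max K0 cptK cn; rewrite inE => Kz.
  by exists (normc z) => [|w Kw]; [exact: K1|apply: zM; rewrite inE].
have [rb rb1 hrb] := maxK Kb cKb (ex_intro _ _ (bK 0)) (fun z Kz => proj1 (KbO z Kz)).
have [rc rc1 hrc] := maxK Kc cKc (ex_intro _ _ (cK 0)) (fun z Kz => proj1 (KcO z Kz)).
pose r := Num.max rb rc; have rlt1 : r < 1 by rewrite gt_max rb1.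
pose r' := (1 + r) / 2; have [rr' r'1] : r < r' /\ r' < 1 by rewrite /r'; split; lra.
have bM t : normc (b t) < r'.
  by rewrite (le_lt_trans (hrb _ (bK t))) // (le_lt_trans _ rr') // le_max lexx.
have cM t : normc (c t) < r'.
  by rewrite (le_lt_trans (hrc _ (cK t))) // (le_lt_trans _ rr') // le_max lexx orbT.
have r'0 : 0 < r' := le_lt_trans (normc_ge0 _) (bM 0).
have cD (s : R) : compact [set z : C | normc z <= s].
  exact: compact_disc.
pose A1 := [set z : C | normc z <= r'] `&` [set z | normc (f z) <= r0].
have cA1 : compact A1.
  apply: compact_sublevel => // z zr; apply: cc_normc; apply: cf; exact: le_lt_trans zr r'1.
pose A2 := ([set z : C | normc z <= 2] `&` [set z | - normc z <= - r']) `|`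
  ([set z : C | normc z <= 2] `&` [set z | - normc (z - p) <= - eps]).
have cN (T : topologicalType) (g : T -> R) x : {for x, continuous g} -> {for x, continuous (fun t => - g t)}.
  by move=> cg; exact: (@cvgN R R^o _ (nbhs x) _ g _ cg).
have cA2 : compact A2.
  apply: compactU; apply: compact_sublevel => // z _; apply: cN; apply: cc_normc; first exact: cc_id.
  by apply: ccB; [exact: cc_id|exact: cc_cst].
have inA2 z : normc z <= 2 -> r' <= normc z \/ eps <= normc (z - p) -> A2 z.
  by move=> z2 [h|h]; [left|right]; split => //=; rewrite lerN2.
have cA t : ~ A1 (c t).
  move=> [_ /=]; have [_ h] := KcO _ (cK t); rewrite leNgt => /negP; apply.
  exact: lt_le_trans r01 h.
have bA t : ~ A2 (b t).
  have [_ h] := KbO _ (bK t).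
  move=> [[_ /=]|[_ /=]]; rewrite lerN2 leNgt => /negP; apply; first exact: bM.
  exact: lt_trans h de_lt.
have bO w : joined (~` (A1 `|` A2)) (tau u) w -> normc w < r'.
  move=> [g [cg g0 g1 gA]]; rewrite ltNge; apply/negP => wr.
  have cng : {within `[0, 1], continuous (fun t => normc (g t))}.
    by apply: cont_on_within => t _; apply: cc_normc; exact: (cont_at cg).
  have [t _ gt] : exists2 t, t \in `[(0 : R), 1] & normc (g t) = r'.
    apply: IVT => //; rewrite g0 g1 -b0.
    by rewrite ge_min le_max (ltW (bM 0)) wr orbT.
  apply: (gA t); right; apply: inA2; last by left; rewrite gt.
  by rewrite gt (le_trans (ltW r'1)) // ler1n.
(* a point of [A1] and [A2] reaches the circle of radius [r'] off both paths *)
have far z : A1 z -> A2 z -> exists2 z1, joined (~` (range b `|` range c)) z z1 & r' <= normc z1.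
  move=> [zr fz] zA2.
  have [rz|zr'] := lerP r' (normc z).
    exists z => //; apply: joined_refl => -[[t _ tz]|[t _ tz]].
      by have := bM t; rewrite tz ltNge rz.
    by have := cM t; rewrite tz ltNge rz.
  have ze : eps <= normc (z - p).
    by case: zA2 => -[_ /=]; rewrite lerN2 // leNgt zr'.
  have z1 : normc z < 1 := lt_trans zr' r'1.
  have [z2 jz2 z2r] := finger_reaches_circle oE dtau tau_inj tauE fE lift_closed p1 r10 e01 z1 fz ze r'1.
  exists z2 => //; apply: joined_sub jz2 => y [y1 fy yp] [[t _ ty]|[t _ ty]].
    by have [_] := KbO _ (bK t); rewrite ty ltNge (ltW yp).
  by have [_] := KcO _ (cK t); rewrite ty leNgt fy.
have J := joined_union cA1 cA2 cb cc b0 b1 c0 c1 cA bA bM cM bO far.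
have nu : ~ (A1 `|` A2) (tau u) by have [] := joined_in J.
have J2 := joined_max (joined_refl nu) J.
apply: joined_sub J2 => w jw; have wr := bO w jw.
have [_ nA] := joined_in jw.
have w1 : normc w < 1 := lt_trans wr r'1.
split => //.
  rewrite ltNge; apply/negP => h; apply: nA; right; apply: inA2; last by right.
  by rewrite (le_trans (ltW w1)) // ler1n.
rewrite ltNge; apply/negP => h; apply: nA; left; split => //=; exact: ltW.
Qed.

(** [strands_connect] is applied to consecutive members of a subsequence, with
    neighbourhoods of [p] which shrink along it. *)
Theorem path_avoiding (r1 : R) (u : nat -> C) : 0 < r1 ->
  (forall k l, joined [set w | E w /\ r1 <= normc w] (u k) (u l)) ->
  (forall e : R, 0 < e -> exists N, forall k l, (N <= k)%N -> (N <= l)%N ->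
     joined [set w | E w /\ normc (tau w - p) < e] (u k) (u l)) ->
  exists g : R -> C, [/\ forall t, t < 1 -> {for t, continuous g},
    forall t, 0 <= t < 1 -> E (g t) /\ r1 * expR (-5) < normc (g t) &
    forall e : R, 0 < e -> exists2 s, s < 1 & forall t, s <= t < 1 -> normc (tau (g t) - p) < e].
Proof.
move=> r10 hE hp.
pose ep (n : nat) : R := n.+1%:R^-1.
have ep0 n : 0 < ep n by rewrite invr_gt0.
have ep01 n : 0 < ep n <= 1 by rewrite ep0 invf_le1 // ler1n.
have [N hN] := choice (fun n => hp (ep n ^+ 8 / 256) (divr_gt0 (exprn_gt0 8 (ep0 n)) (ltr0Sn _ 255))).
pose K n := (\max_(i < n.+1) N i)%N.
have NK n m : (n <= m)%N -> (N n <= K m)%N.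
  by move=> nm; rewrite /K (@leq_bigmax _ (fun i : 'I_m.+1 => N i) (Ordinal (nm : n < m.+1)%N)).
pose O n := [set z | [/\ normc z < 1, normc (z - p) < ep n & r1 * expR (-5) < normc (f z)]].
have J n : joined (O n) (tau (u (K n))) (tau (u (K n.+1))).
  by apply: strands_connect => //; apply: hN; apply: NK.
have [g [cg gO]] := infinite_concat J.
have g1 t : 0 <= t < 1 -> normc (g t) < 1 /\ r1 * expR (-5) < normc (f (g t)).
  by move=> t01; have [|k _ []] := gO 0%N t; rewrite ?mul0r.
exists (fun t => f (g (Num.max 0 t))); split.
- move=> t t1; apply: (@cc_comp R C C (fun t => g (Num.max 0 t)) f).
    apply: (@cc_comp R R C (fun t => Num.max 0 t) g).
      by apply: (@continuous_max R R (fun=> 0) id); [exact: cvg_cst|exact: cvg_id].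
    by apply: cg; rewrite gt_max ltr01.
  by apply: cf; have [] := g1 (Num.max 0 t); rewrite ?le_max ?lexx ?gt_max ?ltr01.
- move=> t /andP[t0 t1]; rewrite max_r //.
  have [h1 h2] := g1 t (introT andP (conj t0 t1)).
  by have [] := fE h1.
- move=> e e0.
  have [n hn] : exists n : nat, ep n < e.
    exists (Num.truncn e^-1); rewrite /ep -[ltRHS]invrK ltf_pV2 ?posrE ?invr_gt0 //.
    exact: truncnS_gt.
  exists (n%:R / n.+1%:R); first by rewrite ltr_pdivrMr // mul1r ltr_nat.
  move=> t /andP[nt t1].
  have t0 : 0 <= t by apply: le_trans nt; rewrite divr_ge0.
  rewrite max_r //.
  have [k nk [h1 h2 _]] := gO n t (introT andP (conj nt t1)).
  have [_ ->] := fE h1; rewrite (lt_trans h2) // (le_lt_trans _ hn) //.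
  by rewrite /ep lef_pV2 ?posrE // ler_nat.
Qed.

End strands.

(** * Quasicomponents of compact sets *)

Section cut_wire.
Context {R : realType}.
Local Notation C := R[i].
Implicit Types (L U A B : set C).

(** [U] is open and closed in the closed set [L], expressed by closed sets of
    the plane. *)
Definition relclopen L U := [/\ U `<=` L, closed U & closed (L `\` U)].

Lemma relclopenI L U V : relclopen L U -> relclopen L V -> relclopen L (U `&` V).
Proof.
move=> [UL cU cLU] [VL cV cLV]; split; [by move=> z [/UL]|exact: closedI|].
by rewrite setDIr; exact: closedU.
Qed.

Lemma relclopenU L U V : relclopen L U -> relclopen L V -> relclopen L (U `|` V).
Proof.
move=> [UL cU cLU] [VL cV cLV]; split; [by move=> z [/UL|/VL]|exact: closedU|].
by rewrite setDUr; exact: closedI.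
Qed.

(** Compactness in the form of the finite intersection property. *)
Lemma compact_filtered (P : set (set C)) (M : set C) : compact M -> P !=set0 ->
  (forall U V, P U -> P V -> exists2 W, P W & W `<=` U `&` V) -> (forall U, P U -> closed U) ->
  (forall U, P U -> U `&` M !=set0) -> exists2 z, M z & forall U, P U -> U z.
Proof.
move=> cM [U0 PU0] PI Pc PM.
pose F := filter_from P (fun U => U `&` M).
have FF : ProperFilter F.
  apply: filter_from_proper; last exact: PM.
  apply: filter_from_filter; first by exists U0.
  move=> U V PU PV; have [W PW WUV] := PI U V PU PV.
  by exists W => // z [/WUV[Uz Vz] Mz].
have FM : F M by exists U0 => // z [].
have [z [Mz clz]] := cM F FF FM; exists z => // U PU.
apply: (Pc U PU) => V Vz.
have FU : F U by exists U => // w [].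
by have [w [Uw Vw]] := clz U V FU Vz; exists w.
Qed.

Definition quasicomp L a : set C := [set z | forall U, relclopen L U -> U a -> U z].

Lemma relclopen_self L : compact L -> relclopen L L.
Proof.
by move=> cL; split => //; [exact: compact_closedC|rewrite setDv; exact: closed0].
Qed.

Lemma quasicomp_sub L a : compact L -> L a -> quasicomp L a `<=` L.
Proof. by move=> cL La z; apply => //; exact: relclopen_self. Qed.

Lemma relclopen_avoid L a M : compact L -> L a -> compact M -> quasicomp L a `&` M = set0 ->
  exists U, [/\ relclopen L U, U a & U `&` M = set0].
Proof.
move=> cL La cM QM; apply: contrapT => /forallNP h.
have [z Mz Uz] : exists2 z, M z & forall U, (relclopen L U /\ U a) -> U z.
  apply: (@compact_filtered [set U | relclopen L U /\ U a]) => //.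
  - by exists L; split => //; exact: relclopen_self.
  - by move=> U V [cU Ua] [cV Va]; exists (U `&` V) => //; split => //; exact: relclopenI.
  - by move=> U [[]].
  - by move=> U [cU Ua]; apply/set0P/eqP => UM; apply: (h U).
suff : (quasicomp L a `&` M) z by rewrite QM.
by split=> // U cU Ua; exact: Uz.
Qed.

(** In a compact set quasicomponents are connected. If one of them were the
    disjoint union of two closed sets, a continuous function equal to 0 on the
    first and to 1 on the second would take the value 1/2 at no point of some
    relatively clopen neighbourhood, which the function would then split. *)
Lemma quasicomp_connected L a : compact L -> L a -> connected (quasicomp L a).
Proof.
move=> cL La B B0 [Co oC BCo] [Cc cC BCc]; set Q := quasicomp L a.
have Qa : Q a by move=> U.
have cQ : closed Q.
  rewrite (_ : Q = \bigcap_(U in [set U | relclopen L U /\ U a]) U).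
    by apply: closed_bigI => U [[]].
  by rewrite eqEsubset; split => z Qz U; [move=> [cU Ua]; exact: Qz|move=> cU Ua; exact: Qz].
have QL := quasicomp_sub cL La.
have cptQ : compact Q by exact: subclosed_compact cQ cL QL.
pose F2 := Q `\` B.
have cB : closed B by rewrite BCc; exact: closedI.
have F2E : F2 = Q `&` ~` Co.
  rewrite /F2 BCo eqEsubset; split => z [Qz h]; split => //.
    by move=> Cz; apply: h.
  by move=> [_ /h].
have cF2 : closed F2 by rewrite F2E; apply: closedI => //; exact: open_closedC.
have BQ : B `<=` Q by rewrite BCo => z [].
have QE : Q = B `|` F2.
  by rewrite eqEsubset; split => z; [move=> Qz; have [|] := pselect (B z); [left|right]|move=> [/BQ|[]]].
pose ind z : R := if `[< B z >] then 0 else 1.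
have cind : {within Q, continuous ind}.
  rewrite QE; apply: withinU_continuous => //.
    apply: (@subspace_eq_continuous _ B _ (fun _ : C => 0 : R)); last by apply: cont_on_within => z _; exact: rc_cst.
    by move=> z; rewrite inE => Bz; rewrite /from_subspace /ind asboolT.
  apply: (@subspace_eq_continuous _ F2 _ (fun _ : C => 1 : R)); last by apply: cont_on_within => z _; exact: rc_cst.
  by move=> z; rewrite inE => -[_ nB]; rewrite /from_subspace /ind asboolF.
have [g cg gE] := tietze_real cptQ cind.
have gB z : B z -> g z = 0 by move=> Bz; rewrite gE ?/ind ?asboolT //; exact: BQ.
have gF2 z : F2 z -> g z = 1 by move=> [Qz nB]; rewrite gE // /ind asboolF.
have cpre (D : set R) : closed D -> closed (g @^-1` D).
  by move=> cD; apply: closed_comp => // z _; exact: cg.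
(* [M] misses the quasicomponent, so a clopen set [U] avoids it *)
pose M := L `&` g @^-1` [set 2^-1].
have cM : compact M.
  apply: (subclosed_compact _ cL); last by move=> z [].
  by apply: closedI; [exact: compact_closedC|apply: cpre; exact: closed_eq].
have half0 : (2^-1 : R) != 0 by rewrite invr_eq0.
have half1 : (2^-1 : R) != 1 by apply/eqP; lra.
have QM : Q `&` M = set0.
  rewrite -subset0 => z [Qz [_ /= gz]]; move: Qz gz; rewrite QE => -[/gB ->|/gF2 ->] /esym/eqP.
    by rewrite (negbTE half0).
  by rewrite (negbTE half1).
have [U [[UL cU cLU] Ua UM]] := relclopen_avoid cL La cM QM.
have gU z : U z -> g z != 2^-1.
  move=> Uz; apply/eqP => gz; have : (U `&` M) z by split => //; split => //; exact: UL.
  by rewrite UM.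
pose U1 := U `&` g @^-1` [set x | x <= 2^-1].
pose U2 := U `&` g @^-1` [set x | 2^-1 <= x].
have cU1 : closed U1 by apply: closedI => //; apply: cpre; exact: closed_le.
have cU2 : closed U2 by apply: closedI => //; apply: cpre; exact: closed_ge.
have U12 : L `\` U1 = (L `\` U) `|` U2.
  rewrite eqEsubset; split => z.
    move=> [Lz nU1]; have [Uz|nU] := pselect (U z); last by left.
    right; split => //=; rewrite leNgt; apply/negP => h; apply: nU1; split => //=; exact: ltW.
  move=> [[Lz nU]|[Uz /= h]]; split => //; [by move=> []|exact: UL|move=> [_ /= h2]].
  by move: (gU z Uz); rewrite eq_le h h2.
have U21 : L `\` U2 = (L `\` U) `|` U1.
  rewrite eqEsubset; split => z.
    move=> [Lz nU2]; have [Uz|nU] := pselect (U z); last by left.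
    right; split => //=; rewrite leNgt; apply/negP => h; apply: nU2; split => //=; exact: ltW.
  move=> [[Lz nU]|[Uz /= h]]; split => //; [by move=> []|exact: UL|move=> [_ /= h2]].
  by move: (gU z Uz); rewrite eq_le h h2.
have rU1 : relclopen L U1 by split => //; [move=> z [/UL]|rewrite U12; exact: closedU].
have rU2 : relclopen L U2 by split => //; [move=> z [/UL]|rewrite U21; exact: closedU].
have [Ba|nBa] := pselect (B a).
  have U1a : U1 a by split => //=; rewrite gB // invr_ge0.
  rewrite -/Q QE; apply/esym/setUidPl => z F2z; exfalso.
  have [_ /=] : U1 z by apply: (proj1 F2z).
  by rewrite gF2 // leNgt => /negP; apply; lra.
have F2a : F2 a by [].
have U2a : U2 a by split => //=; rewrite gF2 //; lra.
have [b Bb] := B0; have [_ /=] : U2 b by apply: (BQ _ Bb).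
by rewrite gB // leNgt => /negP; case; rewrite invr_gt0.
Qed.

(** The cut-wire theorem. The quasicomponent of each point of [A] misses [B],
    so it has a relatively clopen neighbourhood which misses [B]; finitely many
    of these neighbourhoods cover [A], by compactness. *)
Theorem cut_wire L A B : compact L -> closed A -> closed B ->
  (forall P, connected P -> P `<=` L -> P `&` A !=set0 -> P `&` B !=set0 -> False) ->
  exists L1 L2, [/\ closed L1, closed L2, L = L1 `|` L2, L1 `&` L2 = set0 &
    L1 `&` B = set0 /\ L2 `&` A = set0].
Proof.
move=> cL cA cB noP.
have step a : L a -> A a -> exists U, [/\ relclopen L U, U a & U `&` B = set0].
  move=> La Aa; have cM : compact (L `&` B) by exact: compact_closedI.
  have QM : quasicomp L a `&` (L `&` B) = set0.
    rewrite -subset0 => b [Qb [Lb Bb]]; apply: (noP (quasicomp L a)).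
    - exact: quasicomp_connected.
    - exact: quasicomp_sub.
    - by exists a; split => // U.
    - by exists b.
  have [U [rU Ua UM]] := relclopen_avoid cL La cM QM; exists U; split => //.
  by rewrite -subset0 -UM => z [Uz Bz]; split => //; split => //; case: rU => UL _ _; exact: UL.
have [U [rU UB AU]] : exists U, [/\ relclopen L U, U `&` B = set0 & (L `&` A) `<=` U].
  apply: contrapT => /forallNP h.
  have cM : compact (L `&` A) by exact: compact_closedI.
  have [a [La Aa] aP] : exists2 a, (L `&` A) a & forall V, (exists2 U, relclopen L U /\ U `&` B = set0 & V = L `\` U) -> V a.
    apply: (@compact_filtered [set V | exists2 U, relclopen L U /\ U `&` B = set0 & V = L `\` U]) => //.
    - exists (L `\` set0), set0 => //; split; last by rewrite set0I.
      by split => //; [exact: closed0|rewrite setD0; exact: compact_closedC].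
    - move=> _ _ [U [rU UB] ->] [V [rV VB] ->]; exists (L `\` (U `|` V)).
        exists (U `|` V) => //; split; first exact: relclopenU.
        by rewrite setIUl UB VB setU0.
      by rewrite setDUr.
    - by move=> _ [U [[_ _ cLU] _] ->].
    - move=> _ [U [rU UB] ->]; apply: contrapT => ne; apply: (h U); split => // z [Lz Az].
      by apply: contrapT => nU; apply: ne; exists z.
  have [U [rU Ua UB]] := step a La Aa.
  by have [] : (L `\` U) a by apply: aP; exists U.
case: rU => UL cU cLU; exists U, (L `\` U); split => //.
- by rewrite setDUK.
- by rewrite -subset0 => z [Uz [_ nU]]; exact: nU.
- split => //; rewrite -subset0 => z [[Lz nU] Az]; exact: nU (AU z (conj Lz Az)).
Qed.

End cut_wire.

(** * Strands across a ring *)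

(** [N + 1] rational vectors of length [N] are linearly dependent; multiplying
    by the denominators gives an integer relation. *)
Lemma int_left_kernel (N : nat) (M : 'I_N.+1 -> 'I_N -> int) :
  exists m : 'I_N.+1 -> int, (exists i, m i != 0) /\ forall j, \sum_i m i * M i j = 0.
Proof.
pose A : 'M[rat]_(N.+1, N) := \matrix_(i, j) (M i j)%:~R.
have : kermx A != 0.
  by rewrite kermx_eq0 -row_leq_rank -ltnNge ltnS rank_leq_col.
move=> /rowV0Pn[v /sub_kermxP vA v0].
pose m i : int := numq (v 0 i) * \prod_(j | j != i) denq (v 0 j).
pose D : int := \prod_j denq (v 0 j).
have D0 : D != 0 by apply/prodf_neq0 => j _; exact: denq_neq0.
have mE i : (m i)%:~R = v 0 i * D%:~R :> rat.
  rewrite /m /D [in RHS](bigD1 i) //= !rmorphM /= mulrA; congr (_ * _).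
  by rewrite -[X in _ = X * _]divq_num_den divfK // intr_eq0 denq_neq0.
exists m; split.
  have [i vi] : exists i, v 0 i != 0.
    apply: contrapT => /forallNP h; move/eqP: v0; apply; apply/rowP => i; rewrite mxE.
    by apply/eqP; apply: contrapT => /negP; exact: h.
  by exists i; rewrite -(intr_eq0 rat) mE mulf_neq0 // intr_eq0.
move=> j; apply/eqP; rewrite -(intr_eq0 rat) rmorph_sum /=; apply/eqP.
rewrite (eq_bigr (fun i => D%:~R * (v 0 i * A i j))); last first.
  by move=> i _; rewrite rmorphM /= mE mxE; ring.
by rewrite -mulr_sumr; have := congr1 (fun B : 'rV_N => B 0 j) vA; rewrite !mxE => ->; rewrite mulr0.
Qed.

Section crossing_strands.
Context {R : realType}.
Local Notation C := R[i].
Variables (r1 r2 : R) (L : set C).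
Hypothesis r12 : 0 < r1 < r2.
Hypothesis cL : compact L.
Hypothesis Lr : forall w, L w -> r1 <= normc w <= r2.

Definition inner_disc : set C := [set w | normc w <= r1].
Definition outer_ring : set C := [set w | r2 <= normc w <= r2 + 1].
(** The obstacle [L] lies in the closed ring; the strands run in the rest of
    the open ring. *)
Definition open_gap : set C := [set w | r1 < normc w < r2 /\ ~ L w].

Definition crossing_component (P : set C) :=
  [/\ is_component L P, (exists2 w, P w & normc w = r1) & exists2 w, P w & normc w = r2].

Lemma compact_inner_disc : compact inner_disc.
Proof.
exact: compact_disc.
Qed.

Lemma compact_outer_ring : compact outer_ring.
Proof.
apply: (@bounded_closed_compactC _ _ (r2 + 1)); last by move=> z /andP[].
rewrite (_ : outer_ring = (fun v : C => normc v) @^-1` `[r2, r2 + 1]%classic).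
  apply: closed_comp; first by move=> w _; exact: (@normc_cont R w).
  exact: itv_closed.
by rewrite eqEsubset; split => z /=; rewrite in_itv.
Qed.

(** The outer ring is a barrier: a path which starts between the two circles
    and avoids it does not leave the large one. *)
Lemma gap_path v w : open_gap v -> joined (~` (inner_disc `|` L `|` outer_ring)) v w -> joined open_gap v w.
Proof.
move=> gv J.
have nv : (~` (inner_disc `|` L `|` outer_ring)) v by have [] := joined_in J.
apply: joined_sub (joined_max (joined_refl nv) J) => z Jz.
have [_ nz] := joined_in Jz.
have nL : ~ L z by move=> Lz; apply: nz; left; right.
have z1 : r1 < normc z by rewrite ltNge; apply/negP => h; apply: nz; left; left.
split => //; rewrite z1 /= ltNge; apply/negP => z2.
have [g [cg g0 g1 gO]] := Jz.
have cng : {within `[0, 1], continuous (fun t => normc (g t))}.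
  by apply: cont_on_within => t _; apply: cc_normc; exact: (cont_at cg).
have [t _ gt] : exists2 t, t \in `[(0 : R), 1] & normc (g t) = r2.
  apply: IVT => //; rewrite g0 g1.
  by have [/andP[_ h] _] := gv; rewrite ge_min le_max (ltW h) z2 orbT.
by apply: (gO t); right; rewrite /outer_ring /= gt lexx lerDl ler01.
Qed.

(** Each of the [N + 2] points [v 0, ..., v (N + 1)] is connected outwards off
    [X], the union of [L] with the inner disc, and inwards off [Y], the union
    of [L] with the outer ring. This gives logarithms [phi i] and [psi i] of
    [(z - v (i + 1)) / (z - v 0)] on [X] and on [Y]. On [L] they differ by 2 pi
    i times an integer, which is constant on each of the at most [N] crossing
    components. A nontrivial integer combination of the differences vanishes on
    all crossing components. Then the rest of [L] splits into a part away from
    the large circle and a part away from the small one ([cut_wire]), and the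
    combinations of the [phi i] on the first and of the [psi i] on the second
    form one logarithm on the union of [X] and [Y]. By [eilenberg] two of the
    points lie in one component of the complement. *)
Lemma two_strands_joined (s : seq (set C)) (v : nat -> C) (xi xo : C) :
  (forall P, crossing_component P -> P \in s) ->
  (forall k, open_gap (v k)) ->
  (forall k, joined (~` (inner_disc `|` L)) (v k) xo) ->
  (forall k, joined (~` (L `|` outer_ring)) (v k) xi) ->
  exists i j, (i < j)%N /\ joined open_gap (v i) (v j).
Proof.
move=> hs gv jo ji; apply: contrapT => sep.
have {}sep i j : (i < j)%N -> ~ joined open_gap (v i) (v j).
  by move=> ij h; apply: sep; exists i, j.
have r1r2 : r1 < r2 by have /andP[] := r12.
pose N := size s.
have nL k : ~ L (v k) by have [] := gv k.
have neL k z : L z -> z - v k != 0.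
  by move=> Lz; rewrite subr_eq0; apply/eqP => e; apply: (nL k); rewrite -e.
pose X := inner_disc `|` L; pose Y := L `|` outer_ring.
have cX : compact X by apply: compactU => //; exact: compact_inner_disc.
have cY : compact Y by apply: compactU => //; exact: compact_outer_ring.
have nX k : ~ X (v k).
  by move=> [|/nL //]; have [/andP[h _] _] := gv k; rewrite /inner_disc /= leNgt h.
have nY k : ~ Y (v k).
  by move=> [/nL //|]; have [/andP[_ h] _] := gv k; rewrite /outer_ring /= leNgt h.
have getlog (Z : set C) (x : C) : compact Z -> (forall k, ~ Z (v k)) -> (forall k, joined (~` Z) (v k) x) ->
  forall i : 'I_N.+1, exists phi : C -> C, {within Z, continuous phi} /\
    forall z, Z z -> expC (phi z) = (z - v i.+1) / (z - v 0%N).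
  move=> cZ nZ jZ i.
  have [c [cc c0 c1 cZ']] := joined_trans (jZ 0%N) (joined_sym (jZ i.+1)).
  have ne z t : Z z -> z != c t by move=> Zz; apply/eqP => e; apply: (cZ' t); rewrite -e.
  have [M [_ ME _ cM]] := path_log cZ (fun z _ => @cc_id R z) cc ne.
  exists (fun z => M z 1); split => // z Zz.
  have n0 : z - v 0%N != 0 by rewrite subr_eq0; apply/eqP => e; apply: (nZ 0%N); rewrite -e.
  by apply: (mulIf n0); rewrite divfK // -{1}c0 ME ?ler01 ?lexx // c1.
have [phi hphi] := choice (getlog X xo cX nX jo).
have [psi hpsi] := choice (getlog Y xi cY nY ji).
have LX : L `<=` X by move=> z; right.
have LY : L `<=` Y by move=> z; left.
have dint (i : 'I_N.+1) (z : C) : exists k : int, L z -> phi i z - psi i z = twopii *~ k.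
  have [Lz|nz] := pselect (L z); last by exists 0.
  have : expC (phi i z - psi i z) = 1.
    have n0 : (z - v i.+1) / (z - v 0%N) != 0 by rewrite mulf_neq0 ?invr_eq0 ?neL.
    by rewrite expCB (proj2 (hphi i) z (LX z Lz)) (proj2 (hpsi i) z (LY z Lz)) divff.
  by move=> /expC_eq1[k hk]; exists k.
have [n hn] := choice (fun iz : 'I_N.+1 * C => dint iz.1 iz.2).
have rep (P : set C) : exists z, crossing_component P -> P z.
  have [|nP] := pselect (crossing_component P); last by exists 0.
  by move=> [_ [w Pw _] _]; exists w.
have [kp hk] := choice rep.
(* [kp P] is a chosen point of the crossing component [P] *)
have [m [[i0 mi0] mK]] := int_left_kernel (fun (i : 'I_N.+1) (j : 'I_N) => n (i, kp (nth set0 s j))).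
pose Phi z := \sum_(i < N.+1) phi i z * (m i)%:~R.
pose Psi z := \sum_(i < N.+1) psi i z * (m i)%:~R.
have csum (Z : set C) (q : 'I_N.+1 -> C -> C) : (forall i, {within Z, continuous (q i)}) ->
    {within Z, continuous (fun z => \sum_(i < N.+1) q i z * (m i)%:~R)}.
  move=> cq z; apply: (@cvgc_sum R (subspace Z) (nbhs z) _ _ _ (fun i z => q i z * (m i)%:~R) (fun i => q i z * (m i)%:~R)) => i.
  exact: (@cvgcM R (subspace Z) (nbhs z) _ (q i) (fun=> (m i)%:~R) _ _ (cq i z) (cvg_cst _)).
have cPhi : {within X, continuous Phi} by apply: csum => i; exact: (proj1 (hphi i)).
have cPsi : {within Y, continuous Psi} by apply: csum => i; exact: (proj1 (hpsi i)).
pose Rz z := \prod_(i < N.+1) ((z - v i.+1) / (z - v 0%N)) ^ (m i).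
have esum (Z : set C) (q : 'I_N.+1 -> C -> C) z : (forall i, expC (q i z) = (z - v i.+1) / (z - v 0%N)) ->
    expC (\sum_(i < N.+1) q i z * (m i)%:~R) = Rz z.
  by move=> eq; rewrite expC_sum; apply: eq_bigr => i _; rewrite mulrzr expCMz eq.
have ePhi z : X z -> expC (Phi z) = Rz z by move=> Xz; apply: esum => // i; exact: (proj2 (hphi i)).
have ePsi z : Y z -> expC (Psi z) = Rz z by move=> Yz; apply: esum => // i; exact: (proj2 (hpsi i)).
pose d z := Phi z - Psi z.
have Rz0 z : L z -> Rz z != 0.
  move=> Lz; apply/prodf_neq0 => i _; apply: expfz_neq0.
  by rewrite mulf_neq0 ?invr_eq0 ?neL.
have cd : {within L, continuous d}.
  have cP := continuous_subspaceW LX cPhi; have cQ := continuous_subspaceW LY cPsi.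
  by move=> z; exact: (@cvgcB R (subspace L) (nbhs z) _ Phi Psi _ _ (cP z) (cQ z)).
have ed z : L z -> expC (d z) = 1.
  by move=> Lz; rewrite expCB ePhi ?ePsi ?divff //; [exact: Rz0|exact: LY|exact: LX].
have dcross P z : crossing_component P -> P z -> d z = 0.
  move=> cP Pz; have [[a La PE] _ _] := cP.
  have PL : P `<=` L by rewrite PE; exact: connected_component_sub.
  have conP : connected P by rewrite PE; exact: component_connected.
  have Pk := hk P cP.
  rewrite (exp_const conP (continuous_subspaceW PL cd) (fun x Px => ed x (PL x Px)) Pz Pk).
  have Ps := hs P cP; have Pi : (index P s < N)%N by rewrite index_mem.
  have := mK (Ordinal Pi); rewrite /= nth_index // => sum0.
  rewrite /d /Phi /Psi -sumrB.
  rewrite (eq_bigr (fun i => twopii *~ (m i * n (i, kp P)))); last first.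
    by move=> i _; rewrite -mulrBl (hn (i, kp P)) /=; [rewrite mulrzr -mulrzA mulrC|exact: PL].
  by rewrite -mulrz_sumr sum0 mulr0z.
(* [d] takes discrete values, so it vanishes on [L0] *)
pose L0 := L `&` [set z | normc (d z) <= 2^-1].
pose L' := L `&` [set z | 2^-1 <= normc (d z)].
have cdn : {within L, continuous (fun z => normc (d z))}.
  by move=> z; exact: (@cvg_normc R (subspace L) (nbhs z) _ d _ (cd z)).
have clL : closed L by exact: compact_closedC.
have clpre (D : set R) : closed D -> closed (L `&` (fun z => normc (d z)) @^-1` D).
  move=> cD.
  have cpre : closed ((fun z => normc (d z)) @^-1` D : set (subspace L)).
    by apply: closed_comp => // z _; exact: cdn.
  have [V cV VE] := proj1 (closed_subspaceP L _) cpre.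
  by rewrite setIC -VE; exact: closedI.
have cL0 : closed L0 by apply: (clpre [set x | x <= 2^-1]); exact: closed_le.
have cL' : closed L' by apply: (clpre [set x | 2^-1 <= x]); exact: closed_ge.
have d00 z : L0 z -> d z = 0.
  move=> [Lz /= h]; apply: expC_eq1_small; first exact: ed.
  by rewrite (le_lt_trans h) // invf_lt1 // ltr1n.
have LU : L = L0 `|` L'.
  rewrite eqEsubset; split => z; last by move=> [[]|[]].
  by move=> Lz; have [h|h] := lerP (normc (d z)) 2^-1; [left|right; split => //; exact: ltW].
have cptL' : compact L' by apply: (subclosed_compact cL' cL) => z [].
have clcirc (r : R) : closed [set z : C | normc z = r].
  rewrite (_ : [set z : C | normc z = r] = (fun z : C => normc z) @^-1` [set r]) //.
  by apply: closed_comp; [move=> w _; exact: (@normc_cont R w)|exact: closed_eq].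
have [L1 [L2 [cL1 cL2 L12 L12d [L1B L2A]]]] : exists L1 L2, [/\ closed L1, closed L2, L' = L1 `|` L2, L1 `&` L2 = set0 &
    L1 `&` [set z | normc z = r2] = set0 /\ L2 `&` [set z | normc z = r1] = set0].
  apply: cut_wire => // P conP PL' [a [Pa /= ar]] [b [Pb /= br]].
  have PL : P `<=` L by move=> z /PL'[].
  have CC : crossing_component (connected_component L a).
    split; first by exists a => //; exact: PL.
      by exists a => //; apply: connected_component_refl; exact: PL.
    exists b => //; exact: (connected_component_max Pa PL conP Pb).
  have [La] := PL' _ Pa; rewrite /= (dcross _ a CC) ?normc0; last exact: connected_component_refl.
  by rewrite leNgt invr_gt0 ltr0n.
(* [Phi] is used on [Z1] and [Psi] on [Z2]; they agree on the intersection *)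
pose Z1 := inner_disc `|` L0 `|` L1; pose Z2 := outer_ring `|` L0 `|` L2.
have L1L' : L1 `<=` L' by rewrite L12 => z; left.
have L2L' : L2 `<=` L' by rewrite L12 => z; right.
have Z1X : Z1 `<=` X by move=> z [[|[]]|/L1L'[]]; [left|right|right].
have Z2Y : Z2 `<=` Y by move=> z [[|[]]|/L2L'[]]; [right|left|left].
have cZ1 : closed Z1.
  by apply: closedU => //; apply: closedU => //; apply: compact_closedC; exact: compact_inner_disc.
have cZ2 : closed Z2.
  by apply: closedU => //; apply: closedU => //; apply: compact_closedC; exact: compact_outer_ring.
have Z12 z : Z1 z -> Z2 z -> Phi z = Psi z.
  move=> z1 z2; suff L0z : L0 z by apply/eqP; rewrite -subr_eq0 -/(d z) d00.
  move: z1 z2 => [[zi|//]|z1] [[zo|//]|z2].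
  - by move: zi zo; rewrite /inner_disc /outer_ring /= => h /andP[h2 _]; move: r1r2; rewrite ltNge (le_trans h2 h).
  - exfalso; suff : (L2 `&` [set z | normc z = r1]) z by rewrite L2A.
    split => //=; apply/eqP; rewrite eq_le zi /=.
    by have [/Lr/andP[]] := L2L' _ z2.
  - exfalso; suff : (L1 `&` [set z | normc z = r2]) z by rewrite L1B.
    split => //=; apply/eqP; rewrite eq_le; move: zo => /andP[-> _]; rewrite andbT.
    by have [/Lr/andP[]] := L1L' _ z1.
  - by exfalso; suff : (L1 `&` L2) z by rewrite L12d.
pose Th z := if `[< Z1 z >] then Phi z else Psi z.
have Th1 z : Z1 z -> Th z = Phi z by move=> h; rewrite /Th asboolT.
have Th2 z : Z2 z -> Th z = Psi z.
  move=> h; have [h1|h1] := pselect (Z1 z); first by rewrite Th1 // Z12.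
  by rewrite /Th asboolF.
have cTh : {within Z1 `|` Z2, continuous Th}.
  apply: withinU_continuous; [exact: cZ1|exact: cZ2| |].
    apply: (@subspace_eq_continuous _ Z1 _ Phi); last exact: (continuous_subspaceW Z1X cPhi).
    by move=> z; rewrite inE => Az; rewrite /from_subspace Th1.
  apply: (@subspace_eq_continuous _ Z2 _ Psi); last exact: (continuous_subspaceW Z2Y cPsi).
  by move=> z; rewrite inE => Az; rewrite /from_subspace Th2.
have ZE : Z1 `|` Z2 = inner_disc `|` L `|` outer_ring.
  rewrite eqEsubset; split => z.
    by move=> [/Z1X[]|/Z2Y[]]; [left; left|left; right|left; right|right].
  rewrite {1}LU L12 => -[[zi|[z0|[z1|z2]]]|zo].
  - by left; left; left.
  - by left; left; right.
  - by left; right.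
  - by right; right.
  - by right; left; left.
have nZ k : ~ (Z1 `|` Z2) (v k) by move=> [/Z1X/nX|/Z2Y/nY].
pose vv (i : 'I_N.+2) := v i.
(* the exponent at [v 0] makes the total exponent 0 *)
pose mm (i : 'I_N.+2) : int := if unlift ord0 i is Some j then m j else - \sum_j m j.
suff : mm (lift ord0 i0) = 0 by rewrite /mm liftK => h; rewrite h eqxx in mi0.
apply: (@eilenberg _ _ vv mm (Z1 `|` Z2) Th _ r2) => //.
- apply: compactU; first exact: subclosed_compact cZ1 cX Z1X.
  exact: subclosed_compact cZ2 cY Z2Y.
- move=> z Zz.
  have -> : expC (Th z) = Rz z.
    by case: Zz => h; [rewrite Th1 // ePhi //; exact: Z1X|rewrite Th2 // ePsi //; exact: Z2Y].
  have nv k : z - v k != 0 by rewrite subr_eq0; apply/eqP => e; apply: (nZ k); rewrite -e.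
  rewrite big_ord_recl /mm unlift_none /vv /=.
  rewrite (eq_bigr (fun i : 'I_N.+1 => (z - v i.+1) ^ m i)); last by move=> i _; rewrite liftK.
  have -> : Rz z = \prod_(i < N.+1) ((z - v i.+1) ^ m i * (z - v 0%N) ^ (- m i)).
    by apply: eq_bigr => i _; rewrite expfzMl exprz_inv.
  rewrite big_split /= mulrC; congr (_ * _).
  by rewrite -sumrN (big_morph (fun k : int => (z - v 0%N) ^ k) (id1 := 1) (op1 := *%R)) // => a b; rewrite expfzDr.
- by move=> i; exact: nZ.
- move=> w; rewrite ZE => J0; have J := gap_path (gv _) J0.
  by have [_ [/andP[]]] := joined_in J.
- move=> i ij _; rewrite ZE => J0; have J := gap_path (gv _) J0.
  have [h|h|h] := ltngtP (lift ord0 i0) i.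
  + exact: sep h J.
  + exact: sep h (joined_sym J).
  + by move/eqP: ij; apply; apply: val_inj.
Qed.

(** If every point could be joined to finitely many others only, an infinite
    subsequence of points would be pairwise separated, against
    [two_strands_joined]. *)
Theorem infinitely_many_strands (v : nat -> C) (xi xo : C) :
  finite_set crossing_component ->
  (forall k, open_gap (v k)) ->
  (forall k, joined (~` (inner_disc `|` L)) (v k) xo) ->
  (forall k, joined (~` (L `|` outer_ring)) (v k) xi) ->
  exists k0, forall n, exists2 k, (n <= k)%N & joined open_gap (v k0) (v k).
Proof.
move=> /finite_seqP[s sE] gv jo ji; apply: contrapT => /forallNP h.
have [F hF] : exists F : nat -> nat, forall k0 k, (F k0 <= k)%N -> ~ joined open_gap (v k0) (v k).
  have h' k0 : exists n, forall k, (n <= k)%N -> ~ joined open_gap (v k0) (v k).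
    have /existsNP[n hn] := h k0; exists n => k nk J.
    by apply: hn; exists k.
  by have [F hF] := choice h'; exists F.
pose G m := (\max_(i < m.+1) F i)%N.
pose a j := iter j (fun m => maxn (G m) m.+1) 0%N.
have aS j : (a j < a j.+1)%N by rewrite /= leq_max leqnn orbT.
have a_inc i j : (i <= j)%N -> (a i <= a j)%N.
  move=> ij; rewrite -(subnKC ij); elim: (j - i)%N => [|k IH]; first by rewrite addn0.
  by rewrite addnS (leq_trans IH) // ltnW.
have Fa i j : (i < j)%N -> (F (a i) <= a j)%N.
  move=> ij; apply: (@leq_trans (a i.+1)); last exact: a_inc.
  rewrite /= leq_max; apply/orP; left.
  exact: (@leq_bigmax _ (fun k : 'I_(a i).+1 => F k) ord_max).
have [||||i [j [ij J]]] := @two_strands_joined s (fun k => v (a k)) xi xo.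
- by move=> P cP; have : [set` s] P by rewrite -sE.
- by move=> k; exact: gv.
- by move=> k; exact: jo.
- by move=> k; exact: ji.
exact: hF (Fa i j ij) J.
Qed.

End crossing_strands.

(** * Blaschke's selection theorem *)

(** Cantor's diagonal argument: along a subsequence each of countably many
    boolean sequences is eventually constant. *)
Lemma diagonal_subsequence (b : nat -> nat -> bool) :
  exists phi : nat -> nat, (forall n, (phi n < phi n.+1)%N) /\
    forall k, exists c, forall n, (k < n)%N -> b k (phi n) = c.
Proof.
pose inf (S : nat -> Prop) := forall n, exists2 m, (n <= m)%N & S m.
pose step k (S : nat -> Prop) : nat -> Prop :=
  if `[< inf (fun n => S n /\ b k n) >] then (fun n => S n /\ b k n) else (fun n => S n /\ ~~ b k n).
have step_inf k S : inf S -> inf (step k S).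
  move=> iS; rewrite /step; case: asboolP => // ni n.
  have /existsNP[n0 hn0] := ni.
  have [m nm Sm] := iS (maxn n n0); exists m; first by rewrite (leq_trans _ nm) ?leq_maxl.
  split => //; apply/negP => bm; apply: hn0; exists m => //.
  by rewrite (leq_trans _ nm) ?leq_maxr.
pose S := fix S k := if k is j.+1 then step j (S j) else fun=> True.
have iS k : inf (S k) by elim: k => [n|k IH]; [exists n|exact: step_inf].
have SS k n : S k.+1 n -> S k n by rewrite /= /step; case: asboolP => _ [].
have Sle j k n : (j <= k)%N -> S k n -> S j n.
  by move=> jk; rewrite -(subnKC jk); elim: (k - j)%N => [|i IH]; rewrite ?addn0 // addnS => /SS.
have Sc k : exists c, forall n, S k.+1 n -> b k n = c.
  rewrite /= /step; case: asboolP => _; [exists true|exists false] => n [_ //].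
  by move/negbTE.
have nxt (k m : nat) : exists m', (m < m')%N /\ S k m'.
  by have [m' h1 h2] := iS k m.+1; exists m'.
have [g hg] := choice (fun km : nat * nat => nxt km.1 km.2).
pose phi := fix phi n := if n is j.+1 then g (j.+1, phi j) else g (0%N, 0%N).
have phiS n : S n (phi n) by case: n => [|n]; [have [] := hg (0%N, 0%N)|have [] := hg (n.+1, phi n)].
exists phi; split; first by move=> n; have [] := hg (n.+1, phi n).
move=> k; have [c hc] := Sc k; exists c => n kn; apply: hc; exact: Sle kn (phiS n).
Qed.

Section blaschke.
Context {R : realType}.
Local Notation C := R[i].

(** [A] and [B] are at Hausdorff distance at most [e]. *)
Definition hausdorff_close (A B : set C) (e : R) :=
  (forall a, A a -> exists2 b, B b & normc (a - b) < e) /\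
  (forall b, B b -> exists2 a, A a & normc (a - b) < e).

(** Pass to a subsequence along which each disc with rational centre and radius
    1/(m + 1) is eventually met by all of the sets or by none of them. The
    limit consists of the points all of whose discs are eventually met; both
    halves of the Hausdorff convergence follow from compactness. *)
Theorem blaschke (L : set C) (P : nat -> set C) : compact L -> (forall n, P n `<=` L) ->
  (exists phi : nat -> nat, exists Poo : set C, [/\ forall n, (phi n < phi n.+1)%N, compact Poo, Poo `<=` L &
    forall e : R, 0 < e -> exists N, forall n, (N <= n)%N -> hausdorff_close (P (phi n)) Poo e]).
Proof.
move=> cL PL.
pose cell (k : nat) : set C :=
  if @unpickle (rat * rat * nat)%type k is Some (q1, q2, m)
  then [set z | normc (z - Complex (ratr q1) (ratr q2)) < m.+1%:R^-1] else set0.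
have ocell k : open (cell k).
  rewrite /cell; case: unpickle => [[[q1 q2] m]|]; last exact: open0.
  rewrite openE => z /= zr; apply/nbhsCP.
  exists (m.+1%:R^-1 - normc (z - Complex (ratr q1) (ratr q2))); first by rewrite subr_gt0.
  by move=> w wz /=; rewrite (le_lt_trans (ler_distcD z _ _)) // -ltrBrDr.
have cellP z (e : R) : 0 < e -> exists k, cell k z /\ forall v w, cell k v -> cell k w -> normc (v - w) < e.
  move=> e0; have e4 : 0 < e / 2 by rewrite divr_gt0.
  have [m hm] : exists m : nat, m.+1%:R^-1 < e / 2.
    exists (Num.truncn (e / 2)^-1); rewrite -[ltRHS]invrK ltf_pV2 ?posrE ?invr_gt0 //.
    exact: truncnS_gt.
  have m2 : 0 < m.+1%:R^-1 / 2 :> R by rewrite divr_gt0 // invr_gt0.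
  have rr (x d : R) : 0 < d -> exists q : rat, `|x - ratr q| < d.
    move=> d0; have xx : x - d < x + d by lra.
    have [q] := rat_in_itvoo xx; rewrite in_itv /= => /andP[q1 q2].
    by exists q; rewrite distrC ltr_norml ltrBrDr ltrBlDr addrC q1 /= addrC.
  have [q1 h1] := rr (complex.Re z) _ m2; have [q2 h2] := rr (complex.Im z) _ m2.
  exists (pickle (q1, q2, m)); rewrite /cell pickleK; split => /=.
    rewrite [X in normc X](_ : _ = Complex (complex.Re z - ratr q1) (complex.Im z - ratr q2)).
      by rewrite (le_lt_trans (normc_le_sum _ _)) // [ltRHS]splitr ltrD.
    by apply: ceqP; rewrite !reim.
  move=> v w hv hw; rewrite (le_lt_trans (ler_distcD (Complex (ratr q1) (ratr q2)) _ _)) //.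
  by rewrite [normc (_ - w)]distcC [ltRHS]splitr ltrD // (lt_trans _ hm).
(* [hit k]: the cell [k] is met by all later sets of the subsequence *)
have [phi [phiS phic]] := diagonal_subsequence (fun k n => `[< P n `&` cell k !=set0 >]).
pose hit k := forall n, (k < n)%N -> P (phi n) `&` cell k !=set0.
have nhit k : ~ hit k -> forall n, (k < n)%N -> ~ (P (phi n) `&` cell k !=set0).
  move=> nh n kn ne; apply: nh => m km; have [c hc] := phic k.
  by have := hc m km; rewrite -(hc n kn) (asboolT ne) => /asboolP.
pose Poo := L `&` [set z | forall k, cell k z -> hit k].
have cPoo : closed Poo.
  apply: closedI; first exact: compact_closedC.
  move=> z cz k kz; have [w [hw kw]] := cz _ (open_nbhs_nbhs (conj (ocell k) kz)).
  exact: hw.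
have cptPoo : compact Poo by apply: (subclosed_compact cPoo cL) => z [].
exists phi, Poo; split => //; first by move=> z [].
move=> e e0.
have [N1 _ hN1] : \forall n \near \oo, L `<=` (fun z => P (phi n) z -> exists2 b, Poo b & normc (z - b) < e).
  have := proj1 (compact_near_coveringP _) cL nat \oo (fun n z => P (phi n) z -> exists2 b, Poo b & normc (z - b) < e).
  apply => z Lz; have [Pz|nPz] := pselect (Poo z).
    exists ([set w | normc (w - z) < e], setT).
      by split; [exact: near_normc|exact: filterT].
    by move=> [w n] [/= we _] _; exists z.
  have [k [kz nk]] : exists k, cell k z /\ ~ hit k.
    apply: contrapT => /forallNP h; apply: nPz; split => //= k kz.
    by apply: contrapT => nh; apply: (h k).
  exists (cell k, [set n | (k < n)%N]).
    split; first exact: (open_nbhs_nbhs (conj (ocell k) kz)).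
    by exists k.+1.
  by move=> [w n] [/= kw kn] Pw; exfalso; apply: (nhit k nk n kn); exists w.
have [N2 _ hN2] : \forall n \near \oo, Poo `<=` (fun b => exists2 a, P (phi n) a & normc (a - b) < e).
  have := proj1 (compact_near_coveringP _) cptPoo nat \oo (fun n b => exists2 a, P (phi n) a & normc (a - b) < e).
  apply => z [Lz hz]; have [k [kz kd]] := cellP z e e0.
  exists (cell k, [set n | (k < n)%N]).
    split; first exact: (open_nbhs_nbhs (conj (ocell k) kz)).
    by exists k.+1.
  move=> [w n] [/= kw kn]; have [a [Pa ka]] := hz k kz n kn.
  by exists a => //; exact: kd.
exists (maxn N1 N2) => n; rewrite geq_max => /andP[n1 n2]; split.
  by move=> a Pa; apply: (hN1 n n1 a) => //; exact: PL Pa.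
by move=> b Pb; exact: (hN2 n n2 b Pb).
Qed.

End blaschke.

(** * Charts and homographies of the sphere *)

Section charts.
Context {R : realType}.
Local Notation C := R[i].
Local Notation Chat := (riemann_sphere R).

Lemma cont_at_Some {T : topologicalType} (g : Chat -> T) (z : C) :
  {for z, continuous (fun w : C => g (Some w))} -> {for (Some z : Chat), continuous g}.
Proof. by move=> cg U Ug; exact: (cg U Ug). Qed.

Lemma inv_chart0 : inv_chart (0 : C) = None.
Proof. by rewrite /inv_chart eqxx. Qed.

(** Neighbourhoods of infinity are complements of compact sets; in the chart at
    infinity these are neighbourhoods of 0. *)
Lemma nbhs_None (U : set Chat) : nbhs (0 : C) (fun v => U (inv_chart v)) -> nbhs (None : Chat) U.
Proof.
move=> /nbhsCP[e e0 he].
exists [set z : C | normc z <= e^-1].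
  have cK : compact [set z : C | normc z <= e^-1].
    exact: compact_disc.
  by split; last exact: compact_closedC.
move=> q [[z /= nz <-]|->].
  have ze : e^-1 < normc z by rewrite ltNge; apply/negP.
  have z0 : z != 0 by rewrite -normc_gt0 (lt_trans _ ze) // invr_gt0.
  have := he z^-1; rewrite /inv_chart invr_eq0 (negbTE z0) invrK; apply.
  rewrite subr0 normcV -[ltRHS]invrK ltf_pV2 ?posrE ?invr_gt0 //.
  by rewrite normc_gt0.
by have := he 0; rewrite inv_chart0; apply; rewrite subrr normc0.
Qed.

Lemma cont_at_None {T : topologicalType} (g : Chat -> T) :
  {for (0 : C), continuous (fun v : C => g (inv_chart v))} -> {for (None : Chat), continuous g}.
Proof.
move=> cg U Ug; apply: nbhs_None; apply: (cg U).
by rewrite /= inv_chart0.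
Qed.

Lemma cont_Some : continuous (fun z : C => Some z : Chat).
Proof. by move=> z U. Qed.

Lemma cont_inv_chart0 : {for (0 : C), continuous (fun v : C => inv_chart v : Chat)}.
Proof.
move=> U; rewrite /= inv_chart0 => -[K [cK _] KU].
have [M M0 hM] := compact_boundedC cK.
apply/nbhsCP; exists M^-1; first by rewrite invr_gt0.
move=> v; rewrite subr0 => vM; apply: KU; rewrite /inv_chart.
have [_|v0] := eqVneq v 0; first by right.
left; exists v^-1 => // Kv; have := hM _ Kv; rewrite normcV.
have h : M < (normc v)^-1 by rewrite -[ltLHS]invrK ltf_pV2 ?posrE ?invr_gt0 ?normc_gt0.
by move=> /(lt_trans h); rewrite ltxx.
Qed.

Lemma derivable_at_cont (T : Chat -> C) q : complex_derivable_at T q -> {for q, continuous T}.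
Proof.
case: q => [z|] /= /derivable_cdiff/cdiff_cont h; first exact: cont_at_Some.
exact: cont_at_None.
Qed.

(** Points of the sphere in homogeneous coordinates, which make the point at
    infinity an ordinary point of the formulas below. *)
Definition of_hom (P Q : C) : Chat := if Q == 0 then None else Some (P / Q).
Definition hom1 (q : Chat) : C := if q is Some z then z else 1.
Definition hom2 (q : Chat) : C := if q is Some z then 1 else 0.
Definition det (a1 a2 b1 b2 : C) := a1 * b2 - a2 * b1.

Lemma of_hom_Some P Q : Q != 0 -> of_hom P Q = Some (P / Q).
Proof. by rewrite /of_hom => /negbTE ->. Qed.

Lemma of_hom_inv P Q : P != 0 -> of_hom P Q = inv_chart (Q / P).
Proof.
move=> P0; rewrite /of_hom /inv_chart mulf_eq0 invr_eq0 (negbTE P0) orbF.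
by case: eqP => // _; rewrite invf_div.
Qed.

Lemma hom_neq0 q : (hom1 q != 0) || (hom2 q != 0).
Proof. by case: q => [z|] /=; rewrite oner_eq0 ?orbT. Qed.

Lemma of_hom_hom k q : k != 0 -> of_hom (k * hom1 q) (k * hom2 q) = q.
Proof.
move=> k0; case: q => [z|] /=; rewrite /of_hom ?mulr1 ?mulr0 ?eqxx ?(negbTE k0) //.
by rewrite mulrC mulKf.
Qed.

Lemma hom_of_hom P Q : (P != 0) || (Q != 0) -> exists2 k, k != 0 &
  P = k * hom1 (of_hom P Q) /\ Q = k * hom2 (of_hom P Q).
Proof.
move=> PQ; have [Q0|Q0] := eqVneq Q 0.
  exists P; first by move: PQ; rewrite Q0 eqxx orbF.
  rewrite Q0 /of_hom eqxx.
  by split; [exact: (esym (mulr1 P))|exact: (esym (mulr0 P))].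
exists Q => //; rewrite (of_hom_Some P Q0); split; last exact: (esym (mulr1 Q)).
by rewrite [hom1 _]/(P / Q : C) mulrC divfK.
Qed.

Lemma det_hom_neq0 x y : x <> y -> det (hom1 x) (hom2 x) (hom1 y) (hom2 y) != 0.
Proof.
rewrite /det; case: x y => [x|] [y|] //= xy; rewrite ?mulr1 ?mul1r ?mul0r ?mulr0 ?subr0 ?sub0r ?oppr_eq0 ?oner_eq0 //.
by rewrite subr_eq0; apply/eqP => e; apply: xy; rewrite e.
Qed.

Lemma det_hom_eq0 y : det (hom1 y) (hom2 y) (hom1 y) (hom2 y) = 0.
Proof. by rewrite /det mulrC subrr. Qed.

(** The Hermitian norm of the homogeneous coordinates. *)
Definition hnorm (P Q : C) : R := Num.sqrt (normc P ^+ 2 + normc Q ^+ 2).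

Lemma hnorm_gt0 P Q : (P != 0) || (Q != 0) -> 0 < hnorm P Q.
Proof.
move=> PQ; rewrite sqrtr_gt0; case/orP: PQ => h.
  by rewrite ltr_pwDl ?sqr_ge0 // exprn_gt0 // normc_gt0.
by rewrite ltr_wpDl ?sqr_ge0 // exprn_gt0 // normc_gt0.
Qed.

Lemma hnorm_Q P Q : Q != 0 -> Num.sqrt (1 + normc (P / Q) ^+ 2) = hnorm P Q / normc Q.
Proof.
move=> Q0; have q0 : 0 < normc Q by rewrite normc_gt0.
rewrite /hnorm; have -> : normc P ^+ 2 + normc Q ^+ 2 = normc Q ^+ 2 * (1 + normc (P / Q) ^+ 2).
  by rewrite normcM normcV; field; rewrite gt_eqF.
by rewrite sqrtrM ?sqr_ge0 // sqrtr_sqr ger0_norm ?normc_ge0 // [RHS]mulrC mulKf // gt_eqF.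
Qed.

Lemma chordal_of_hom P Q P' Q' : (P != 0) || (Q != 0) -> (P' != 0) || (Q' != 0) ->
  chordal (of_hom P Q) (of_hom P' Q') = 2 * normc (det P Q P' Q') / (hnorm P Q * hnorm P' Q').
Proof.
move=> PQ PQ'; have h0 := hnorm_gt0 PQ; have h0' := hnorm_gt0 PQ'.
have hN A : hnorm A 0 = normc A by rewrite /hnorm normc0 expr0n addr0 sqrtr_sqr ger0_norm ?normc_ge0.
rewrite /of_hom; case: eqP => [Q0|/eqP Q0]; case: eqP => [Q0'|/eqP Q0'] /=.
- by rewrite /det Q0 Q0' mulr0 mul0r subr0 normc0 mulr0 mul0r.
- rewrite Q0 in PQ h0 *; rewrite hN /det mul0r subr0 hnorm_Q // normcM.
  rewrite hN in h0; have q0 : 0 < normc Q' by rewrite normc_gt0.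
  by field; rewrite !gt_eqF.
- rewrite Q0' in PQ' h0' *; rewrite hN /det mulr0 sub0r normc_opp hnorm_Q // normcM.
  rewrite hN in h0'; have q0 : 0 < normc Q by rewrite normc_gt0.
  by field; rewrite !gt_eqF.
- have q0 : 0 < normc Q by rewrite normc_gt0.
  have q0' : 0 < normc Q' by rewrite normc_gt0.
  rewrite !hnorm_Q // (_ : P / Q - P' / Q' = det P Q P' Q' / (Q * Q')); last first.
    by rewrite /det; field; rewrite Q0 Q0'.
  rewrite normcM normcV normcM.
  by field; rewrite !gt_eqF.
Qed.

Lemma chordal_ge0 (q q' : Chat) : 0 <= chordal q q'.
Proof.
by case: q q' => [z|] [w|] //=; rewrite ?divr_ge0 ?mulr_ge0 ?sqrtr_ge0 ?normc_ge0.
Qed.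

End charts.

Section homography.
Context {R : realType}.
Local Notation C := R[i].
Local Notation Chat := (riemann_sphere R).
Variables (x y : Chat).
Hypothesis xy : x <> y.

Definition hP (w : C) := hom1 x + w * hom1 y.
Definition hQ (w : C) := hom2 x + w * hom2 y.
(** The homography which maps 0 to [x] and infinity to [y]. *)
Definition moeb (w : C) : Chat := of_hom (hP w) (hQ w).
Definition moeb_inv (q : Chat) : C :=
  - (det (hom1 q) (hom2 q) (hom1 x) (hom2 x) / det (hom1 q) (hom2 q) (hom1 y) (hom2 y)).

Let dxy := det_hom_neq0 xy.

Lemma det_hPQ v w : det (hP v) (hQ v) (hP w) (hQ w) = (w - v) * det (hom1 x) (hom2 x) (hom1 y) (hom2 y).
Proof. by rewrite /det /hP /hQ; ring. Qed.

Lemma det_hPQy w : det (hP w) (hQ w) (hom1 y) (hom2 y) = det (hom1 x) (hom2 x) (hom1 y) (hom2 y).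
Proof. by rewrite /det /hP /hQ; ring. Qed.

Lemma det_hPQx w : det (hP w) (hQ w) (hom1 x) (hom2 x) = - (w * det (hom1 x) (hom2 x) (hom1 y) (hom2 y)).
Proof. by rewrite /det /hP /hQ; ring. Qed.

Lemma hPQ_neq0 w : (hP w != 0) || (hQ w != 0).
Proof.
rewrite -negb_and; apply/negP => /andP[/eqP p0 /eqP q0].
by move: dxy; rewrite -(det_hPQy w) p0 q0 /det !mul0r subrr eqxx.
Qed.

Lemma moebK w : moeb_inv (moeb w) = w.
Proof.
have [k k0 [Pk Qk]] := hom_of_hom (hPQ_neq0 w).
rewrite /moeb_inv -/(moeb w) -[moeb w]/(of_hom (hP w) (hQ w)).
set h1 := hom1 _ in Pk *; set h2 := hom2 (of_hom _ _) in Qk *.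
have Dx := det_hPQx w; have Dy := det_hPQy w.
have kx : det (hP w) (hQ w) (hom1 x) (hom2 x) = k * det h1 h2 (hom1 x) (hom2 x).
  by rewrite {1}Pk {1}Qk /det; ring.
have ky : det (hP w) (hQ w) (hom1 y) (hom2 y) = k * det h1 h2 (hom1 y) (hom2 y).
  by rewrite {1}Pk {1}Qk /det; ring.
have dy0 : det h1 h2 (hom1 y) (hom2 y) != 0.
  by move: dxy; rewrite -Dy ky mulf_eq0 negb_or => /andP[].
apply: (mulIf dy0); apply: (mulfI k0).
rewrite mulNr divfK // mulrN -kx Dx opprK mulrCA -ky Dy //.
Qed.

Lemma moeb0 : moeb 0 = x.
Proof. by rewrite /moeb /hP /hQ !mul0r !addr0 -[in RHS](@of_hom_hom R 1 x) ?oner_eq0 // !mul1r. Qed.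

Lemma moeb_neq w : moeb w <> y.
Proof.
move=> e; have [k k0 [Pk Qk]] := hom_of_hom (hPQ_neq0 w).
rewrite -[of_hom _ _]/(moeb w) e in Pk Qk.
move: dxy; rewrite -(det_hPQy w) Pk Qk /det.
by rewrite [X in _ - X](_ : _ = k * hom1 y * hom2 y) ?subrr ?eqxx //; ring.
Qed.

Lemma moeb_invK q : q <> y -> moeb (moeb_inv q) = q.
Proof.
move=> qy; have d0 := det_hom_neq0 qy; set d := det (hom1 q) (hom2 q) (hom1 y) (hom2 y) in d0.
pose k := det (hom1 x) (hom2 x) (hom1 y) (hom2 y) / d.
have k0 : k != 0 by rewrite mulf_neq0 // invr_eq0.
rewrite /moeb (_ : hP _ = k * hom1 q); last first.
  by rewrite /hP /moeb_inv /k -/d; apply: (mulfI d0); rewrite /d /det; field.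
rewrite (_ : hQ _ = k * hom2 q); first exact: of_hom_hom.
by rewrite /hQ /moeb_inv /k -/d; apply: (mulfI d0); rewrite /d /det; field.
Qed.

Lemma moeb_inv_x : moeb_inv x = 0.
Proof. by rewrite /moeb_inv det_hom_eq0 mul0r oppr0. Qed.

(** This value comes from division by 0; it keeps [y] out of the rings below,
    which are described by lower bounds on the modulus of [moeb_inv]. *)
Lemma moeb_inv_y : moeb_inv y = 0.
Proof. by rewrite /moeb_inv det_hom_eq0 invr0 mulr0 oppr0. Qed.

Lemma cc_affine (a b w : C) : {for w, continuous (fun v : C => a + v * b)}.
Proof.
apply: (@ccD R C (fun=> a) (fun v => v * b)); first exact: (@cc_cst R C a w).
apply: (@ccM R C (fun v => v) (fun=> b)); [exact: cc_id|exact: (@cc_cst R C b w)].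
Qed.

Lemma near_neq0 (g : C -> C) w : {for w, continuous g} -> g w != 0 -> \forall v \near w, g v != 0.
Proof.
move=> cg gw; have g0 : 0 < normc (g w) by rewrite normc_gt0.
have := rc_gt (cc_normc cg) g0; apply: filterS => v.
by rewrite normc_gt0.
Qed.

(** Near each point the homography is a quotient of affine functions in one of
    the two charts. *)
Lemma moeb_chart w : (hQ w != 0 /\ \forall v \near w, moeb v = Some (hP v / hQ v)) \/
  [/\ hQ w = 0, hP w != 0 & \forall v \near w, moeb v = inv_chart (hQ v / hP v)].
Proof.
have [q0|q0] := eqVneq (hQ w) 0; [right|left].
  have p0 : hP w != 0 by have := hPQ_neq0 w; rewrite q0 eqxx orbF.
  split => //; have := near_neq0 (@cc_affine (hom1 x) (hom1 y) w) p0; apply: filterS => v.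
  exact: of_hom_inv.
split => //; have := near_neq0 (@cc_affine (hom2 x) (hom2 y) w) q0; apply: filterS => v.
exact: of_hom_Some.
Qed.

Lemma moeb_cont : continuous moeb.
Proof.
apply: at_cont => w; have cP := (@cc_affine (hom1 x) (hom1 y) w); have cQ := (@cc_affine (hom2 x) (hom2 y) w).
have [[q0 near1]|[q0 p0 near1]] := moeb_chart w.
  apply: (cc_near near1).
  apply: (@cc_comp C C Chat (fun v => hP v / hQ v) (fun z => Some z)); last exact: cont_Some.
  exact: (ccM cP (ccV q0 cQ)).
apply: (cc_near near1).
apply: (@cc_comp C C Chat (fun v => hQ v / hP v) (fun z => inv_chart z)).
  exact: (ccM cQ (ccV p0 cP)).
by rewrite q0 mul0r; exact: cont_inv_chart0.
Qed.

Lemma moeb_inv_cont q : q <> y -> {for q, continuous moeb_inv}.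
Proof.
have cdet (a b : C) (c d : C -> C) v : {for v, continuous c} -> {for v, continuous d} ->
    {for v, continuous (fun v : C => det (c v) (d v) a b)}.
  move=> cc cd; apply: (@ccB R C (fun v => c v * b) (fun v => d v * a)).
    by apply: (@ccM R C c (fun=> b)); [exact: cc|exact: (@cc_cst R C b v)].
  by apply: (@ccM R C d (fun=> a)); [exact: cd|exact: (@cc_cst R C a v)].
have cquo (c d : C -> C) v : {for v, continuous c} -> {for v, continuous d} ->
    det (c v) (d v) (hom1 y) (hom2 y) != 0 -> {for v, continuous (fun v : C =>
      - (det (c v) (d v) (hom1 x) (hom2 x) / det (c v) (d v) (hom1 y) (hom2 y)))}.
  move=> cc cd d0.
  have cn := cdet (hom1 x) (hom2 x) c d v cc cd; have cd' := cdet (hom1 y) (hom2 y) c d v cc cd.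
  apply: (@ccN R C (fun v => det (c v) (d v) (hom1 x) (hom2 x) / det (c v) (d v) (hom1 y) (hom2 y))).
  apply: (@ccM R C (fun v => det (c v) (d v) (hom1 x) (hom2 x)) (fun v => (det (c v) (d v) (hom1 y) (hom2 y))^-1)).
    exact: cn.
  exact: (@ccV R C (fun v => det (c v) (d v) (hom1 y) (hom2 y)) v d0 cd').
move=> qy; have d0 := det_hom_neq0 qy; case: q qy d0 => [z|] qy d0.
  by apply: cont_at_Some; apply: (cquo (fun v => v) (fun=> 1)); [exact: (@cc_id R z)|exact: (@cc_cst R C 1 z)|exact: d0].
apply: cont_at_None.
pose g (v : C) := - (det 1 v (hom1 x) (hom2 x) / det 1 v (hom1 y) (hom2 y)).
have gE v : moeb_inv (inv_chart v) = g v.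
  rewrite /inv_chart /moeb_inv /g; have [->//|v0] := eqVneq v 0.
  have s a b : det 1 v a b = v * det v^-1 1 a b by rewrite /det; field.
  by rewrite !s /= -mulf_div mulfV // mul1r.
rewrite (_ : (fun v => _) = g); last exact/funext.
by apply: (cquo (fun=> 1) (fun v => v)); [exact: (@cc_cst R C 1 0)|exact: (@cc_id R 0)|exact: d0].
Qed.

Lemma cdiff_affine (a b w : C) : cdiff (fun v : C => a + v * b) w.
Proof.
by apply: cdiffD; [exact: cdiff_cst|apply: cdiffM; [exact: cdiff_id|exact: cdiff_cst]].
Qed.

Lemma cdiff_moeb (T : Chat -> C) w : complex_derivable_at T (moeb w) -> cdiff (fun v => T (moeb v)) w.
Proof.
have dP := cdiff_affine (hom1 x) (hom1 y) w; have dQ := cdiff_affine (hom2 x) (hom2 y) w.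
have [[q0 near1]|[q0 p0 near1]] := moeb_chart w.
  rewrite (nbhs_singleton near1) /= => /derivable_cdiff dT.
  apply: (@cdiff_near _ _ (fun v => T (Some (hP v / hQ v)))).
    by apply: filterS near1 => v ->.
  apply: (@cdiff_comp _ (fun z => T (Some z)) (fun v => hP v / hQ v)) => //.
  exact: (cdiffM dP (cdiff_inv q0 dQ)).
rewrite (nbhs_singleton near1) q0 mul0r inv_chart0 /= => /derivable_cdiff dT.
apply: (@cdiff_near _ _ (fun v => T (inv_chart (hQ v / hP v)))).
  by apply: filterS near1 => v ->.
apply: (@cdiff_comp _ (fun z => T (inv_chart z)) (fun v => hQ v / hP v)).
  exact: (cdiffM dQ (cdiff_inv p0 dP)).
by rewrite q0 mul0r.
Qed.

(** The denominator of the chordal distance is bounded below, since [det_hPQy]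
    bounds the Hermitian norm of [(hP w, hQ w)] from below. *)
Lemma chordal_moeb : exists2 K : R, 0 < K & forall v w, chordal (moeb v) (moeb w) <= K * normc (v - w).
Proof.
pose D := det (hom1 x) (hom2 x) (hom1 y) (hom2 y).
have D0 : 0 < normc D by rewrite normc_gt0.
pose s := normc (hom1 y) + normc (hom2 y).
have s0 : 0 < s.
  have /orP[h|h] := hom_neq0 y; first by rewrite ltr_pwDl ?normc_ge0 // normc_gt0.
  by rewrite ltr_wpDl ?normc_ge0 // normc_gt0.
have low w : normc D / s <= hnorm (hP w) (hQ w).
  rewrite ler_pdivrMr // /D -(det_hPQy w) /det (le_trans (ler_normcD _ _)) // normc_opp !normcM.
  have n1 : normc (hP w) <= hnorm (hP w) (hQ w).
    rewrite /hnorm -[leLHS](@ger0_norm _ (normc (hP w))) ?normc_ge0 // -sqrtr_sqr.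
    by rewrite ler_wsqrtr // lerDl sqr_ge0.
  have n2 : normc (hQ w) <= hnorm (hP w) (hQ w).
    rewrite /hnorm -[leLHS](@ger0_norm _ (normc (hQ w))) ?normc_ge0 // -sqrtr_sqr.
    by rewrite ler_wsqrtr // lerDr sqr_ge0.
  by rewrite /s mulrDr addrC lerD // ler_wpM2r ?normc_ge0.
have l0 : 0 < normc D / s by rewrite divr_gt0.
exists (2 * normc D / (normc D / s) ^+ 2).
  by apply: divr_gt0; [apply: mulr_gt0|apply: exprn_gt0].
move=> v w; rewrite chordal_of_hom ?hPQ_neq0 // det_hPQ normcM -/D distcC.
rewrite ler_pdivrMr; last by rewrite mulr_gt0 // hnorm_gt0 // hPQ_neq0.
have e2 : (normc D / s) ^+ 2 <= hnorm (hP v) (hQ v) * hnorm (hP w) (hQ w).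
  by rewrite expr2; apply: ler_pM; rewrite ?low // ltW.
have -> : 2 * (normc (v - w) * normc D) = 2 * normc D / (normc D / s) ^+ 2 * normc (v - w) * (normc D / s) ^+ 2.
  by field; rewrite !gt_eqF.
apply: ler_wpM2l => //; apply: mulr_ge0; last exact: normc_ge0.
apply: divr_ge0; [apply: mulr_ge0; [by []|exact: normc_ge0]|exact: sqr_ge0].
Qed.

End homography.

Section swap.
Context {R : realType}.
Local Notation C := R[i].

Lemma moeb_swap (x y : riemann_sphere R) (w : C) : x <> y -> w != 0 -> moeb y x w^-1 = moeb x y w.
Proof.
move=> xy w0; have [k k0 [Pk Qk]] := hom_of_hom (hPQ_neq0 xy w).
rewrite -[of_hom _ _]/(moeb x y w) in Pk Qk.
rewrite -[RHS](@of_hom_hom R (w^-1 * k)) ?mulf_neq0 ?invr_eq0 //.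
rewrite -!mulrA -Pk -Qk /moeb; congr of_hom; rewrite /hP /hQ mulrDr mulrA mulVf // mul1r addrC //.
Qed.

End swap.

(** * Rings on the sphere *)

Section shells.
Context {R : realType}.
Local Notation C := R[i].

(** The exponential maps a segment between two logarithms into the smallest
    ring which contains the end points. *)
Lemma joined_shell (P : R -> Prop) (w w' : C) :
  (forall a b c, P a -> P b -> a <= c <= b -> P c) -> w != 0 -> w' != 0 ->
  P (normc w) -> P (normc w') -> joined [set v | P (normc v)] w w'.
Proof.
move=> cP /expC_surj[z <-] /expC_surj[z' <-]; rewrite !normc_expC => Pz Pz'.
apply: (@joined_image _ [set z | P (expR (complex.Re z))] _ expC).
- by move=> v _; exact: expC_cont.
- by move=> v hv; rewrite -[[set _ | _] _]/(P (normc (expC v))) normc_expC.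
apply: joined_seg => t /andP[t0 t1] /=.
have -> : complex.Re (z + (t%:C)%C * (z' - z)) = complex.Re z + t * (complex.Re z' - complex.Re z).
  by rewrite !reim mul0r subr0.
have [h|h] := leP (complex.Re z) (complex.Re z').
  by apply: (cP _ _ _ Pz Pz'); rewrite !ler_expR; apply/andP; split; nra.
by apply: (cP _ _ _ Pz' Pz); rewrite !ler_expR; apply/andP; split; nra.
Qed.

Lemma joined_connected (A : set C) : (forall u v, A u -> A v -> joined A u v) -> connected A.
Proof.
move=> jA; have [->|/set0P[u Au]] := eqVneq A set0; first exact: connected0.
suff -> : A = connected_component A u by exact: component_connected.
rewrite eqEsubset; split; last exact: connected_component_sub.
move=> v Av; have [c [cc c0 c1 cA]] := jA u v Au Av.
exists (c @` `[0, 1]); last by exists 1 => //=; rewrite in_itv /= ler01 lexx.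
split.
- by exists 0 => //=; rewrite in_itv /= ler01 lexx.
- by move=> z [t /= t01 <-]; apply: cA; move: t01; rewrite in_itv.
apply: connected_continuous_connected; first exact: segment_connected.
exact: (continuous_subspaceT cc).
Qed.

End shells.

Section transported_ring.
Context {R : realType}.
Local Notation C := R[i].
Local Notation Chat := (riemann_sphere R).
Variables (x y : Chat) (r1 r2 : R).
Hypotheses (xy : x <> y) (r10 : 0 < r1) (r12 : r1 < r2).
Local Notation M := (moeb x y).
Local Notation m := (moeb_inv x y).

Let r20 : 0 < r2. Proof. exact: lt_trans r10 r12. Qed.

Let openr : set C := [set w | r1 < normc w < r2].
Let closedr : set C := [set w | r1 <= normc w <= r2].

Lemma moeb_inj : injective M.
Proof. exact: can_inj (moebK xy). Qed.

Lemma ring_imageE q : (M @` openr) q <-> r1 < normc (m q) < r2.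
Proof.
split; first by move=> [w hw <-]; rewrite moebK.
move=> hq; exists (m q) => //; apply: moeb_invK => // qy.
by move: hq; rewrite qy moeb_inv_y normc0 ltNge (ltW r10).
Qed.

Lemma open_ring_image : open (M @` openr).
Proof.
rewrite openE => q [w /andP[w1 w2] <-].
have cm : {for M w, continuous (fun q => normc (m q))}.
  by apply: cc_normc; exact: (@moeb_inv_cont R x y (M w) (moeb_neq xy (w := w))).
have w1' : r1 < normc (m (M w)) by rewrite moebK.
have w2' : normc (m (M w)) < r2 by rewrite moebK.
have n1 := rc_gt cm w1'; have n2 := rc_lt cm w2'.
apply: filterS2 n1 n2 => q' h1 h2; apply/ring_imageE.
by rewrite h1 h2.
Qed.

(** Away from [y] the inverse homography is continuous. Near [y] the points of
    the image are excluded by the homography with [x] and [y] exchanged, in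
    which they have modulus at least [r2^-1]. *)
Lemma closed_ring_image : closed (M @` closedr).
Proof.
move=> q cq; have [qy|qy] := pselect (q = y).
  have ym : {for y, continuous (fun q => normc (moeb_inv y x q))}.
    by apply: cc_normc; exact: (@moeb_inv_cont R y x y (fun e => xy (esym e))).
  have y0 : normc (moeb_inv y x y) < r2^-1 by rewrite moeb_inv_x normc0 invr_gt0.
  have near_y := rc_lt ym y0.
  rewrite qy in cq; have [q' [[w /andP[w1 w2] <-]]] := cq _ near_y.
  have w0 : w != 0 by rewrite -normc_gt0 (lt_le_trans r10).
  rewrite /= -(moeb_swap xy w0) moebK; last by move=> e; apply: xy.
  by rewrite normcV ltf_pV2 ?posrE // ?normc_gt0 // ltNge w2.
have cm : {for q, continuous (fun q => normc (m q))}.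
  by apply: cc_normc; exact: (@moeb_inv_cont R x y q qy).
exists (m q); last exact: moeb_invK.
apply/andP; split; rewrite leNgt; apply/negP => h.
  have nq := rc_lt cm h; have [q' [[w /andP[w1 w2] <-]]] := cq _ nq.
  by rewrite /= moebK // ltNge w1.
have nq := rc_gt cm h; have [q' [[w /andP[w1 w2] <-]]] := cq _ nq.
by rewrite /= moebK // ltNge w2.
Qed.

Lemma closure_ring_image : closure (M @` openr) = M @` closedr.
Proof.
rewrite eqEsubset; split.
  rewrite [X in _ `<=` X](proj1 (closure_id _) closed_ring_image).
  apply: closure_subset; apply: image_subset => w /andP[w1 w2].
  by apply/andP; split; apply: ltW.
move=> _ [w /andP[w1 w2] <-] V MV.
have w0 : w != 0 by rewrite -normc_gt0 (lt_le_trans r10).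
have n0 : 0 < normc w by rewrite normc_gt0.
have /nbhsCP[e e0 he] : nbhs w (M @^-1` V) by move: MV; exact: (@moeb_cont R x y xy w V).
(* move from w towards the circle of radius (r1 + r2) / 2 *)
pose c := (r1 + r2) / 2; pose d := c - normc w.
pose t := Num.min 1 (e / (2 * (`|d| + 1))).
have d1 : 0 < `|d| + 1 by rewrite ltr_wpDl.
have t0 : 0 < t by rewrite lt_min ltr01 /= divr_gt0 // mulr_gt0.
have t1 : t <= 1 by rewrite ge_min lexx.
have td : t * `|d| < e.
  have h : t <= e / (2 * (`|d| + 1)) by rewrite ge_min lexx orbT.
  apply: (@le_lt_trans _ _ (t * (`|d| + 1))); first by rewrite ler_wpM2l ?lerDl // ltW.
  apply: (@le_lt_trans _ _ (e / (2 * (`|d| + 1)) * (`|d| + 1))); first by rewrite ler_wpM2r // ltW.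
  rewrite (_ : e / _ * _ = e / 2); last by field; rewrite gt_eqF.
  by rewrite ltr_pdivrMr // ltr_pMr // ltr1n.
pose k := 1 + t * d / normc w.
have kw : k * normc w = normc w + t * d by rewrite /k; field; rewrite gt_eqF.
have h1 : 0 <= (1 - t) * (normc w - r1) by rewrite mulr_ge0 // subr_ge0.
have h2 : 0 <= (1 - t) * (r2 - normc w) by rewrite mulr_ge0 // subr_ge0.
have h3 : 0 < t * (r2 - r1) by rewrite mulr_gt0 // subr_gt0.
have kw1 : r1 < k * normc w by rewrite kw /d /c; lra.
have kw2 : k * normc w < r2 by rewrite kw /d /c; lra.
have k0 : 0 < k by rewrite -(pmulr_lgt0 _ n0); apply: lt_trans kw1.
have nk : normc ((k%:C)%C * w) = k * normc w by rewrite normcM normc_real gtr0_norm.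
exists (M ((k%:C)%C * w)); split; first by exists ((k%:C)%C * w) => //; rewrite /openr /= nk kw1.
apply: he; rewrite (_ : _ - w = ((k - 1)%:C)%C * w); last first.
  by rewrite rmorphB mulrBl mul1r.
by rewrite normcM normc_real /k addrAC subrr add0r !normrM (gtr0_norm t0) normfV (gtr0_norm n0) divfK // gt_eqF.
Qed.

(** The image of the open ring is connected, open, and closed in the complement
    of the two curves. *)
Lemma annulus_ring_image : annulus_between (M @` [set w | normc w = r1]) (M @` [set w | normc w = r2]) (M @` openr).
Proof.
have CU : M @` openr `<=` ~` (M @` [set w | normc w = r1] `|` M @` [set w | normc w = r2]).
  move=> _ [w /andP[w1 w2] <-] [[v v1 /moeb_inj e]|[v v1 /moeb_inj e]].
    by move: w1; rewrite -e v1 ltxx.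
  by move: w2; rewrite -e v1 ltxx.
have cU : connected (M @` openr).
  apply: connected_continuous_connected; last exact: (continuous_subspaceT (moeb_cont xy)).
  apply: joined_connected => u v /andP[u1 u2] /andP[v1 v2].
  apply: (@joined_shell _ (fun s => r1 < s < r2)).
  - by move=> a b c /andP[a1 a2] /andP[b1 b2] /andP[ac cb]; rewrite (lt_le_trans a1) // (le_lt_trans cb).
  - by rewrite -normc_gt0 (lt_trans r10).
  - by rewrite -normc_gt0 (lt_trans r10).
  - by rewrite u1.
  - by rewrite v1.
have [c [c0 c1 c2]] : exists c, [/\ 0 < c, r1 < c & c < r2].
  by exists ((r1 + r2) / 2); split; [rewrite divr_gt0 // addr_gt0|rewrite midf_lt|rewrite midf_lt].
pose w0 : C := (c%:C)%C.
have nc : normc w0 = c by rewrite /w0 normc_real gtr0_norm.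
have nw0 : openr w0 by change (r1 < normc w0 < r2); rewrite nc c1.
split; last first.
  rewrite /boundary closure_ring_image (proj1 (interior_id _) open_ring_image).
  rewrite eqEsubset; split.
    move=> _ [[w /andP[w1 w2] <-] nU].
    have [e1|n1] := eqVneq (normc w) r1; first by left; exists w.
    have [e2|n2] := eqVneq (normc w) r2; first by right; exists w.
    by exfalso; apply: nU; exists w => //; rewrite /openr /= !lt_neqAle w1 w2 n2 eq_sym n1.
  have lr := ltW r12.
  move=> q [[w /= e <-]|[w /= e <-]]; split.
  - by exists w => //; rewrite /closedr /= e lexx.
  - by case=> v + /moeb_inj ev; rewrite ev /openr /= e ltxx.
  - by exists w => //; rewrite /closedr /= e lexx andbT.
  - by case=> v + /moeb_inj ev; rewrite ev /openr /= e ltxx andbF.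
exists (M w0); first by apply: CU; exists w0.
rewrite eqEsubset; split.
  by apply: connected_component_max => //; exists w0.
move=> q [B [Bw BJ cB] Bq].
have BU : B `&` (M @` openr) = B.
  apply: cB.
  - by exists (M w0); split => //; exists w0.
  - by exists (M @` openr) => //; exact: open_ring_image.
  exists (M @` closedr); first exact: closed_ring_image.
  rewrite eqEsubset; split => z [Bz [w /andP[w1 w2] e]]; split => //; exists w => //.
    by rewrite /closedr /= !ltW.
  have nJ := BJ _ Bz; rewrite /openr /= !lt_neqAle w1 w2 !andbT.
  apply/andP; split; apply/eqP => r; apply: nJ; [left|right]; exists w => //.
by have [] : (B `&` (M @` openr)) q by rewrite BU.
Qed.

Lemma jordan_ring (r : R) : 0 < r -> jordan_curve (M @` [set w | normc w = r]).
Proof.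
move=> r0; have rC : ((r%:C)%C : C) != 0 by rewrite -normc_gt0 normc_real gtr0_norm.
exists (fun z => M ((r%:C)%C * z)); split.
- apply: cont_on_within => z _.
  apply: (@cc_comp C C Chat (fun z => (r%:C)%C * z) M); last exact: (@moeb_cont R x y xy).
  by apply: (@ccM R C (fun=> (r%:C)%C) (fun z => z)); [exact: (@cc_cst R C _ z)|exact: (@cc_id R z)].
- by move=> u v _ _ /moeb_inj/(mulfI rC).
rewrite eqEsubset; split.
  move=> _ [w /= wr <-]; exists (((r%:C)%C)^-1 * w); last by rewrite mulVKf.
  by rewrite /unit_circle /= normcE normcM normcV normc_real wr gtr0_norm // mulVf // gt_eqF.
move=> _ [z zu <-]; exists ((r%:C)%C * z) => //=.
rewrite normcM normc_real gtr0_norm //; move: zu; rewrite /unit_circle /= normcE => /complexI ->.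
exact: mulr1.
Qed.

(** Both [M] and its inverse map connected sets to connected sets. *)
Lemma component_image (L P : set C) : is_component L P -> is_component (M @` L) (M @` P).
Proof.
move=> [z Lz ->]; exists (M z); first by exists z.
rewrite eqEsubset; split.
  apply: connected_component_max.
  - by exists z => //; exact: connected_component_refl.
  - by apply: image_subset; exact: connected_component_sub.
  apply: connected_continuous_connected; first exact: component_connected.
  exact: (continuous_subspaceT (moeb_cont xy)).
move=> q [B [Bz BL cB] Bq].
have mB : m @` B `<=` connected_component L z.
  apply: connected_component_max.
  - by exists (M z) => //; exact: moebK.
  - by move=> _ [v /BL[w Lw <-] <-]; rewrite moebK.
  apply: connected_continuous_connected => //; apply: cont_on_within => v /BL[w _ <-].
  exact: (@moeb_inv_cont R x y (M w) (moeb_neq xy (w := w))).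
have [w Lw e] := BL _ Bq; exists w => //; apply: mB.
by exists q => //; rewrite -e moebK.
Qed.

End transported_ring.

(** * Pairs related by the Schoenflies relation *)

Section schoenflies_pairs.
Context {R : realType}.
Local Notation C := R[i].
Local Notation Chat := (riemann_sphere R).
Variables (x y : Chat) (r1 r2 : R) (K : set Chat).
Hypotheses (xy : x <> y) (r10 : 0 < r1) (r12 : r1 < r2) (cK : closed K).
Local Notation M := (moeb x y).

Definition ring_part : set C := [set w | r1 <= normc w <= r2 /\ K (M w)].

Lemma compact_ring_part : compact ring_part.
Proof.
apply: (@bounded_closed_compactC _ _ r2); last by move=> z [/andP[]].
move=> w cw; split.
  have cn : {for w, continuous (fun v : C => normc v)} by exact: (@normc_cont R w).
  apply/andP; split; rewrite leNgt; apply/negP => h.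
    have [v [[/andP[v1 _] _]]] := cw _ (rc_lt cn h).
    by rewrite ltNge v1.
  have [v [[/andP[_ v2] _]]] := cw _ (rc_gt cn h).
  by rewrite ltNge v2.
apply: cK => V MV.
have [v [[_ Kv] Vv]] := cw _ (@moeb_cont R x y xy w V MV).
by exists (M v).
Qed.

Lemma hausdorff_dist_ge0 (A B : set Chat) : A !=set0 -> (0 <= hausdorff_dist (@chordal R) A B)%E.
Proof.
move=> [a Aa]; rewrite le_max; apply/orP; left.
apply: le_ereal_sup_tmp; exists (ereal_inf [set (chordal a b)%:E | b in B]); first by exists a.
by apply: le_ereal_inf_tmp => _ [b _ <-]; rewrite lee_fin chordal_ge0.
Qed.

Lemma hausdorff_dist_le (k e : R) (A B : set C) :
  (forall v w, chordal (M v) (M w) <= k * normc (v - w)) -> 0 <= k -> hausdorff_close A B e ->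
  (hausdorff_dist (@chordal R) (M @` A) (M @` B) <= (k * e)%:E)%E.
Proof.
move=> hk k0 [hA hB]; rewrite ge_max; apply/andP; split.
  apply: ge_ereal_sup => _ [_ [a Aa <-] <-]; have [b Bb ab] := hA a Aa.
  apply: ge_ereal_inf; exists (chordal (M a) (M b))%:E; first by exists (M b) => //; exists b.
  by rewrite lee_fin (le_trans (hk _ _)) // ler_wpM2l // ltW.
apply: ge_ereal_sup => _ [_ [b Bb <-] <-]; have [a Aa ab] := hB b Bb.
apply: ge_ereal_inf; exists (chordal (M a) (M b))%:E; first by exists (M a) => //; exists a.
by rewrite lee_fin (le_trans (hk _ _)) // ler_wpM2l // ltW.
Qed.

Lemma cvg_hausdorff (P : nat -> set C) (Poo : set C) : (forall n, P n !=set0) ->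
  (forall e : R, 0 < e -> exists N, forall n, (N <= n)%N -> hausdorff_close (P n) Poo e) ->
  hausdorff_dist (@chordal R) (M @` P n) (M @` Poo) @[n --> \oo] --> 0%E.
Proof.
move=> Pne hP; have [k k0 hk] := chordal_moeb xy.
have bound e : 0 < e -> \forall n \near \oo, (0 <= hausdorff_dist (@chordal R) (M @` P n) (M @` Poo) <= e%:E)%E.
  move=> e0; have [N hN] := hP _ (divr_gt0 e0 k0); exists N => // n /= nN.
  rewrite hausdorff_dist_ge0 /=; last by have [a Pa] := Pne n; exists (M a); exists a.
  have h := hausdorff_dist_le hk (ltW k0) (hN n nN).
  by rewrite (_ : k * (e / k) = e) // in h; field; rewrite gt_eqF.
apply/fine_cvgP; split.
  by apply: filterS (bound 1 ltr01) => n /andP[h0 h1]; rewrite fin_numE; case: hausdorff_dist h0 h1.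
apply/cvgrPdist_le => e e0; apply: filterS (bound e e0) => n /=.
case: hausdorff_dist => [r||] //=; rewrite ?lee_fin => /andP[h0 h1].
  by rewrite sub0r normrN ger0_norm.
by rewrite subr0 normr0 ltW.
Qed.

(** Otherwise the distance from the circle of radius [r] would be bounded below
    on the compact limit, hence on all late sets. *)
Lemma touches_limit (P : nat -> set C) (Poo : set C) (r : R) : compact Poo ->
  (forall e : R, 0 < e -> exists N, forall n, (N <= n)%N -> hausdorff_close (P n) Poo e) ->
  (forall n, exists2 w, P n w & normc w = r) -> exists2 w, Poo w & normc w = r.
Proof.
move=> cP hP Pr; apply: contrapT => no.
have cg z : {for z, continuous (fun w : C => `|normc w - r|)}.
  apply: (@cc_comp C R R (fun w => normc w - r) (fun s => `|s|)); last exact: norm_continuous.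
  by apply: rcB; [exact: (@normc_cont R z)|exact: rc_cst].
have := proj1 (compact_near_coveringP _) cP nat \oo (fun n z => n.+1%:R^-1 <= `|normc z - r|).
case.
  move=> z Pz; have d0 : 0 < `|normc z - r|.
    rewrite normr_gt0 subr_eq0; apply/eqP => e; apply: no; by exists z.
  have d2 : `|normc z - r| / 2 < `|normc z - r| by rewrite ltr_pdivrMr // ltr_pMr // ltr1n.
  exists ([set w | `|normc z - r| / 2 < `|normc w - r|], [set n | n.+1%:R^-1 <= `|normc z - r| / 2]).
    split => /=; first exact: (rc_gt (cg z) d2).
    have h0 : 0 < `|normc z - r| / 2 by rewrite divr_gt0.
    exists (Num.truncn (`|normc z - r| / 2)^-1) => // n /= hn.
    rewrite -[leRHS]invrK lef_pV2 ?posrE ?invr_gt0 // ltW // (lt_le_trans (truncnS_gt _)) //.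
    by rewrite ler_nat ltnS.
  by move=> [w n] [/= h1 h2]; rewrite (le_trans h2) // ltW.
move=> N _ hN.
have [N1 hN1] := hP N.+1%:R^-1 (ltac:(by rewrite invr_gt0)).
have [w Pw wr] := Pr N1; have [b Pb wb] := (hN1 N1 (leqnn _)).1 w Pw.
have := hN N (leqnn N) b Pb; rewrite /= leNgt => /negP; apply.
rewrite -wr; apply: le_lt_trans wb; rewrite ler_norml.
have h1 := lerB_distc w b; have h2 := lerB_distc b w.
rewrite [normc (b - w)]distcC in h2.
by apply/andP; split; lra.
Qed.

(** Infinitely many crossing components contain a sequence of distinct ones,
    and [blaschke] a convergent subsequence, whose limit meets both circles. *)
Theorem crossing_components_schoenflies : ~ finite_set (crossing_component r1 r2 ring_part) ->
  exists v w : C, [/\ normc v = r1, normc w = r2 & schoenflies_rel K (M v) (M w)].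
Proof.
move=> /infiniteP/pcard_leP/unsquash f.
have Pcr n : crossing_component r1 r2 ring_part (f n) by exact: funS.
have Psub n : f n `<=` ring_part.
  by have [[z _ ->] _ _] := Pcr n; exact: connected_component_sub.
have [phi [Poo [phiS cPoo PooL hP]]] := blaschke compact_ring_part Psub.
have [v Pv v1] : exists2 v, Poo v & normc v = r1.
  by apply: (touches_limit cPoo hP) => n; have [] := Pcr (phi n).
have [w Pw w2] : exists2 w, Poo w & normc w = r2.
  by apply: (touches_limit cPoo hP) => n; have [] := Pcr (phi n).
exists v, w; split => //; split; [by have [] := PooL _ Pv|by have [] := PooL _ Pw|right].
exists (M @` [set w | normc w = r1]), (M @` [set w | normc w = r2]), (M @` [set w | r1 < normc w < r2]).
split; [exact: (jordan_ring xy r10)|exact: (jordan_ring xy (lt_trans r10 r12))| |exact: (annulus_ring_image xy r10 r12)|].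
  rewrite -subset0 => q [[a a1 <-] [b b2 /(moeb_inj xy) e]].
  by move: r12; rewrite -b2 -a1 /= e ltxx.
split; first by exists v.
split; first by exists w.
have LE : closure (M @` [set w | r1 < normc w < r2]) `&` K = M @` ring_part.
  rewrite closure_ring_image // eqEsubset; split.
    by move=> _ [[a ha <-] Ka]; exists a.
  by move=> _ [a [ha Ka] <-]; split => //; exists a.
exists (fun n => M @` (f (phi n))), (M @` Poo); split.
- have fI : injective f by move=> a b; apply: inj; rewrite inE.
  have phiI : injective phi.
    have lt_phi a b : (a < b)%N -> (phi a < phi b)%N by exact: (homo_ltn ltn_trans phiS).
    move=> a b e; case: (ltngtP a b) => // /lt_phi; by rewrite e ltnn.
  have MI := moeb_inj xy.
  move=> a b e; apply: phiI; apply: fI; rewrite eqEsubset; split => z fz.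
    have : (M @` f (phi b)) (M z) by rewrite -e; exists z.
    by case=> z' fz' /MI <-.
  have : (M @` f (phi a)) (M z) by rewrite e; exists z.
  by case=> z' fz' /MI <-.
- by move=> n; rewrite LE; apply: component_image => //; have [] := Pcr (phi n).
- move=> n; have [_ [a Pa a1] [b Pb b2]] := Pcr (phi n).
  by split; [exists (M a)|exists (M b)]; split; [exists a|exists a|exists b|exists b].
- split.
    apply: continuous_compact => //; exact: (continuous_subspaceT (moeb_cont xy)).
  apply: (@cvg_hausdorff (fun n => f (phi n))) => // n.
  by have [_ [a Pa _] _] := Pcr (phi n); exists a.
- by move=> q [->|->]; [exists v|exists w].
Qed.

End schoenflies_pairs.

(** * Limit sets of half-open paths *)

Lemma within_comp {T U V : topologicalType} (A : set U) (f : U -> V) (h : T -> U) t :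
  {within A, continuous f} -> (\forall t' \near t, A (h t')) -> {for t, continuous h} ->
  {for t, continuous (fun t => f (h t))}.
Proof.
move=> cf Ah ch W Wf.
have /subspace_continuousP/(_ _ (nbhs_singleton Ah) _ Wf) h1 := cf.
have {}h1 : nbhs (h t) [set u | A u -> W (f u)] by exact: h1.
by apply: filterS2 Ah (ch _ h1) => u /= Au; exact.
Qed.

Section limit_sets.
Context {R : realType}.
Local Notation C := R[i].

Lemma harmonic_lt (e : R) : 0 < e -> exists N, forall n, (N <= n)%N -> n.+1%:R^-1 < e.
Proof.
move=> e0; exists (Num.truncn e^-1) => n Nn.
rewrite -[ltRHS]invrK ltf_pV2 ?posrE ?invr_gt0 // (lt_le_trans (truncnS_gt _)) //.
by rewrite ler_nat ltnS.
Qed.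

Lemma half_open_cont {T : topologicalType} (D : set T) (a : R -> T) (t : R) : half_open_path D a -> t < 1 ->
  {for t, continuous (fun s : R => a (Num.max 0 s))}.
Proof.
move=> [ca _] t1; apply: (within_comp ca).
  have h := lt_nbhsl t1; apply: filterS h => s /= s1.
  by rewrite in_itv /= le_max lexx gt_max ltr01.
by apply: (@continuous_max R R (fun=> 0) id); [exact: cvg_cst|exact: cvg_id].
Qed.

Lemma limit_set_visits {T : topologicalType} (D : set T) (a : R -> T) (z : T) (U : set T) (s : R) :
  limit_set D a z -> nbhs z U -> s < 1 -> exists t, [/\ s < t < 1, 0 < t & U (a t)].
Proof.
move=> [_ [t [t01 _ t1 az]]] Uz s1.
have [N _ hN] : \forall n \near \oo, s < t n /\ U (a (t n)).
  apply: filterS2 (cvgr_gt _ t1 _ s1) (az _ Uz) => n /=; by split.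
exists (t N); have [h1 h2] := hN N (leqnn N).
by have := t01 N; rewrite in_itv /= => /andP[t0 ->]; rewrite h1.
Qed.

(** [z] is a cluster point of [b] at time 1. *)
Definition approaches (b : R -> C) z :=
  forall e s : R, 0 < e -> s < 1 -> exists t, s < t < 1 /\ normc (b t - z) < e.

(** The increasing sequence of times is chosen recursively. *)
Lemma approaches_limit_set (b : R -> C) z : (forall t, 0 <= t < 1 -> normc (b t) < 1) ->
  approaches b z -> limit_set (@unit_disc R) b z.
Proof.
move=> b1 bz; split.
  move=> U /nbhsCP[e e0 he]; have [t [/andP[t0 t1] ht]] := bz e 0 e0 ltr01.
  exists (b t); split; last exact: he.
  by rewrite /unit_disc /= normcE ltcR b1 // ltW.
have step (q : nat * R) : exists t, q.2 < 1 -> [/\ q.2 < t, 1 - q.1.+2%:R^-1 < t, t < 1 & normc (b t - z) < q.1.+1%:R^-1].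
  have [h|h] := ltP q.2 1; last by exists 0.
  have [| |t [/andP[]]] := bz q.1.+1%:R^-1 (Num.max q.2 (1 - q.1.+2%:R^-1)); first by rewrite invr_gt0.
    by rewrite gt_max h gtrBl invr_gt0 ltr0n.
  by rewrite gt_max => /andP[h1 h2] h3 h4; exists t.
have [g hg] := choice step.
pose t := fix t n := if n is k.+1 then g (k.+1, t k) else g (0%N, 0).
have t1 n : t n < 1.
  by elim: n => [|n IH]; [have [] := hg (0%N, 0) ltr01|have [] := hg (n.+1, t n) IH].
have tS n : t n < t n.+1 by have [] := hg (n.+1, t n) (t1 n).
have tn n : 1 - n.+2%:R^-1 < t n.
  by case: n => [|n]; [have [] := hg (0%N, 0) ltr01|have [] := hg (n.+1, t n) (t1 n)].
have tz n : normc (b (t n) - z) < n.+1%:R^-1.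
  by case: n => [|n]; [have [] := hg (0%N, 0) ltr01|have [] := hg (n.+1, t n) (t1 n)].
exists t; split.
- move=> n; rewrite in_itv /= t1 andbT; apply: le_lt_trans (tn n).
  by rewrite subr_ge0 invf_le1 // ler1n.
- exact: (homo_ltn lt_trans tS).
- apply/cvgrPdist_lt => e e0; have [N hN] := harmonic_lt e0.
  exists N => // n /= Nn; rewrite gtr0_norm ?subr_gt0 // ltrBlDr -ltrBlDl.
  apply: lt_trans (tn n); rewrite ltrD2l ltrN2.
  exact: (hN n.+1 (leqW Nn)).
- apply/cvgCP => e e0; have [N hN] := harmonic_lt e0.
  by exists N => // n /= Nn; apply: lt_trans (tz n) (hN n Nn).
Qed.

(** The limit set is defined by sequences; by compactness of the closed disc, a
    path with a single limit point converges to it. *)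
Lemma endpoint_tends (b : R -> C) p : (forall t, 0 <= t < 1 -> normc (b t) < 1) ->
  has_endpoint (@unit_disc R) b p ->
  forall e : R, 0 < e -> exists2 s, s < 1 & forall t, s <= t < 1 -> normc (b t - p) < e.
Proof.
move=> b1 bp e e0; pose K : set C := [set z | normc z <= 1 /\ e <= normc (z - p)].
have cK : compact K.
  apply: (@bounded_closed_compactC _ _ 1); last by move=> z [].
  move=> z cz; have c1 : {for z, continuous (fun v : C => normc v)} by exact: (@normc_cont R z).
  have c2 : {for z, continuous (fun v : C => normc (v - p))}.
    by apply: cc_normc; apply: (@ccB R C (fun v => v) (fun=> p)); [exact: (@cc_id R z)|exact: (@cc_cst R C p z)].
  split; rewrite leNgt; apply/negP => h.
    by have [v [[h1 _]]] := cz _ (rc_gt c1 h); rewrite ltNge h1.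
  by have [v [[_ h1]]] := cz _ (rc_lt c2 h); rewrite ltNge h1.
pose P (n : nat) z := forall t, 1 - n.+1%:R^-1 <= t < 1 -> b t <> z.
have [|N _ hN] := proj1 (compact_near_coveringP _) cK nat \oo P.
  move=> z [z1 ze]; have /existsNP[d /existsNP[s]] : ~ approaches b z.
    move=> /(approaches_limit_set b1); rewrite bp => zp.
    by move: ze; rewrite zp subrr normc0 leNgt e0.
  move=> /not_implyP[d0 /not_implyP[s1 /forallNP nd]].
  have h0 : 0 < 1 - s by rewrite subr_gt0.
  have [N hN] := harmonic_lt h0.
  exists ([set w | normc (w - z) < d], [set n | (N <= n)%N]).
    by split; [exact: near_normc|exists N].
  move=> [w n] [/= wz Nn] t /andP[t0 t1] bt; apply: (nd t); rewrite bt; split => //.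
  by rewrite t1 andbT (lt_le_trans _ t0) // ltrBrDl -ltrBrDr hN.
exists (1 - N.+1%:R^-1); first by rewrite gtrBl invr_gt0.
move=> t /andP[t0 t1]; rewrite ltNge; apply/negP => h.
have t00 : 0 <= t by apply: le_trans t0; rewrite subr_ge0 invf_le1 // ler1n.
have Kb : K (b t) by split => //; rewrite ltW // b1 // t00.
by apply: (hN N (leqnn N) (b t) Kb t) => //; rewrite t0.
Qed.

Lemma tends_endpoint (b : R -> C) p : (forall t, 0 <= t < 1 -> normc (b t) < 1) ->
  (forall e : R, 0 < e -> exists2 s, s < 1 & forall t, s <= t < 1 -> normc (b t - p) < e) ->
  has_endpoint (@unit_disc R) b p.
Proof.
move=> b1 bp; rewrite /has_endpoint eqEsubset; split.
  move=> z zl; apply: contrapT => /eqP zp.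
  have d0 : 0 < normc (z - p) / 2 by rewrite divr_gt0 // normc_gt0 subr_eq0.
  have [s s1 hs] := bp _ d0.
  have [t [/andP[t0 t1] _ /= tz]] := limit_set_visits zl (near_normc z d0) s1.
  have := hs t; rewrite (ltW t0) t1 => /(_ erefl) tp.
  have := ler_distcD (b t) z p; rewrite [normc (z - b t)]distcC; lra.
move=> _ ->; apply: approaches_limit_set => // e s e0 s1.
have [s' s'1 hs] := bp e e0.
exists ((Num.max s s' + 1) / 2).
have m1 : Num.max s s' < 1 by rewrite gt_max s1.
have ms : s <= Num.max s s' by rewrite le_max lexx.
have ms' : s' <= Num.max s s' by rewrite le_max lexx orbT.
split; first by apply/andP; split; lra.
by apply: hs; apply/andP; split; lra.
Qed.

End limit_sets.

(** * Crossing times *)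

Section strand_times.
Context {R : realType}.
Local Notation C := R[i].
Variables (alpha : R -> C) (r1 r2 : R).
Hypotheses (r12 : r1 < r2) (calpha : forall t, t < 1 -> {for t, continuous alpha}).
Hypothesis goes_in : forall s, s < 1 -> exists2 t, s < t < 1 & normc (alpha t) < r1.
Hypothesis goes_out : forall s, s < 1 -> exists2 t, s < t < 1 & r2 < normc (alpha t).

(** After a visit inside the small circle and before a visit outside the large
    one, take a time shortly after the last visit to the small closed disc. *)
Lemma strand_time s : s < 1 -> exists th, [/\ s < th < 1, r1 < normc (alpha th) < r2,
  exists2 r, th <= r < 1 & r2 < normc (alpha r) /\ (forall t, th <= t <= r -> r1 < normc (alpha t)) &
  exists2 l, s < l <= th & normc (alpha l) <= r1 /\ (forall t, l <= t <= th -> normc (alpha t) < r2)].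
Proof.
move=> s1; have [l /andP[sl l1] al] := goes_in s1; have [r /andP[lr r1'] ar] := goes_out l1.
have cn t : t < 1 -> {for t, continuous (fun t => normc (alpha t))} by move=> t1; exact: cc_normc (calpha t1).
(* [l'] is the last time in [l, r] at which the small closed disc is visited *)
pose S := [set t | l <= t <= r /\ normc (alpha t) <= r1].
have Sl : S l by split; rewrite ?lexx ltW.
have ubr : ubound S r by move=> t [/andP[_ tr] _].
have hS : has_sup S by split; [exists l|exists r].
pose l' := sup S.
have ll' : l <= l' by apply: (sup_upper_bound hS).
have l'r : l' <= r by apply: ge_sup; [exists l|exact: ubr].
have l'1 : l' < 1 by exact: le_lt_trans r1'.
have al' : normc (alpha l') <= r1.
  rewrite leNgt; apply/negP => h.
  have /nbhs_ballP[d /= d0 hd] := rc_gt (cn _ l'1) h.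
  have [t St tl] := sup_adherent d0 hS.
  have tl' : t <= l' by exact: (sup_upper_bound hS).
  have := hd t; rewrite /ball /= => /(_ (ltac:(rewrite ger0_norm ?subr_ge0 //; rewrite -/l' in tl; lra))).
  by rewrite ltNge (St.2).
have l'r' : l' < r.
  by rewrite lt_neqAle l'r andbT; apply/eqP => e; move: al'; rewrite e leNgt (lt_trans r12).
have after t : l' < t <= r -> r1 < normc (alpha t).
  move=> /andP[lt tr]; rewrite ltNge; apply/negP => h.
  have : S t by split; rewrite // tr (le_trans ll') // ltW.
  by move=> /(sup_upper_bound hS); rewrite leNgt lt.
have /nbhs_ballP[d /= d0 hd] := rc_lt (cn _ l'1) (le_lt_trans al' r12).
pose th := Num.min (l' + d / 2) ((l' + r) / 2).
have th1 : l' < th by rewrite lt_min; apply/andP; split; lra.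
have thd : th <= l' + d / 2 by rewrite ge_min lexx.
have thr : th <= (l' + r) / 2 by rewrite ge_min lexx orbT.
have before t : l' <= t <= th -> normc (alpha t) < r2.
  move=> /andP[t0 t1]; apply: hd; rewrite /ball /= distrC ger0_norm ?subr_ge0 //; lra.
exists th; split.
- by apply/andP; split; lra.
- by rewrite after ?before ?lexx ?andbT ?(ltW th1) //; lra.
- exists r; first by apply/andP; split; lra.
  by split => // t /andP[t0 t1]; rewrite after // t1 (lt_le_trans th1).
- by exists l'; [apply/andP; split; lra|].
Qed.

End strand_times.

(** * Rings around a point of the principal set *)

Section separated_by_rings.
Context {R : realType}.
Local Notation C := R[i].
Local Notation Chat := (riemann_sphere R).
Variables (D : set Chat) (T : Chat -> C) (p : C) (x y : Chat).
Hypotheses (oD : open D) (scD : simply_connected (R := R) D) (hT : conformal_onto_disc D T).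
Hypotheses (p1 : normc p = 1) (xy : x <> y) (nx : ~ D x) (ny : ~ D y).
Local Notation M := (moeb x y).
Local Notation m := (moeb_inv x y).

Let E : set C := [set w | D (M w)].

Lemma in_domain_neq q : D q -> q <> y.
Proof. by move=> Dq e; apply: ny; rewrite -e. Qed.

Lemma chart_domain q : D q -> M (m q) = q.
Proof. by move=> Dq; apply: (moeb_invK xy); exact: in_domain_neq. Qed.

Lemma chart_neq0 q : D q -> m q != 0.
Proof.
by move=> Dq; apply/eqP => e; apply: nx; rewrite -(moeb0 x y) -e chart_domain.
Qed.

Lemma image_in_disc q : D q -> normc (T q) < 1.
Proof.
move=> Dq; have [[fT _ _] _] := hT.
by have := fT q Dq; rewrite /unit_disc /= normcE ltcR.
Qed.

(** A loop in [D] which does not lift to a closed path would wind around 0, the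
    preimage of [x]. The homotopy contracting the loop stays away from 0, and
    its logarithm is constant on the three sides of the square where the
    homotopy is. *)
Lemma loops_lift_closed (s : R -> C) : continuous s -> (forall t, E (expC (s t))) ->
  expC (s 0) = expC (s 1) -> s 0 = s 1.
Proof.
move=> cs Es e01.
have cg t : {for t, continuous (fun t : R => M (expC (s t)))}.
  apply: (@cc_comp R C Chat (fun t => expC (s t)) M); last exact: (@moeb_cont R x y xy).
  by apply: cc_expC; exact: (cont_at cs).
have [||| H [cH HD H0 H1 Hs]] := scD (g := fun t => M (expC (s t))).
- by apply: cont_on_within => t _; exact: cg.
- by move=> _ [t _ <-]; exact: Es.
- by rewrite e01.
have c01 t : clamp t \in `[0, 1 : R] by rewrite in_itv /= clamp01.
have DH q : D (H (clamp q.1, clamp q.2)).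
  by apply: HD; exists (clamp q.1, clamp q.2) => //; split => /=; exact: c01.
(* the homotopy in the coordinate [w], extended to the whole plane *)
pose F (z t : R) := m (H (clamp z, clamp t)).
have cF (q : R * R) : {for q, continuous (fun q : R * R => F q.1 q.2)}.
  apply: (@cc_comp (R * R)%type Chat C (fun q => H (clamp q.1, clamp q.2)) m); last first.
    by apply: moeb_inv_cont; exact: in_domain_neq.
  apply: (within_comp cH).
    by apply: (@filterE _ (nbhs q) _) => q'; split => /=; exact: c01.
  apply: cc_pair.
    apply: (@cc_comp (R * R)%type R R (fun q => q.1) (@clamp R)); [exact: cc_fst|exact: (cont_at (@clamp_cont R))].
  apply: (@cc_comp (R * R)%type R R (fun q => q.2) (@clamp R)); [exact: cc_snd|exact: (cont_at (@clamp_cont R))].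
have F0 z t : F z t != 0 by apply: chart_neq0; exact: (DH (z, t)).
have i0 : 0 <= (0 : R) <= 1 by rewrite lexx ler01.
have i1 : 0 <= (1 : R) <= 1 by rewrite lexx ler01.
have Fs z : 0 <= z <= 1 -> F z 0 = expC (s z).
  by move=> z01; rewrite /F !clamp_id // H0 ?in_itv //= (moebK xy).
have Fb z : 0 <= z <= 1 -> F z 1 = expC (s 0).
  by move=> z01; rewrite /F !clamp_id // H1 ?in_itv //= (moebK xy).
have Fl t : 0 <= t <= 1 -> F 0 t = expC (s 0) /\ F 1 t = expC (s 0).
  move=> t01; rewrite /F (clamp_id i0) (clamp_id i1) (clamp_id t01).
  by have [|-> ->] := Hs t; rewrite ?in_itv //= (moebK xy).
have cI : compact (`[0, 1] : set R) by exact: segment_compact.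
have kI : connected (`[0, 1] : set R) by exact: segment_connected.
have [||L [L0 Le Lc]] := @log_lift R R `[0, 1]%classic F cI.
- by move=> z t _ _; exact: (cF (z, t)).
- by move=> z t _ _; exact: F0.
have I z : 0 <= z <= 1 -> (`[0, 1]%classic : set R) z by rewrite /= in_itv.
(* the base point is fixed along the two vertical sides *)
have side z : 0 <= z <= 1 -> (forall t, 0 <= t <= 1 -> F z t = expC (s 0)) -> L z 1 = 0.
  move=> z01 Fz; rewrite -(L0 z (I z z01)).
  apply: (@exp_const R R `[0, 1]%classic (L z) kI).
  - apply: cont_on_within => t; rewrite /= in_itv /= => t01.
    apply: (@cc_comp R (R * R)%type C (fun t => (z, t)) (fun q => L q.1 q.2)).
      by apply: cc_pair; [exact: rc_cst|exact: rc_id].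
    exact: Lc (I z z01) t01.
  - move=> t; rewrite /= in_itv /= => t01.
    have := Le z t (I z z01) t01; rewrite (Fz t t01) (Fz 0 i0) => h.
    by apply: (mulIf (expC_neq0 (s 0))); rewrite mul1r.
  - exact: I.
  - exact: I.
have l0 := side 0 i0 (fun t t01 => (Fl t t01).1).
have l1 := side 1 i1 (fun t t01 => (Fl t t01).2).
have : L 0 1 + s 0 - s 0 = L 1 1 + s 1 - s 0.
  apply: (@exp_const R R `[0, 1]%classic (fun z => L z 1 + s z - s 0) kI); [|  |exact: I|exact: I].
  - apply: cont_on_within => z; rewrite /= in_itv /= => z01.
    apply: (@ccB R R (fun z => L z 1 + s z) (fun=> s 0)); last exact: (@cc_cst R R (s 0) z).
    apply: (@ccD R R (fun z => L z 1) s); last exact: (cont_at cs).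
    apply: (@cc_comp R (R * R)%type C (fun z => (z, 1)) (fun q => L q.1 q.2)).
      by apply: cc_pair; [exact: rc_id|exact: rc_cst].
    exact: Lc (I z z01) i1.
  - move=> z; rewrite /= in_itv /= => z01.
    have := Le z 1 (I z z01) i1; rewrite (Fb z z01) (Fs z z01) => h.
    by rewrite expCB expCD h divff // expC_neq0.
by rewrite l0 l1 !add0r subrr => /esym/eqP; rewrite subr_eq0 => /eqP.
Qed.

Variables (a : R -> Chat) (r1 r2 : R).
Hypotheses (r10 : 0 < r1) (r12 : r1 < r2).
Hypotheses (ha : possesses_prime_end D T a p) (ax : limit_set D a x) (ay : limit_set D a y).
Hypothesis minimal : forall a', possesses_prime_end D T a' p -> limit_set D a' x.

Local Notation L := (ring_part x y r1 r2 (~` D)).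
Let alpha (t : R) : C := m (a (Num.max 0 t)).

Lemma a_in t : 0 <= t < 1 -> D (a t).
Proof. by move=> t01; have [[_ aD] _] := ha; apply: aD; exists t; rewrite //= in_itv. Qed.

Lemma a_in_max t : t < 1 -> D (a (Num.max 0 t)).
Proof. by move=> t1; apply: a_in; rewrite le_max lexx gt_max ltr01. Qed.

Lemma M_alpha t : t < 1 -> M (alpha t) = a (Num.max 0 t).
Proof. by move=> t1; apply: chart_domain; exact: a_in_max. Qed.

Lemma alpha_in t : t < 1 -> E (alpha t).
Proof. by move=> t1; rewrite /E /= M_alpha //; exact: a_in_max. Qed.

Lemma alpha_cont t : t < 1 -> {for t, continuous alpha}.
Proof.
move=> t1; have [hp _] := ha.
apply: (@cc_comp R Chat C (fun t => a (Num.max 0 t)) m); first exact: (half_open_cont hp t1).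
by apply: moeb_inv_cont; apply: in_domain_neq; exact: a_in_max.
Qed.

Lemma alpha_goes_in s : s < 1 -> exists2 t, s < t < 1 & normc (alpha t) < r1.
Proof.
move=> s1; have cm : {for x, continuous (fun q => normc (m q))}.
  by apply: cc_normc; exact: (@moeb_inv_cont R x y x xy).
have h : normc (m x) < r1 by rewrite moeb_inv_x normc0.
have [t [st t0 at1]] := limit_set_visits ax (rc_lt cm h) s1.
by exists t => //; rewrite /alpha max_r // ltW.
Qed.

Lemma alpha_goes_out s : s < 1 -> exists2 t, s < t < 1 & r2 < normc (alpha t).
Proof.
move=> s1; have yx : y <> x by move=> e; apply: xy.
have r20 : 0 < r2 by exact: lt_trans r12.
have cm : {for y, continuous (fun q => normc (moeb_inv y x q))}.
  by apply: cc_normc; exact: (@moeb_inv_cont R y x y yx).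
have h : normc (moeb_inv y x y) < r2^-1 by rewrite moeb_inv_x normc0 invr_gt0.
have [t [/andP[st t1] t0 /= at1]] := limit_set_visits ay (rc_lt cm h) s1.
exists t; first by rewrite st.
have e : alpha t = m (a t) by rewrite /alpha max_r // ltW.
have Da : D (a t) by apply: a_in; rewrite ltW.
have n0 := chart_neq0 Da.
move: at1; rewrite -(chart_domain Da) -(moeb_swap xy n0) (moebK yx) normcV e.
by rewrite ltf_pV2 ?posrE // normc_gt0.
Qed.

Lemma alpha_joined (O : set C) t t' : t <= t' -> t' < 1 -> (forall u, t <= u <= t' -> O (alpha u)) ->
  joined O (alpha t) (alpha t').
Proof.
move=> tt t1 hO; apply: joined_itv => //; apply: cont_on_within => u.
by rewrite /= in_itv /= => /andP[_ ut]; apply: alpha_cont; exact: le_lt_trans t1.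
Qed.

Lemma alpha_notin_part t : t < 1 -> ~ L (alpha t).
Proof. by move=> t1 [_]; apply; exact: alpha_in. Qed.

Let xo : C := ((r2 + 1)%:C)%C.

Lemma join_out th r : th <= r < 1 -> r2 < normc (alpha r) ->
  (forall t, th <= t <= r -> r1 < normc (alpha t)) ->
  joined (~` (inner_disc r1 `|` L)) (alpha th) xo.
Proof.
move=> /andP[thr r1'] ar hr.
have r20 : 0 < r2 by exact: lt_trans r12.
have nxo : normc xo = r2 + 1 by rewrite /xo normc_real gtr0_norm // addr_gt0.
apply: (@joined_trans _ _ _ (alpha r)).
  apply: alpha_joined => // t tt [|]; last by apply: alpha_notin_part; case/andP: tt => _ /le_lt_trans; apply.
  by rewrite /inner_disc /= leNgt (hr t tt).
apply: (@joined_sub _ [set v | r2 < normc v]).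
  move=> v /= v2 [|[/andP[_]]]; last by rewrite leNgt v2.
  by rewrite /inner_disc /= leNgt (lt_trans r12).
apply: (@joined_shell _ (fun s => r2 < s)) => //.
- by move=> b c d b2 _ /andP[bd _]; exact: lt_le_trans bd.
- by rewrite -normc_gt0 (lt_trans r20).
- by rewrite -normc_gt0 nxo addr_gt0.
- by rewrite nxo ltrDl.
Qed.

Lemma join_in th l : l <= th < 1 -> normc (alpha l) <= r1 ->
  (forall t, l <= t <= th -> normc (alpha t) < r2) ->
  joined (~` (L `|` outer_ring r2)) (alpha th) 0.
Proof.
move=> /andP[lth th1] al hl; have l1 : l < 1 by exact: le_lt_trans th1.
apply: (@joined_trans _ _ _ (alpha l)).
  apply: joined_sym; apply: alpha_joined => // t tt [|]; first by apply: alpha_notin_part; case/andP: tt => _ /le_lt_trans; apply.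
  by rewrite /outer_ring /= => /andP[]; rewrite leNgt (hl t tt).
apply: joined_seg => t /andP[t0 t1].
have -> : alpha l + (t%:C)%C * (0 - alpha l) = ((1 - t)%:C)%C * alpha l.
  by rewrite sub0r mulrN rmorphB mulrBl mul1r.
have nt : normc (((1 - t)%:C)%C * alpha l) = (1 - t) * normc (alpha l).
  by rewrite normcM normc_real ger0_norm // subr_ge0.
have h0 := normc_ge0 (alpha l).
case=> [[]|]; rewrite ?/outer_ring /= nt => /andP[h1 h2].
  have [->|tn0] := eqVneq t 0; first by rewrite subr0 mul1r => nD; apply: nD; exact: alpha_in.
  have t00 : 0 < t by rewrite lt_neqAle eq_sym tn0.
  have h3 : 0 < t * r1 by rewrite mulr_gt0.
  have h4 : 0 <= (1 - t) * (r1 - normc (alpha l)) by rewrite mulr_ge0 ?subr_ge0.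
  by exfalso; lra.
have h3 : (1 - t) * normc (alpha l) <= normc (alpha l) by rewrite ler_piMl // gerBl.
by have := lt_le_trans r12 (le_trans h1 (le_trans h3 al)); rewrite ltxx.
Qed.

(** The contradiction described at the top: with finitely many crossing
    components, infinitely many strands of [alpha] are joined in the ring, and
    [path_avoiding] yields a path which possesses the prime end but stays away
    from [x]. *)
Theorem infinitely_many_crossings : ~ finite_set (crossing_component r1 r2 L).
Proof.
move=> fin; have r20 : 0 < r2 by exact: lt_trans r12.
have cD : closed (~` D) by exact: open_closedC.
have cL : compact L by exact: compact_ring_part.
have sk (k : nat) : 1 - k.+1%:R^-1 < 1 :> R by rewrite gtrBl invr_gt0 ltr0n.
have [th hth] := choice (fun k => strand_time r12 alpha_cont alpha_goes_in alpha_goes_out (sk k)).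
have th1 k : th k < 1 by have [/andP[]] := hth k.
have th0 k : 0 <= th k.
  have [/andP[h _] _ _ _] := hth k; apply: le_trans (ltW h).
  by rewrite subr_ge0 invf_le1 ?ler1n.
pose v k := alpha (th k).
have [k0 hk0] : exists k0, forall n, exists2 k, (n <= k)%N & joined (open_gap r1 r2 L) (v k0) (v k).
  apply: (@infinitely_many_strands R r1 r2 L _ cL _ v 0 xo fin).
  - by rewrite r10.
  - by move=> w [].
  - by move=> k; have [_ h _ _] := hth k; split => //; exact: alpha_notin_part.
  - move=> k; have [_ _ [r hr [ar hr']] _] := hth k; exact: (join_out hr ar hr').
  - move=> k; have [_ _ _ [l /andP[_ hl] [al hl']]] := hth k.
    by apply: (@join_in _ l) => //; rewrite hl th1.
have [kap hkap] := choice (fun n => let: ex_intro2 k h1 h2 := hk0 n in ex_intro (fun k => (n <= k)%N /\ joined (open_gap r1 r2 L) (v k0) (v k)) k (conj h1 h2)).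
pose u n := v (kap n).
have [[fT injT surjT] dT] := hT.
have [hpa hea] := ha.
have b1 t : 0 <= t < 1 -> normc ((T \o a) t) < 1 by move=> /a_in; exact: image_in_disc.
have lim := endpoint_tends b1 hea.
have oE : open E by exact: (open_comp (fun w _ => @moeb_cont R x y xy w) oD).
have dtau w : E w -> cdiff (fun v => T (M v)) w by move=> Ew; apply: (cdiff_moeb xy); exact: dT.
have tau_inj w w' : E w -> E w' -> T (M w) = T (M w') -> w = w'.
  move=> Ew Ew' e; apply: (moeb_inj xy); apply: injT => //; by rewrite inE.
have [S hS] : exists S : C -> Chat, forall z, normc z < 1 -> D (S z) /\ T (S z) = z.
  have h z : exists q, normc z < 1 -> D q /\ T q = z.
    have [z1|z1] := ltP (normc z) 1; last by exists x.
    have [|q Dq <-] := surjT z; first by rewrite /unit_disc /= normcE ltcR.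
    by exists q.
  by have [S hS] := choice h; exists S.
have tau1 w : E w -> normc (T (M w)) < 1 by move=> Ew; exact: image_in_disc.
have fE z : normc z < 1 -> E (m (S z)) /\ T (M (m (S z))) = z.
  by move=> /hS[DS TS]; rewrite /E /= (chart_domain DS).
have [k l|e e0|g [cg gE gp]] := @path_avoiding R E (fun w => T (M w)) (fun z => m (S z)) oE dtau tau_inj tau1 fE
    loops_lift_closed p p1 r1 u r10.
- have [_ jk] := hkap k; have [_ jl] := hkap l.
  apply: joined_sub (joined_trans (joined_sym jk) jl) => w [/andP[w1 w2] nLw].
  split; last exact: ltW.
  by apply: contrapT => nE; apply: nLw; split => //; rewrite !ltW.
- have [s s1 hs] := lim e e0.
  have h0 : 0 < 1 - s by rewrite subr_gt0.
  have [N hN] := harmonic_lt h0; exists N.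
  have hth' n : (N <= n)%N -> s <= th (kap n).
    move=> Nn; have [/andP[h _] _ _ _] := hth (kap n); apply: le_trans (ltW h).
    rewrite lerBrDl -lerBrDr ltW // hN // (leq_trans Nn) //; by have [] := hkap n.
  have key t t' : s <= t -> 0 <= t -> t <= t' -> t' < 1 ->
      joined [set w | E w /\ normc (T (M w) - p) < e] (alpha t) (alpha t').
    move=> st t0 tt t1; apply: alpha_joined => // q /andP[tq qt].
    have q1 : q < 1 by exact: le_lt_trans t1.
    split; first exact: alpha_in.
    by rewrite M_alpha // max_r ?(le_trans t0) //; apply: hs; rewrite q1 (le_trans st).
  move=> k l Nk Nl; have [h|h] := leP (th (kap k)) (th (kap l)).
    by apply: key => //; exact: hth'.
  by apply: joined_sym; apply: key => //; [exact: hth'|exact: ltW].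
(* the image of g possesses the prime end but stays away from x *)
have gD t : 0 <= t < 1 -> D (M (g t)) by move=> /gE[].
have pos : possesses_prime_end D T (fun t => M (g t)) p.
  split.
    split; last by move=> _ [t + <-]; rewrite /= in_itv /=; exact: gD.
    apply: cont_on_within => t; rewrite /= in_itv /= => /andP[_ t1].
    apply: (@cc_comp R C Chat g M); [exact: cg|exact: (@moeb_cont R x y xy)].
  by apply: tends_endpoint => // t /gD; exact: image_in_disc.
have cm : {for x, continuous (fun q => normc (m q))}.
  by apply: cc_normc; exact: (@moeb_inv_cont R x y x xy).
have h : normc (m x) < r1 * expR (-5) by rewrite moeb_inv_x normc0 mulr_gt0 // expR_gt0.
have [t [/andP[_ t1] t0 /=]] := limit_set_visits (minimal pos) (rc_lt cm h) ltr01.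
rewrite (moebK xy); have [|_ /lt_trans h2 /h2] := gE t; first by rewrite ltW.
by rewrite ltxx.
Qed.

End separated_by_rings.

(** * The impression and the principal set *)

(** At a point [q] of [D] the map [T] is continuous, so [T q] would be the
    point [p] of the circle. *)
Lemma limit_set_outside (R : realType) (D : set (riemann_sphere R)) (T : riemann_sphere R -> R[i])
    (p : R[i]) (a : R -> riemann_sphere R) (q : riemann_sphere R) :
  conformal_onto_disc D T -> normc p = 1 -> possesses_prime_end D T a p -> limit_set D a q -> ~ D q.
Proof.
move=> hT p1 [[_ aD] ha] aq Dq; have [_ dT] := hT.
have b1 t : 0 <= t < 1 -> normc ((T \o a) t) < 1.
  by move=> t01; apply: (image_in_disc hT); apply: aD; exists t; rewrite //= in_itv.
have Tq := image_in_disc hT Dq.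
have d0 : 0 < (1 - normc (T q)) / 2 by rewrite divr_gt0 // subr_gt0.
have [s s1 hs] := endpoint_tends b1 ha d0.
have cT : {for q, continuous T} by exact: (derivable_at_cont (dT q Dq)).
have U1 := proj1 (ccP T q) cT _ d0.
have [t [/andP[st t1] _ /= h]] := limit_set_visits aq U1 s1.
have := hs t; rewrite (ltW st) t1 => /(_ erefl) /= h'.
have h1 := ler_distcD (T (a t)) p (T q); have h2 := lerB_distc p (T q).
by rewrite p1 [normc (p - T (a t))]distcC in h1 h2; lra.
Qed.

Theorem theorem2p5 (R : realType) (D : set (riemann_sphere R))
    (hDdom : domain D) (hDsc : simply_connected (R := R) D)
    (hDbd : exists a b : riemann_sphere R,
        [/\ a <> b, boundary D a & boundary D b])
    (T : riemann_sphere R -> R[i]) (hT : conformal_onto_disc D T)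
    (p : R[i]) (hp : unit_circle p)
    (Imp Prin : set (riemann_sphere R))
    (hImp : is_impression D T p Imp) (hPrin : is_principal_set D T p Prin)
    (x : riemann_sphere R) (hx : Prin x) :
  Imp `<=` closed_schoenflies_class (~` D) x.
Proof.
move=> y Iy; have [oD _ _] := hDdom.
have p1 : normc p = 1 by move: hp; rewrite /unit_circle /= normcE => /complexI.
have [[a ha aI] _] := hImp; have [_ minP] := hPrin.
have ax : limit_set D a x by exact: minP.
have ay : limit_set D a y by rewrite aI.
have nx : ~ D x by exact: (limit_set_outside hT p1 ha ax).
have ny : ~ D y by exact: (limit_set_outside hT p1 ha ay).
split => // B [[U V] [/= Ux Vy] UVB].
have [xy|xy] := pselect (x = y).
  exists (x, x); split; first by split => //; left.
  by apply: UVB; split => /=; [exact: nbhs_singleton|rewrite xy; exact: nbhs_singleton].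
have yx : y <> x by move=> e; apply: xy.
have /nbhsCP[e e0 he] : nbhs (0 : R[i]) (moeb x y @^-1` U).
  by apply: (moeb_cont xy); rewrite moeb0.
have /nbhsCP[d d0 hd] : nbhs (0 : R[i]) (moeb y x @^-1` V).
  by apply: (moeb_cont yx); rewrite moeb0.
(* [U] contains the images of [|w| < e], [V] those of [|w| > 1 / d] *)
pose r1 := e / 2; pose r2 := Num.max (2 / d) (e + 1).
have r10 : 0 < r1 by rewrite divr_gt0.
have re : r1 < e by rewrite /r1; lra.
have r12 : r1 < r2 by rewrite lt_max; apply/orP; right; lra.
have r20 : 0 < r2 by exact: lt_trans r12.
have minx a' : possesses_prime_end D T a' p -> limit_set D a' x by move=> /minP; exact.
have inf := infinitely_many_crossings oD hDsc hT p1 xy nx ny r10 r12 ha ax ay minx.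
have [v [w [v1 w2 rel]]] := crossing_components_schoenflies xy r10 r12 (open_closedC oD) inf.
exists (moeb x y v, moeb x y w); split => //; apply: UVB; split => /=.
  by apply: he; rewrite subr0 v1.
have w0 : w != 0 by rewrite -normc_gt0 w2.
rewrite -(moeb_swap xy w0); apply: hd; rewrite subr0 normcV w2.
rewrite -[ltRHS]invrK ltf_pV2 ?posrE ?invr_gt0 //.
by rewrite lt_max; apply/orP; left; rewrite -[ltLHS]mul1r ltr_pM2r ?invr_gt0 // ltr1n.
Qed.
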